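(* Let $1\le p<\infty$ and let $A=(a_{nk})_{n,k\ge0}$ be complex scalars with $\sum_k|a_{nk}|<\infty$ for each $n$. For holomorphic $f(z)=\sum_k\hat f(k)z^k$ on the unit disk put $S_n^A(f):=\sum_{k\ge0}a_{nk}\hat f(k)z^k$. If $\|S_n^A(f)-f\|_{H^p}\to0$ for all $f\in H^p$, then $\|S_n^A(g)-g\|_{A^p}\to0$ for all $g\in A^p$.
   Context: $H^p$ is the Hardy space of holomorphic $f$ on the unit disk $\mathbb D$ with $\|f\|_{H^p}=\sup_{r<1}\bigl(\frac1{2\pi}\int_0^{2\pi}|f(re^{i\theta})|^pd\theta\bigr)^{1/p}<\infty$. $A^p$ is the Bergman space of holomorphic $f$ on $\mathbb D$ with $\|f\|_{A^p}=\bigl(\frac1\pi\int_{\mathbb D}|f|^pdA\bigr)^{1/p}<\infty$, $dA$ area measure. *)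

(* Defs.v *)
From HB Require Import structures.
From mathcomp Require Import all_boot all_order all_algebra.
From mathcomp Require Import all_classical all_reals all_analysis.
From mathcomp Require Import complex.
Set Implicit Arguments. Unset Strict Implicit. Unset Printing Implicit Defensive.
Import Order.TTheory GRing.Theory Num.Theory.
Import numFieldNormedType.Exports.
Local Open Scope classical_set_scope.
Local Open Scope ring_scope.
Local Open Scope complex_scope.

(* The complex plane, viewed as a normed space over itself (so that limits
   h -> 0 range over complex h). *)
Notation Cplx R := ((R[i])^o).

Definition cpt (R : realType) (x y : R) : Cplx R := x +i* y.

Definition cderiv (R : realType) (f : Cplx R -> Cplx R) (z : Cplx R) : Cplx R :=
  lim ((fun h : Cplx R => (f (z + h) - f z) / h) @ (0 : Cplx R)^').

Definition holomorphic_disk (R : realType) (f : Cplx R -> Cplx R) : Prop :=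
  forall z : Cplx R, Normc.normc z < 1 ->
    cvg ((fun h : Cplx R => (f (z + h) - f z) / h) @ (0 : Cplx R)^').

Definition taylor_coef (R : realType) (f : Cplx R -> Cplx R) (k : nat) : Cplx R :=
  iter k (@cderiv R) f 0 / (k`!)%:R.

Definition SA (R : realType) (a : nat -> nat -> Cplx R) (n : nat)
  (f : Cplx R -> Cplx R) (z : Cplx R) : Cplx R :=
  limn (series (fun k => a n k * taylor_coef f k * z ^+ k)).

Definition integral_mean (R : realType) (p : R) (f : Cplx R -> Cplx R) (r : R)
  : \bar R :=
  (((pi *+ 2)^-1)%:E *
   \int[@lebesgue_measure R]_(t in `[0%R, (pi *+ 2)%R]%classic)
      (powR (Normc.normc (f (cpt (r * cos t) (r * sin t)))) p)%:E)%E.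

Definition hardy_norm (R : realType) (p : R) (f : Cplx R -> Cplx R) : \bar R :=
  ereal_sup [set (integral_mean p f r `^ p^-1)%E | r in `[0%R, 1%R[%classic].

Definition unit_disk (R : realType) : set (R * R) :=
  [set xy | xy.1 ^+ 2 + xy.2 ^+ 2 < 1].

Definition bergman_norm (R : realType) (p : R) (f : Cplx R -> Cplx R) : \bar R :=
  ((pi^-1)%:E *
   \int[((@lebesgue_measure R) \x (@lebesgue_measure R))%E]_(xy in @unit_disk R)
      (powR (Normc.normc (f (cpt xy.1 xy.2))) p)%:E) `^ p^-1.

(* Main.v *)
(* By the gliding hump argument, pointwise convergence of S_n on H^p gives a uniform bound
   ||S_n f - f||_{H^p} <= C ||f||_{H^p}. For |z| < 1 the function w |-> g(z w) extends past the
   unit circle, hence lies in H^p; multiplier operators commute with these dilations, so the circle means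
   A_n(z) = mean over t of |(S_n g - g)(z e^{it})|^p tend to 0 for every z in the disk and are
   bounded by C^p times the same mean A(z) of |g|^p. Area measure being rotation invariant,
   the integral over the disk of |S_n g - g|^p is that of A_n, and that of A is the integral
   of |g|^p, which is finite: dominated convergence concludes. *)
Require Import Defs.
From HB Require Import structures.
From mathcomp Require Import all_boot all_order all_algebra.
From mathcomp Require Import all_classical all_reals all_analysis.
From mathcomp Require Import complex measurable_realfun.
From mathcomp Require Import ring lra.
Set Implicit Arguments. Unset Strict Implicit. Unset Printing Implicit Defensive.
Import Order.TTheory GRing.Theory Num.Theory.
Import numFieldNormedType.Exports.
Local Open Scope classical_set_scope.
Local Open Scope ring_scope.

(** * Complex moduli *)

(** Holomorphy is given only as existence of complex derivatives, and Taylor coefficients as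
    iterated limits. Continuity of the derivative cannot be assumed, so Goursat's theorem is proved
    in polar coordinates, and Cauchy's formula and power series are derived from it. The H^p norm is
    a supremum that may be infinite. It is replaced by a gauge on coefficient sequences: the p-th
    power means on all circles of radius r < 1 are at most A^p. The uniform boundedness argument
    uses only formal properties of this gauge and a completeness property for rapidly decreasing
    series. To bring the uniform bound down to a single circle, the H^p norm of a dilate must be
    governed by its mean on the boundary circle. That is monotonicity of the integral means, which
    comes from the Poisson kernel and Jensen's inequality. No polar change of variables is made for
    area: averaging over rotations needs only Tonelli's theorem and rotation invariance of the
    product measure, which is obtained from shears. *)

Local Notation nc := Normc.normc.

Section ComplexModulus.
Context {R : realType}.
Implicit Types (z w u v : Cplx R) (e : R).

Lemma normE z : `|z| = (nc z)%:C%C.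
Proof. by []. Qed.

Lemma nc_ge0 z : 0 <= nc z.
Proof. by case: z => a b; rewrite /Normc.normc sqrtr_ge0. Qed.

Lemma ncD z w : nc (z + w) <= nc z + nc w.
Proof. exact: le_normcD. Qed.

Lemma ncN z : nc (- z) = nc z.
Proof. exact: normcN. Qed.

Lemma nc_distC z w : nc (z - w) = nc (w - z).
Proof. by rewrite -ncN opprB. Qed.

Lemma ncM z w : nc (z * w) = nc z * nc w.
Proof. exact: Normc.normcM. Qed.

Lemma ncV z : nc (z^-1) = (nc z)^-1.
Proof. exact: Normc.normcV. Qed.

Lemma ncX z n : nc (z ^+ n) = nc z ^+ n.
Proof. by elim: n => [|n ih]; rewrite ?expr0 ?Normc.normc1// !exprS ncM ih. Qed.

Lemma nc_eq0 z : (nc z == 0) = (z == 0).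
Proof.
apply/eqP/eqP => [|->]; [exact: Normc.eq0_normc | exact: Normc.normc0].
Qed.

Lemma nc_gt0 z : (0 < nc z) = (z != 0).
Proof. by rewrite lt_def nc_ge0 andbT nc_eq0. Qed.

Lemma nc_real (x : R) : nc (x%:C%C : Cplx R) = `|x|.
Proof. by rewrite /Normc.normc /= expr0n /= addr0 sqrtr_sqr. Qed.

Lemma nc_sum (I : Type) (s : seq I) (P : pred I) (F : I -> Cplx R) :
  nc (\sum_(i <- s | P i) F i) <= \sum_(i <- s | P i) nc (F i).
Proof.
elim/big_rec2: _ => [|i y x _ xy]; first by rewrite Normc.normc0.
by rewrite (le_trans (ncD _ _))// lerD2l.
Qed.

Lemma le_Re_nc z : `|complex.Re z| <= nc z.
Proof.
by case: z => a b /=; rewrite -sqrtr_sqr ler_wsqrtr// lerDl sqr_ge0.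
Qed.

Lemma le_Im_nc z : `|complex.Im z| <= nc z.
Proof.
by case: z => a b /=; rewrite -sqrtr_sqr ler_wsqrtr// lerDr sqr_ge0.
Qed.

Lemma nc_le_ReIm z : nc z <= `|complex.Re z| + `|complex.Im z|.
Proof.
rewrite -[leRHS]ger0_norm ?addr_ge0// -sqrtr_sqr; case: z => a b /=.
rewrite ler_wsqrtr// sqrrD !real_normK ?num_real// -addrA lerD2l lerDr.
by rewrite mulrn_wge0// mulr_ge0.
Qed.

Lemma gt0_complexE (e : R[i]) : 0 < e -> e = (complex.Re e)%:C%C /\ 0 < complex.Re e.
Proof. by case: e => a b; rewrite ltcE/= => /andP[/eqP -> ?]. Qed.

Lemma ReB z w : complex.Re (z - w) = complex.Re z - complex.Re w.
Proof. by case: z => a b; case: w. Qed.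

Lemma ImB z w : complex.Im (z - w) = complex.Im z - complex.Im w.
Proof. by case: z => a b; case: w. Qed.

Lemma ReD z w : complex.Re (z + w) = complex.Re z + complex.Re w.
Proof. by case: z => a b; case: w. Qed.

Lemma ImD z w : complex.Im (z + w) = complex.Im z + complex.Im w.
Proof. by case: z => a b; case: w. Qed.

(** The norm of [Cplx R] has values in [R[i]], so the radii of its balls are complex numbers with
    zero imaginary part. This and the next two lemmas restate limits with real moduli. *)
Lemma continuous_ncP (f : Cplx R -> Cplx R) z : {for z, continuous f} <->
  forall e, 0 < e -> exists2 d : R, 0 < d &
    forall w, nc (w - z) < d -> nc (f w - f z) < e.
Proof.
split=> [/cvgrPdist_lt cf e e0|cf].
  have /cf/nbhs_ballP[d /= d0 df] : (0 : R[i]) < e%:C%C by rewrite ltcR.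
  have [dE d0'] := gt0_complexE d0; exists (complex.Re d) => // w wz.
  have : ball z d w by rewrite -ball_normE /= normE dE ltcR nc_distC.
  by move=> /df; rewrite normE ltcR nc_distC.
apply/(@cvgrPdist_lt _ (Cplx R) _ (nbhs z)) => e /gt0_complexE[-> /cf[d d0 df]].
apply/nbhs_ballP; exists d%:C%C => /=; first by rewrite ltcR.
move=> w; rewrite -ball_normE /= normE ltcR nc_distC => /df.
by rewrite normE ltcR nc_distC.
Qed.

Lemma cvg_dnbhs_ncP (f : Cplx R -> Cplx R) (l : Cplx R) : f @ 0^' --> l <->
  forall e, 0 < e -> exists2 d : R, 0 < d &
    forall h, h != 0 -> nc h < d -> nc (f h - l) < e.
Proof.
split=> [/cvgrPdist_lt cf e e0|cf].
  have /cf/nbhs_ballP[d /= d0 df] : (0 : R[i]) < e%:C%C by rewrite ltcR.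
  have [dE d0'] := gt0_complexE d0; exists (complex.Re d) => // h h0 hd.
  have : ball (0 : Cplx R) d h by rewrite -ball_normE /= normE dE ltcR sub0r ncN.
  by move=> /df /(_ h0); rewrite normE ltcR nc_distC.
apply/(@cvgrPdist_lt _ (Cplx R) _ (0^')) => e /gt0_complexE[-> /cf[d d0 df]].
apply/nbhs_ballP; exists d%:C%C => /=; first by rewrite ltcR.
move=> h; rewrite -ball_normE /= normE ltcR sub0r ncN => hd h0.
by rewrite normE ltcR nc_distC df.
Qed.

Lemma cvgn_ncP (u : nat -> Cplx R) (l : Cplx R) : u n @[n --> \oo] --> l <->
  (fun n => nc (u n - l)) @ \oo --> (0 : R).
Proof.
split=> [/cvgrPdist_lt cf|/cvgrPdist_lt cf].
  apply/cvgrPdist_lt => e e0.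
  have e0' : (0 : R[i]) < e%:C%C by rewrite ltcR.
  near=> n; rewrite sub0r normrN ger0_norm ?nc_ge0// nc_distC -ltcR -normE.
  by near: n; exact: cf.
apply/(@cvgrPdist_lt _ (Cplx R) _ \oo) => e /gt0_complexE[-> /cf].
by apply: filterS => n; rewrite sub0r normrN ger0_norm ?nc_ge0// normE ltcR nc_distC.
Unshelve. all: by end_near. Qed.

(** The error form needs no division and includes w = z. Going back to the strict inequality of a
    limit costs the factor in [e / 2]. *)
Lemma derivable_ncP (f : Cplx R -> Cplx R) z : derivable f z 1 <->
  exists l : Cplx R, forall e, 0 < e -> exists2 d : R, 0 < d &
    forall w, nc (w - z) < d -> nc (f w - f z - l * (w - z)) <= e * nc (w - z).
Proof.
rewrite /derivable; split=> [/cvg_ex[l /cvg_dnbhs_ncP fl]|[l fl]].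
  exists l => e /fl[d d0 fd]; exists d => // w wz.
  have [->|wz0] := eqVneq w z; first by rewrite !subrr mulr0 subr0 Normc.normc0 mulr0.
  have h0 : w - z != 0 by rewrite subr_eq0.
  have /ltW := fd _ h0 wz.
  rewrite -(@ler_pM2r _ (nc (w - z))) ?nc_gt0// -ncM mulrBl.
  by rewrite /GRing.scale /= mulr1 subrK mulrAC mulVf// mul1r.
apply/cvg_ex; exists l; apply/cvg_dnbhs_ncP => e e0.
have /fl[d d0 fd] : 0 < e / 2 by rewrite divr_gt0.
exists d => // h h0 hd.
rewrite -(@ltr_pM2r _ (nc h)) ?nc_gt0// -ncM mulrBl.
rewrite /GRing.scale /= mulr1 mulrAC mulVf// mul1r.
have := fd (h + z); rewrite addrK => /(_ hd) /le_lt_trans; apply.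
by rewrite ltr_pM2r ?nc_gt0// gtr_pMr// invf_lt1// ltr1n.
Qed.

Lemma derivable_continuous (f : Cplx R -> Cplx R) z :
  derivable f z 1 -> {for z, continuous f}.
Proof. by move/derivable1_diffP/differentiable_continuous. Qed.

Lemma holomorphic_derivable (f : Cplx R -> Cplx R) z :
  cvg ((fun h : Cplx R => (f (z + h) - f z) / h) @ (0 : Cplx R)^') <->
  derivable f z 1.
Proof.
rewrite /derivable.
suff -> : (fun h : Cplx R => (f (z + h) - f z) / h) =
  (fun h : Cplx R => h^-1 *: (f (h *: 1 + z) - f z)) by [].
by apply/funext => h; rewrite /GRing.scale /= mulr1 (addrC h) mulrC.
Qed.

Lemma cderivE (f : Cplx R -> Cplx R) z (l : Cplx R) :
  (forall e, 0 < e -> exists2 d : R, 0 < d &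
    forall h, h != 0 -> nc h < d -> nc ((f (z + h) - f z) / h - l) < e) ->
  cderiv f z = l.
Proof. by move=> /cvg_dnbhs_ncP H; apply: cvg_lim. Qed.

End ComplexModulus.

(** * Integrals of continuous functions over segments *)

Section IntervalIntegrals.
Context {R : realType}.
Implicit Types (f g : R -> R) (a b m M : R).
Notation mu := (@lebesgue_measure R).

(** Continuity is two-sided even at the end points: the integrands are defined around the segment,
    and subspace topologies stay out of the way. *)
Definition cont_on f a b := forall t, a <= t <= b -> {for t, continuous f}.

Lemma cont_within f a b : cont_on f a b -> {within `[a, b], continuous f}.
Proof.
move=> cf; apply: continuous_in_subspaceT => t.
by rewrite inE/= in_itv/= => /cf.
Qed.

Lemma cont_integrable f a b : cont_on f a b -> mu.-integrable `[a, b] (EFin \o f).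
Proof.
by move=> cf; apply: continuous_compact_integrable; [exact: segment_compact|exact: cont_within].
Qed.

Lemma cont_onB f g a b : cont_on f a b -> cont_on g a b -> cont_on (f \- g) a b.
Proof. by move=> cf cg t tab; apply: continuousB; [exact: cf|exact: cg]. Qed.

Lemma cont_onD f g a b : cont_on f a b -> cont_on g a b -> cont_on (f \+ g) a b.
Proof. by move=> cf cg t tab; apply: continuousD; [exact: cf|exact: cg]. Qed.

Lemma cont_onM f g a b : cont_on f a b -> cont_on g a b -> cont_on (f \* g) a b.
Proof. by move=> cf cg t tab; apply: continuousM; [exact: cf|exact: cg]. Qed.

Lemma Int_cst c a b : a <= b -> \int[mu]_(t in `[a, b]) (cst c t) = c * (b - a) :> R.
Proof.
move=> ab; rewrite Rintegral_cst//= lebesgue_measure_itv/= lte_fin.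
by move: ab; rewrite le_eqVlt => /predU1P[->|->//]; rewrite ltxx/= subrr.
Qed.

Lemma Int_split f a m b : a <= m <= b -> cont_on f a b ->
  \int[mu]_(t in `[a, b]) f t = \int[mu]_(t in `[a, m]) f t + \int[mu]_(t in `[m, b]) f t.
Proof.
move=> /andP[am mb] cf.
have intf := cont_integrable cf.
have := @Rintegral_itvB R f (BLeft a) (BRight b) m intf.
rewrite !bnd_simp => /(_ am mb).
rewrite (Rintegral_itv_obnd_cbnd); last first.
  apply: integrableS intf => //; apply: subset_itv; by rewrite ?bnd_simp.
by move=> <-; rewrite addrC subrK.
Qed.

Lemma Int_le f g a b : cont_on f a b -> cont_on g a b ->
  (forall t, a <= t <= b -> f t <= g t) ->
  \int[mu]_(t in `[a, b]) f t <= \int[mu]_(t in `[a, b]) g t.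
Proof.
move=> cf cg fg; by apply: le_Rintegral => //; exact: cont_integrable.
Qed.

Lemma Int_bound f a b M : a <= b -> cont_on f a b ->
  (forall t, a <= t <= b -> `|f t| <= M) ->
  `|\int[mu]_(t in `[a, b]) f t| <= M * (b - a).
Proof.
move=> ab cf fM.
have cc c : cont_on (cst c) a b by move=> t _; exact: cst_continuous.
rewrite ler_norml -mulNr -!Int_cst// !Int_le// => t /fM; rewrite ler_norml => /andP[]//.
Qed.

Lemma IntB f g a b : cont_on f a b -> cont_on g a b ->
  \int[mu]_(t in `[a, b]) (f t - g t) =
  \int[mu]_(t in `[a, b]) f t - \int[mu]_(t in `[a, b]) g t.
Proof. by move=> cf cg; apply: RintegralB => //; exact: cont_integrable. Qed.

Lemma IntD f g a b : cont_on f a b -> cont_on g a b ->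
  \int[mu]_(t in `[a, b]) (f t + g t) =
  \int[mu]_(t in `[a, b]) f t + \int[mu]_(t in `[a, b]) g t.
Proof. by move=> cf cg; apply: RintegralD => //; exact: cont_integrable. Qed.

Lemma IntZ c f a b : cont_on f a b ->
  \int[mu]_(t in `[a, b]) (c * f t) = c * \int[mu]_(t in `[a, b]) f t.
Proof. by move=> cf; rewrite RintegralZl//; exact: cont_integrable. Qed.

Lemma Int_deriv f F a b : a <= b -> cont_on f a b ->
  (forall t : R, is_derive t (1 : R) (F : R -> R) (f t)) ->
  \int[mu]_(t in `[a, b]) f t = F b - F a.
Proof.
rewrite le_eqVlt => /predU1P[->|ab] cf dF.
  by rewrite set_itv1 Rintegral_set1 subrr.
rewrite /Rintegral (@continuous_FTC2 _ _ F)//.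
- exact: cont_within.
- have cF t : {for t, continuous F}.
    by apply/differentiable_continuous/derivable1_diffP; case: (dF t).
  split=> //.
  + exact: cvg_at_right_filter (cF a).
  + exact: cvg_at_left_filter (cF b).
- by move=> t _; rewrite derive1E; case: (dF t).
Qed.

End IntervalIntegrals.

(** * Goursat's theorem in polar coordinates *)

(** The supremum of the left end points works: by nestedness every left end point lies below every
    right end point. *)
Lemma nested_point {R : realType} (x h : nat -> R) :
  (forall n, 0 <= h n) ->
  (forall n, x n <= x n.+1) -> (forall n, x n.+1 + h n.+1 <= x n + h n) ->
  exists y, forall n, x n <= y <= x n + h n.
Proof.
move=> h0 xS xhS.
have xm n m : (n <= m)%N -> x n <= x m.
  by apply: (@homo_leq _ _ (fun a b => a <= b)) => //; exact: le_trans.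
have xhm n m : (n <= m)%N -> x m + h m <= x n + h n.
  apply: (@homo_leq _ (fun n => x n + h n) (fun a b => b <= a)) => //.
  by move=> a b c ba ac; exact: le_trans ac ba.
have xlt n m : x n <= x m + h m.
  have [nm|/ltnW mn] := leqP n m; first by rewrite (le_trans (xm _ _ nm))// lerDl.
  by rewrite (le_trans _ (xhm _ _ mn))// lerDl.
have sx : has_sup (range x).
  by split; [exists (x 0%N); exists 0%N|exists (x 0%N + h 0%N) => _ [n _ <-]].
exists (sup (range x)) => n; apply/andP; split.
  by apply: ub_le_sup; [case: sx|exists n].
by apply: ge_sup; [case: sx|move=> _ [m _ <-]].
Qed.

Lemma half_pow_lt {R : realType} (c d : R) : 0 < d -> exists n, c / 2 ^+ n < d.
Proof.
move=> d0; exists (Num.bound (c / d)).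
rewrite ltr_pdivrMr ?exprn_gt0// mulrC -ltr_pdivrMr//.
have [cd|cd] := leP 0 (c / d).
  rewrite (lt_trans (archi_boundP cd))// -natrX ltr_nat.
  exact: ltn_expl.
by rewrite (lt_trans cd)// exprn_gt0.
Qed.

Section Bisection.
Context {R : realType}.
Variables (Phi : R -> R -> R -> R -> R) (x0 t0 H K : R).
Hypotheses (H0 : 0 < H) (K0 : 0 < K).

Definition subrect (x t h k : R) :=
  [/\ 0 <= h, 0 <= k, x0 <= x /\ x + h <= x0 + H & t0 <= t /\ t + k <= t0 + K].

Hypothesis quarter : forall x t h k : R, subrect x t h k ->
  `|Phi x t h k| <= `|Phi x t (h / 2) (k / 2)| + `|Phi (x + h / 2) t (h / 2) (k / 2)| +
   (`|Phi x (t + k / 2) (h / 2) (k / 2)| + `|Phi (x + h / 2) (t + k / 2) (h / 2) (k / 2)|).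

Hypothesis local : forall x' t', x0 <= x' <= x0 + H -> t0 <= t' <= t0 + K ->
  forall e : R, 0 < e -> exists2 d : R, 0 < d & forall x t h k : R, subrect x t h k ->
    x <= x' <= x + h -> t <= t' <= t + k -> h < d -> k < d ->
    `|Phi x t h k| <= e * (h + k) ^+ 2.

(** If the full rectangle had a value of modulus E > 0, repeated quartering would give nested
    rectangles with values of modulus at least E / 4^n. Near their common point the bound in [local]
    is quadratic in the side lengths, so it also decays like 4^-n, with a constant as small as
    desired. *)
Lemma bisection_zero : Phi x0 t0 H K = 0.
Proof.
apply/eqP; rewrite -normr_eq0; apply/contraT; rewrite neq_lt ltNge normr_ge0/=.
have [E EE] : exists E : R, E = `|Phi x0 t0 H K| by eexists.
rewrite -EE => E0.
pose hh n := H / 2 ^+ n; pose kk n := K / 2 ^+ n.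
have hS n : hh n / 2 = hh n.+1 by rewrite /hh exprSr invfM mulrA.
have kS n : kk n / 2 = kk n.+1 by rewrite /kk exprSr invfM mulrA.
have h0 n : 0 <= hh n by rewrite divr_ge0// ltW.
have k0 n : 0 <= kk n by rewrite divr_ge0// ltW.
pose inv n (s : R * R) := subrect s.1 s.2 (hh n) (kk n) /\
  E / 4 ^+ n <= `|Phi s.1 s.2 (hh n) (kk n)|.
(* The implication stands under the existential, so that choice yields a total selection function,
   defined also where the invariant fails. *)
have step n s : exists s', inv n s -> inv n.+1 s' /\
   [/\ s.1 <= s'.1, s'.1 + hh n.+1 <= s.1 + hh n, s.2 <= s'.2 & s'.2 + kk n.+1 <= s.2 + kk n].
  have [[Qs Es]|ns] := pselect (inv n s); last by exists s => /ns.
  suff [a [b [Ea aE bE]]] : exists a b : R, [/\ E / 4 ^+ n.+1 <= `|Phi a b (hh n.+1) (kk n.+1)|,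
     a = s.1 \/ a = s.1 + hh n.+1 & b = s.2 \/ b = s.2 + kk n.+1].
    exists (a, b) => _; case: Qs => _ _ [sa sb] [sc sd].
    have := hS n; have := kS n; have := h0 n.+1; have := k0 n.+1.
    move: Ea; rewrite /inv /subrect /=; case: aE => ->; case: bE => -> Ea k' h' kE hE;
      clear -Ea k' h' kE hE sa sb sc sd;
      by split; [split; [split; [lra|lra|split; lra|split; lra]|exact: Ea]|split; lra].
  have := quarter Qs; rewrite hS kS.
  set p1 := Phi _ _ _ (kk n.+1); set p2 := Phi _ _ _ (kk n.+1).
  set p3 := Phi _ _ _ (kk n.+1); set p4 := Phi _ _ _ (kk n.+1) => qq.
  have [e1|e1] := leP (E / 4 ^+ n.+1) `|p1|.
    by exists s.1, s.2; split => //; left.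
  have [e2|e2] := leP (E / 4 ^+ n.+1) `|p2|.
    by exists (s.1 + hh n.+1), s.2; split => //; [right|left].
  have [e3|e3] := leP (E / 4 ^+ n.+1) `|p3|.
    by exists s.1, (s.2 + kk n.+1); split => //; [left|right].
  have [e4|e4] := leP (E / 4 ^+ n.+1) `|p4|.
    by exists (s.1 + hh n.+1), (s.2 + kk n.+1); split => //; right.
  have E4 : E / 4 ^+ n = E / 4 ^+ n.+1 *+ 4 by rewrite exprSr -mulr_natr; field; rewrite ?expf_neq0.
  exfalso; move: Es; rewrite E4 leNgt (le_lt_trans qq)//.
  by rewrite (_ : 4 = 2 + 2)%N// mulrnDr !mulr2n; do ! apply: ltrD.
have /choice[stp stpP] : forall ns : nat * (R * R), exists s', inv ns.1 ns.2 ->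
   inv ns.1.+1 s' /\
   [/\ ns.2.1 <= s'.1, s'.1 + hh ns.1.+1 <= ns.2.1 + hh ns.1,
       ns.2.2 <= s'.2 & s'.2 + kk ns.1.+1 <= ns.2.2 + kk ns.1].
  by move=> [n s]; exact: step.
pose q := fix q n := if n is m.+1 then stp (m, q m) else (x0, t0).
have qinv n : inv n (q n).
  elim: n => [|n ih]; last by case: (stpP (n, q n) ih).
  rewrite /inv /subrect /= /hh /kk !expr0 !divr1.
  split; last
  by rewrite EE.
  by split; [exact: ltW|exact: ltW|split|split].
have qS n : [/\ (q n).1 <= (q n.+1).1, (q n.+1).1 + hh n.+1 <= (q n).1 + hh n,
     (q n).2 <= (q n.+1).2 & (q n.+1).2 + kk n.+1 <= (q n).2 + kk n].
  by case: (stpP (n, q n) (qinv n)).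
have [y yP] := @nested_point R (fun n => (q n).1) hh h0 (fun n => let: And4 a _ _ _ := qS n in a)
  (fun n => let: And4 _ a _ _ := qS n in a).
have [s sP] := @nested_point R (fun n => (q n).2) kk k0 (fun n => let: And4 _ _ a _ := qS n in a)
  (fun n => let: And4 _ _ _ a := qS n in a).
have := yP 0%N; have := sP 0%N; rewrite /= /hh /kk !expr0 !divr1 => sK yH.
have HK0 : 0 < (H + K) ^+ 2 by rewrite exprn_gt0// addr_gt0.
(* With this constant the local bound at stage n is exactly half of E / 4^n, because the sides add
   up to (H + K) / 2^n. *)
have e0 : 0 < E / (2 * (H + K) ^+ 2) by rewrite divr_gt0// mulr_gt0.
have [d d0 dP] := local yH sK e0.
have [n nd] := half_pow_lt (H + K) d0.
have hnd : hh n < d by apply: le_lt_trans nd; rewrite ler_pM2r ?invr_gt0 ?exprn_gt0// lerDl ltW.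
have knd : kk n < d by apply: le_lt_trans nd; rewrite ler_pM2r ?invr_gt0 ?exprn_gt0// lerDr ltW.
have [Qn En] := qinv n.
have := dP _ _ _ _ Qn (yP n) (sP n) hnd knd.
move/(le_trans En).
have -> : E / (2 * (H + K) ^+ 2) * (hh n + kk n) ^+ 2 = E / 4 ^+ n / 2.
  have -> : 4 = 2 ^+ 2 :> R by rewrite -natrX.
  rewrite -exprM mulnC exprM /hh /kk; field.
  by rewrite expf_neq0//= gt_eqF// addr_gt0.
have : 0 < E / 4 ^+ n by rewrite divr_gt0// exprn_gt0.
by move: (E / 4 ^+ n) => u u0 uu; lra.
Qed.
End Bisection.

Section Polar.
Context {R : realType}.
Implicit Types (r t x s : R) (z w : Cplx R).

Definition pt r t : Cplx R := cpt (r * cos t) (r * sin t).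

Lemma ptE r t : pt r t = r%:C%C * pt 1 t.
Proof. by apply/eqP; rewrite /pt /cpt eq_complex /= !mul1r !mul0r subr0 addr0 !eqxx. Qed.

Lemma nc_pt1 t : nc (pt 1 t) = 1.
Proof. by rewrite /pt /cpt /Normc.normc /= !mul1r cos2Dsin2 sqrtr1. Qed.

Lemma nc_pt r t : nc (pt r t) = `|r|.
Proof. by rewrite ptE ncM nc_pt1 mulr1 nc_real. Qed.

Lemma pt_2pi r : pt r (pi *+ 2) = pt r 0.
Proof. by rewrite /pt cos2pi sin2pi cos0 sin0. Qed.

Lemma lipschitz_of_deriv (f : R -> R) (df : R -> R) :
  (forall x : R, is_derive x (1 : R) f (df x)) -> (forall x, `|df x| <= 1) ->
  forall x y, `|f x - f y| <= `|x - y|.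
Proof.
move=> fdf df1 x y; wlog yx : x y / y < x.
  move=> H; case: (ltgtP x y) => [xy|yx|->]; last by rewrite !subrr.
    by rewrite distrC (distrC x); exact: H.
  exact: H.
have fd (z : R) : z \in `]y, x[ -> is_derive z (1 : R) f (df z) by move=> _; exact: fdf.
have cf : {within `[y, x], continuous f}.
  apply: continuous_subspaceT => z.
  by apply/differentiable_continuous/derivable1_diffP; case: (fdf z).
have [c _ ->] := MVT yx fd cf.
by rewrite normrM ler_piMl.
Qed.

(** The increment splits into a radial and an angular part; the factor 2 comes from bounding the
    cosine and sine increments separately. *)
Lemma nc_pt_sub r t r' t' : nc (pt r t - pt r' t') <= `|r - r'| + `|r'| * (2 * `|t - t'|).
Proof.
have -> : pt r t - pt r' t' = (r - r')%:C%C * pt 1 t + r'%:C%C * (pt 1 t - pt 1 t').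
  by rewrite (ptE r) (ptE r') rmorphB mulrBl mulrBr addrA subrK.
rewrite (le_trans (ncD _ _))// !ncM !nc_real nc_pt1 mulr1 lerD2l ler_wpM2l//.
rewrite (le_trans (nc_le_ReIm _))// ReB ImB /pt /= !mul1r.
rewrite mulr_natl mulr2n lerD//.
  apply: (@lipschitz_of_deriv cos (fun t => - sin t)) => x.
  by rewrite normrN ler_norml sin_geN1 sin_le1.
apply: (@lipschitz_of_deriv sin cos) => x.
by rewrite ler_norml cos_geN1 cos_le1.
Qed.

(** Real part, imaginary part and modulus are treated at once through this property; a truncated and
    rescaled p-th power of the modulus joins them later. *)
Definition contr1 (G : Cplx R -> R) := forall z w, `|G z - G w| <= nc (z - w).

Lemma contr1_Re : contr1 (@complex.Re R).
Proof. by move=> z w; rewrite -ReB le_Re_nc. Qed.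

Lemma contr1_Im : contr1 (@complex.Im R).
Proof. by move=> z w; rewrite -ImB le_Im_nc. Qed.

Lemma contr1_nc : contr1 (@Normc.normc R).
Proof.
move=> z w; rewrite ler_norml lerBlDr lerNl opprB lerBlDr; apply/andP; split.
  by rewrite nc_distC (le_trans _ (ncD _ _))// subrK.
by rewrite (le_trans _ (ncD _ _))// subrK.
Qed.

Lemma contr1_continuous (G : Cplx R -> R) (f : Cplx R -> Cplx R) (phi : R -> Cplx R) (s L : R) :
  contr1 G -> (forall s', nc (phi s' - phi s) <= L * `|s' - s|) ->
  {for phi s, continuous f} -> {for s, continuous (G \o f \o phi)}.
Proof.
move=> cG phiL /continuous_ncP cf; apply/cvgrPdist_lt => e /cf[d d0 df].
have L0 : 0 < `|L| + 1 by rewrite ltr_pwDr.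
have dL : 0 < d / (`|L| + 1) by rewrite divr_gt0.
apply/nbhs_ballP; exists (d / (`|L| + 1)) => //= s'.
rewrite /ball_/= distrC ltr_pdivlMr// => sd.
rewrite distrC (le_lt_trans (cG _ _))// df// (le_lt_trans (phiL _))//.
rewrite (le_lt_trans _ sd)// mulrC ler_wpM2l// (le_trans (ler_norm _))// lerDl//.
Qed.

Lemma continuous_angle (G : Cplx R -> R) (f : Cplx R -> Cplx R) r t :
  contr1 G -> {for pt r t, continuous f} -> {for t, continuous (fun t => G (f (pt r t)))}.
Proof.
move=> cG; apply: (@contr1_continuous _ _ _ _ (`|r| * 2)) => // s'.
by rewrite (le_trans (nc_pt_sub _ _ _ _))// subrr normr0 add0r mulrA.
Qed.

Lemma continuous_radius (G : Cplx R -> R) (f : Cplx R -> Cplx R) r t :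
  contr1 G -> {for pt r t, continuous f} -> {for r, continuous (fun r => G (f (pt r t)))}.
Proof.
move=> cG; apply: (@contr1_continuous _ _ (fun r => pt r t) _ 1) => // s'.
by rewrite (le_trans (nc_pt_sub _ _ _ _))// subrr normr0 !mulr0 addr0 mul1r.
Qed.

End Polar.

Lemma ler_norm2D {R : realDomainType} (a b D : R) :
  `|a| <= D -> `|b| <= D -> `|a - b| <= 2 * D.
Proof.
by move=> aD bD; rewrite mulr_natl mulr2n (le_trans (ler_normB _ _))// lerD.
Qed.

Section Goursat.
Context {R : realType}.
Notation mu := (@lebesgue_measure R).
Variables (f : Cplx R -> Cplx R) (x1 x2 : R).
Hypotheses (x10 : 0 < x1) (x12 : x1 < x2).
Hypothesis df : forall z, x1 <= nc z <= x2 -> derivable f z 1.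

(* In polar coordinates F(x, t) = f(x e^{it}), the Cauchy-Riemann equation F_t = i x F_x has
   real form (Re F)_x = ((Im F) / x)_t, so Phi below is additive in the rectangle and
   vanishes for affine f. Goursat's bisection then gives Phi = 0 without continuity of f'. *)
Let U (x t : R) := complex.Re (f (pt x t)).
Let W (x t : R) := complex.Im (f (pt x t)) / x.
Let A (x a b : R) := \int[mu]_(s in `[a, b]) U x s.
Let B (s a b : R) := \int[mu]_(y in `[a, b]) W y s.
Let Phi (x t h k : R) :=
  A (x + h) t (t + k) - A x t (t + k) - (B (t + k) x (x + h) - B t x (x + h)).

Let cf x t : x1 <= x <= x2 -> {for pt x t, continuous f}.
Proof.
move=> x12'; apply/derivable_continuous/df; rewrite nc_pt ger0_norm//.
by case/andP: x12' => + _; apply: le_trans; exact: ltW.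
Qed.

Let cU x a b : x1 <= x <= x2 -> cont_on (U x) a b.
Proof. by move=> xx t _; apply: (continuous_angle contr1_Re); exact: cf. Qed.

Let cW s a b : x1 <= a -> b <= x2 -> cont_on (W ^~ s) a b.
Proof.
move=> ax bx y /andP[ay yb]; have xy := le_trans ax ay.
apply: (@continuousM R R (fun y => complex.Im (f (pt y s))) (fun y => y^-1)).
  by apply: (continuous_radius contr1_Im); apply: cf; rewrite xy (le_trans yb).
by apply: continuousV => //; rewrite gt_eqF// (lt_le_trans x10).
Qed.

(** Both kinds of side integrals split at the midpoints, and the contributions of the interior cuts
    cancel in pairs. *)
Let quarter x t h k : subrect x1 0 (x2 - x1) (pi *+ 2) x t h k ->
  `|Phi x t h k| <= `|Phi x t (h / 2) (k / 2)| + `|Phi (x + h / 2) t (h / 2) (k / 2)| +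
   (`|Phi x (t + k / 2) (h / 2) (k / 2)| + `|Phi (x + h / 2) (t + k / 2) (h / 2) (k / 2)|).
Proof.
move=> [h0 k0 [xx]]; rewrite (addrC x1) subrK => xh _.
have h20 : 0 <= h / 2 by rewrite divr_ge0.
have k20 : 0 <= k / 2 by rewrite divr_ge0.
have hE : x + h / 2 + h / 2 = x + h by field.
have kE : t + k / 2 + k / 2 = t + k by field.
have xhE : x + h / 2 <= x2 by rewrite (le_trans _ xh)// -hE lerDl.
have xhx1 : x1 <= x + h / 2 by rewrite (le_trans xx)// lerDl.
have xhx1' : x1 <= x + h by rewrite (le_trans xx)// lerDl.
have xx2 : x <= x2 by rewrite (le_trans _ xh)// lerDl.
have As y : x1 <= y <= x2 -> A y t (t + k) = A y t (t + k / 2) + A y (t + k / 2) (t + k).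
  move=> yx; apply: Int_split; last exact: cU.
  by rewrite lerDl k20 -kE lerDl k20.
have Bs s : B s x (x + h) = B s x (x + h / 2) + B s (x + h / 2) (x + h).
  apply: Int_split; last exact: cW.
  by rewrite lerDl h20 -hE lerDl h20.
have -> : Phi x t h k = Phi x t (h / 2) (k / 2) + Phi (x + h / 2) t (h / 2) (k / 2) +
   (Phi x (t + k / 2) (h / 2) (k / 2) + Phi (x + h / 2) (t + k / 2) (h / 2) (k / 2)).
  rewrite /Phi hE kE !As ?xhx1' ?xx ?Bs//; ring.
by rewrite (le_trans (ler_normD _ _))// lerD// ler_normD.
Qed.

(** The affine approximation of f at the base point has vanishing [Phi], so only the remainder
    counts. It is at most a small multiple of h + k, and integration along the sides supplies the
    second factor h + k. *)
Let local x' t' : x1 <= x' <= x1 + (x2 - x1) -> 0 <= t' <= 0 + pi *+ 2 ->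
  forall e : R, 0 < e -> exists2 d : R, 0 < d & forall x t h k : R,
    subrect x1 0 (x2 - x1) (pi *+ 2) x t h k ->
    x <= x' <= x + h -> t <= t' <= t + k -> h < d -> k < d ->
    `|Phi x t h k| <= e * (h + k) ^+ 2.
Proof.
rewrite (addrC x1) subrK => xx' _ e e0.
have x'0 : 0 < x' by case/andP: xx' => + _; apply: lt_le_trans.
have x20 : 0 < x2 by exact: lt_trans x12.
set z0 := pt x' t'.
have /derivable_ncP[l fl] : derivable f z0 1 by apply: df; rewrite nc_pt gtr0_norm.
(* [c * (h + k)] bounds distances in the plane within a polar rectangle. In [q] below, 2 accounts
   for pairs of opposite sides, 1 for the circular sides, and [x1^-1] for the radial ones, where [W]
   divides by the radius. *)
pose c := 1 + 2 * x2.
have c0 : 0 < c by rewrite ltr_pwDl// mulr_ge0// ltW.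
pose q := 2 * c * (1 + x1^-1).
have q0 : 0 < q by rewrite !mulr_gt0// ltr_pwDl// invr_ge0 ltW.
have [d d0 fd] := fl _ (divr_gt0 e0 q0).
exists (d / (2 * c)); first by rewrite divr_gt0// mulr_gt0.
move=> x t h k [h0 k0 [xx]]; rewrite (addrC x1) subrK => xh _ xxh ttk hd kd.
have xxE : x1 <= x <= x2 by rewrite xx (le_trans _ xh)// lerDl.
have xhE : x1 <= x + h <= x2 by rewrite xh (le_trans xx)// lerDl.
have near y s : x <= y <= x + h -> t <= s <= t + k -> nc (pt y s - z0) <= c * (h + k).
  move=> /andP[yx yh] /andP[st sk]; apply: (le_trans (nc_pt_sub _ _ _ _)).
  case/andP: xxh => ? ?; case/andP: ttk => ? ?.
  have yx' : `|y - x'| <= h by rewrite ler_norml; apply/andP; split; lra.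
  have st' : `|s - t'| <= k by rewrite ler_norml; apply/andP; split; lra.
  have : `|x'| * (2 * `|s - t'|) <= x2 * (2 * k).
    rewrite ler_pM// ?mulr_ge0// ?ler_pM2l// gtr0_norm//.
    by case/andP: xx'.
  have : 0 <= x2 * h by rewrite mulr_ge0// ltW.
  by rewrite /c; lra.
have small y s : x <= y <= x + h -> t <= s <= t + k ->
    nc (f (pt y s) - f z0 - l * (pt y s - z0)) <= e / q * (c * (h + k)).
  move=> yx st; have := near _ _ yx st => nys.
  apply: (le_trans (fd _ _)); last by rewrite ler_pM2l ?divr_gt0.
  apply: (le_lt_trans nys).
  move: hd kd; rewrite !ltr_pdivlMr ?mulr_gt0// => hd kd.
  rewrite -(@ltr_pM2l _ 2)// mulrA mulrDr; lra.
set D := e / q * (c * (h + k)) in small.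
pose b1 := complex.Re l; pose b2 := complex.Im l.
(* At radius y and angle s, l z has real part y [m s] and imaginary part y [M s]. That [m] is the
   derivative of [M] is the Cauchy-Riemann equation of the linear part. *)
pose M s := b1 * sin s + b2 * cos s; pose m s := b1 * cos s - b2 * sin s.
have dM s : is_derive s (1 : R) (M : R -> R) (m s).
  have := is_deriveD (is_deriveZ b1 (is_derive_sin s)) (is_deriveZ b2 (is_derive_cos s)).
  rewrite (_ : m s = b1 *: cos s + b2 *: - sin s); first exact.
  by rewrite /m /GRing.scale /= mulrN.
have cm a b : cont_on m a b.
  by move=> s _; apply: continuousB; apply: continuousM; try exact: cst_continuous;
    [exact: continuous_cos|exact: continuous_sin].
have intm : \int[mu]_(s in `[t, t + k]) (h * m s) = h * (M (t + k) - M t).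
  by rewrite IntZ// (Int_deriv _ (cm _ _) dM)// lerDl.
have intM : \int[mu]_(y in `[x, x + h]) (cst (M (t + k) - M t) y) = h * (M (t + k) - M t).
  by rewrite Int_cst ?lerDl// mulrC; congr (_ * _); lra.
have cUh : cont_on (fun s => U (x + h) s - U x s) t (t + k).
  by apply: cont_onB; exact: cU.
have ccm : cont_on (fun s => h * m s) t (t + k).
  by apply: (@cont_onM R (cst h)) => // s _; exact: cst_continuous.
have cWk : cont_on (fun y => W y (t + k) - W y t) x (x + h).
  by apply: cont_onB; apply: cW => //; case/andP: xhE.
have cc : cont_on (cst (M (t + k) - M t)) x (x + h) by move=> s _; exact: cst_continuous.
(* The linear part enters both integrals with the same value h (M (t + k) - M t), so it may be
   subtracted from each. *)
have -> : Phi x t h k = \int[mu]_(s in `[t, t + k]) (U (x + h) s - U x s - h * m s) -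
   \int[mu]_(y in `[x, x + h]) (W y (t + k) - W y t - cst (M (t + k) - M t) y).
  rewrite (IntB cUh ccm) (IntB cWk cc) intm intM IntB; [|exact: cU..].
  rewrite (@IntB _ (W ^~ (t + k)) (W ^~ t)); first by rewrite /Phi /A /B; ring.
    by apply: cW => //; case/andP: xhE.
  by apply: cW => //; case/andP: xhE.
have ReL y s : complex.Re (l * pt y s) = y * m s.
  by rewrite /pt /m /b1 /b2; case: (l) => l1 l2 /=; ring.
have ImL y s : complex.Im (l * pt y s) = y * M s.
  by rewrite /pt /M /b1 /b2; case: (l) => l1 l2 /=; ring.
have smallRe y s : x <= y <= x + h -> t <= s <= t + k ->
   `|U y s - complex.Re (f z0) - (y * m s - complex.Re (l * z0))| <= D.
  move=> yx st; have := le_trans (le_Re_nc _) (small _ _ yx st).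
  by rewrite !ReB mulrBr ReB ReL.
have smallIm y s : x <= y <= x + h -> t <= s <= t + k ->
   `|complex.Im (f (pt y s)) - complex.Im (f z0) - (y * M s - complex.Im (l * z0))| <= D.
  move=> yx st; have := le_trans (le_Im_nc _) (small _ _ yx st).
  by rewrite !ImB mulrBr ImB ImL.
have xl : x <= x <= x + h by rewrite lexx lerDl.
have xr : x <= x + h <= x + h by rewrite lexx lerDl h0.
have tl : t <= t <= t + k by rewrite lexx lerDl.
have tr : t <= t + k <= t + k by rewrite lexx lerDl k0.
have b1' : `|\int[mu]_(s in `[t, t + k]) (U (x + h) s - U x s - h * m s)| <= 2 * D * (t + k - t).
  apply: Int_bound; [by rewrite lerDl|exact: cont_onB|move=> s st].
  have := ler_norm2D (smallRe _ s xr st) (smallRe _ s xl st).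
  by congr (`|_| <= _); ring.
have b2' : `|\int[mu]_(y in `[x, x + h]) (W y (t + k) - W y t - cst (M (t + k) - M t) y)| <=
    2 * D / x1 * (x + h - x).
  apply: Int_bound; [by rewrite lerDl|exact: cont_onB|move=> y yx].
  have y0 : 0 < y by case/andP: yx => + _; apply: lt_le_trans; exact: lt_le_trans xx.
  have -> : W y (t + k) - W y t - cst (M (t + k) - M t) y =
     (complex.Im (f (pt y (t + k))) - complex.Im (f (pt y t)) - (y * M (t + k) - y * M t)) / y.
    by rewrite /W /=; field; rewrite gt_eqF.
  rewrite normrM ler_pM// ?normfV.
    have := ler_norm2D (smallIm _ _ yx tr) (smallIm _ _ yx tl).
    by congr (`|_| <= _); ring.
  rewrite gtr0_norm// lef_pV2 ?posrE//.
  by case/andP: yx => + _; apply: le_trans.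
rewrite (le_trans (ler_normB _ _))// (le_trans (lerD b1' b2'))//.
have D0 : 0 <= D := mulr_ge0 (divr_ge0 (ltW e0) (ltW q0)) (mulr_ge0 (ltW c0) (addr_ge0 h0 k0)).
have -> : e * (h + k) ^+ 2 = 2 * D * (1 + x1^-1) * (h + k).
  rewrite /D /q; field.
  by rewrite !gt_eqF// ltr_pwDl// ltW.
have -> : t + k - t = k by ring.
have -> : x + h - x = h by ring.
have x1V : 0 <= x1^-1 by rewrite invr_ge0 ltW.
have D2 : 0 <= 2 * D by rewrite mulr_ge0.
have Dh : 0 <= 2 * D * h := mulr_ge0 D2 h0.
have Dk : 0 <= 2 * D * x1^-1 * k := mulr_ge0 (mulr_ge0 D2 x1V) k0.
have -> : 2 * D * (1 + x1^-1) * (h + k) =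
    2 * D * k + 2 * D / x1 * h + (2 * D * h + 2 * D / x1 * k) by ring.
by rewrite lerDl addr_ge0.
Qed.

(** The radial sides at angles 0 and 2 pi carry the same values and cancel; what remains of the
    vanishing [Phi] compares the two circles. *)
Lemma mean_Re_annulus :
  \int[mu]_(t in `[0, pi *+ 2]) complex.Re (f (pt x1 t)) =
  \int[mu]_(t in `[0, pi *+ 2]) complex.Re (f (pt x2 t)).
Proof.
have H0 : 0 < x2 - x1 by rewrite subr_gt0.
have K0 : 0 < pi *+ 2 :> R by rewrite pmulrn_lgt0// pi_gt0.
have := bisection_zero H0 K0 quarter local.
rewrite /Phi /B /W !add0r (addrC x1) subrK.
rewrite (_ : (fun y => complex.Im (f (pt y (pi *+ 2))) / y) = (fun y => complex.Im (f (pt y 0)) / y)).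
  by rewrite subrr subr0 => /eqP; rewrite subr_eq0 => /eqP.
by apply/funext => y; rewrite pt_2pi.
Qed.
End Goursat.

(** * Mean values, Cauchy and Poisson formulas *)

Section MeanValue.
Context {R : realType}.
Notation mu := (@lebesgue_measure R).

Lemma twopi_gt0 : 0 < pi *+ 2 :> R.
Proof. by rewrite pmulrn_lgt0// pi_gt0. Qed.

Lemma bounded_polar (f : Cplx R -> Cplx R) (a b : R) : a <= b ->
  (forall x t : R, a <= x <= b -> {for pt x t, continuous f}) ->
  exists2 M, 0 <= M & forall x t, a <= x <= b -> 0 <= t <= pi *+ 2 -> nc (f (pt x t)) <= M.
Proof.
move=> ab cf.
pose K := `[a, b]%classic `*` `[0, pi *+ 2]%classic : set (R * R).
have cK : compact K by apply: compact_setX; exact: segment_compact.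
have K0 : K !=set0.
  by exists (a, 0); split; rewrite /= in_itv/= lexx ?ab// ltW// twopi_gt0.
have cg : {within K, continuous (fun p : R * R => nc (f (pt p.1 p.2)))}.
  apply: continuous_in_subspaceT => -[x t]; rewrite inE => -[/=].
  rewrite in_itv/= => xab _.
  apply/cvgrPdist_lt => e e0.
  have /continuous_ncP /(_ _ e0)[d d0 df] := cf x t xab.
  have c0 : 0 < 1 + `|x| * 2 by rewrite ltr_pwDl// mulr_ge0.
  have dc0 : 0 < d / (1 + `|x| * 2) by rewrite divr_gt0.
  exists (ball x (d / (1 + `|x| * 2)), ball t (d / (1 + `|x| * 2))).
    by split; exact: nbhsx_ballx.
  move=> [y s] [/=]; rewrite /ball/= !ltr_pdivlMr//.
  rewrite (distrC x) (distrC t) => yx st.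
  rewrite distrC (le_lt_trans (contr1_nc _ _))// df// (le_lt_trans (nc_pt_sub _ _ _ _))//.
  have [yt|ty] := leP `|y - x| `|s - t|.
    apply: le_lt_trans st; rewrite mulrDr mulr1 lerD//.
    by rewrite mulrA mulrC.
  apply: le_lt_trans yx; rewrite mulrDr mulr1 lerD2l mulrA (mulrC `|y - x|) ler_wpM2l ?mulr_ge0//.
  exact: ltW.
have [[x0 t0] _ max] := compact_EVT_max K0 cK cg.
exists (nc (f (pt x0 t0))); first exact: nc_ge0.
by move=> x t xab tpi; apply: (max (x, t)); rewrite inE; split; rewrite /= in_itv.
Qed.

Lemma continuous_mean (f : Cplx R -> Cplx R) (G : Cplx R -> R) rho : contr1 G ->
  (forall z, nc z < rho -> {for z, continuous f}) ->
  forall x : R, `|x| < rho ->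
    {for x, continuous (fun x => \int[mu]_(t in `[0, pi *+ 2]) G (f (pt x t)))}.
Proof.
move=> cG cf x xr.
pose r := (`|x| + rho) / 2.
have xr' : `|x| < r by rewrite /r ltr_pdivlMr// mulr_natr mulr2n ltrD2l.
have rr' : r < rho by rewrite /r ltr_pdivrMr// mulr_natr mulr2n ltrD2r.
have cfr (y t : R) : - r <= y <= r -> {for pt y t, continuous f}.
  by rewrite -ler_norml => yr; apply: cf; rewrite nc_pt (le_lt_trans yr).
have r0 : 0 < r by rewrite (le_lt_trans _ xr').
have rr : - r <= r by rewrite (@le_trans _ _ 0) ?oppr_le0 ?(ltW r0).
have [M M0 fM] := bounded_polar rr cfr.
have xI : x \in `]- r, r[%classic by rewrite inE/= in_itv/= -ltr_norml.
have cang (y t : R) : `]- r, r[%classic y -> {for t, continuous (fun t => G (f (pt y t)))}.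
  rewrite /= in_itv/= => /andP[ry yr].
  by apply: (continuous_angle cG); apply: cfr; rewrite !ltW.
apply: (@continuity_under_integral R _ _ mu (fun x t => G (f (pt x t))) `[0, pi *+ 2]%classic
  _ (- r) r _ _ (cst (`|G 0| + M))) xI => //.
- by move=> y ry; apply: cont_integrable => t _; exact: cang.
- apply: aeW => t _ y; rewrite inE/= in_itv/= => /andP[ry yr].
  by apply: (continuous_radius cG); apply: cfr; rewrite !ltW.
- by apply: cont_integrable => t _; exact: cst_continuous.
- move=> y; rewrite /= in_itv/= => /andP[ry yr].
  apply: aeW => t /=; rewrite in_itv/= => tpi.
  rewrite -[G (f _)](subrK (G 0)) addrC (le_trans (ler_normD _ _))// lerD2l.
  by rewrite (le_trans (cG _ _))// subr0 fM// !ltW.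
Qed.

Lemma eq_of_approx (I : R -> R) (c v : R) : {for c, continuous I} ->
  (forall d, 0 < d -> exists2 y, `|y - c| < d & I y = v) -> I c = v.
Proof.
move=> /cvgrPdist_lt cI H; apply/eqP; rewrite -subr_eq0 -normr_le0.
apply/ler_addgt0Pl => e e0; rewrite addr0.
have /nbhs_ballP[d /= d0 dI] := cI e e0.
have [y yc <-] := H _ d0.
by apply/ltW/dI; rewrite /ball/= distrC.
Qed.

(* f is only assumed continuous at z0, as needed for difference quotients in Cauchy's formula. *)
Lemma mean_value_Re (f : Cplx R -> Cplx R) (z0 : Cplx R) rho :
  (forall z, nc z < rho -> {for z, continuous f}) ->
  (forall z, nc z < rho -> z != z0 -> derivable f z 1) ->
  forall r, 0 <= r < rho ->
    \int[mu]_(t in `[0, pi *+ 2]) complex.Re (f (pt r t)) = complex.Re (f 0) * (pi *+ 2).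
Proof.
move=> cf df.
pose I x := \int[mu]_(t in `[0, pi *+ 2]) complex.Re (f (pt x t)).
have cI (x : R) : `|x| < rho -> {for x, continuous I} := @continuous_mean _ _ _ contr1_Re cf x.
pose c := nc z0.
(* Annuli that avoid the circle of radius [c] through the exceptional point preserve the mean;
   continuity of [I] then carries the value from radius 0 and across [c]. *)
have Ieq (x1 x2 : R) : 0 < x1 -> x1 < x2 -> x2 < rho -> ~~ (x1 <= c <= x2) -> I x1 = I x2.
  move=> x10 x12 x2r cx; apply: mean_Re_annulus => // z /andP[x1z zx2].
  apply: df; first exact: le_lt_trans x2r.
  by apply: contraNneq cx => zz0; rewrite /c -zz0 x1z.
have I0E : I 0 = complex.Re (f 0) * (pi *+ 2).
  have p00 t : pt (0 : R) t = 0 by rewrite ptE mul0r.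
  rewrite /I; under eq_Rintegral do rewrite p00.
  by rewrite (@Int_cst _ (complex.Re (f 0)) 0) ?subr0// ltW// twopi_gt0.
have below (x : R) : 0 < x -> x < c -> x < rho -> I x = I 0.
  move=> x0 xc xr; apply/esym; apply: eq_of_approx.
    by apply: cI; rewrite normr0 (lt_trans x0).
  move=> d d0; have m0 : 0 < Num.min d x by rewrite lt_min d0.
  have [m2 m2'] := midf_lt m0; rewrite add0r in m2 m2'.
  exists (Num.min d x / 2).
    by rewrite subr0 gtr0_norm// (lt_le_trans m2')// ge_min lexx.
  apply: Ieq => //; first by rewrite (lt_le_trans m2')// ge_min lexx orbT.
  by rewrite negb_and -!ltNge xc orbT.
have atc : 0 < c -> c < rho -> I c = I 0.
  move=> c0 cr; apply: eq_of_approx; first by apply: cI; rewrite gtr0_norm.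
  move=> d d0; pose u := Num.max (c - d) 0.
  have uc : u < c by rewrite gt_max c0 ltrBlDr ltrDl d0.
  have [m1 m2] := midf_lt uc.
  have m0 : 0 < (u + c) / 2 by rewrite (le_lt_trans _ m1)// le_max lexx orbT.
  exists ((u + c) / 2); last by apply: below => //; exact: lt_trans cr.
  rewrite ltr0_norm ?subr_lt0// opprB ltrBlDr -ltrBlDl (le_lt_trans _ m1)//.
  by rewrite le_max lexx.
have above (x : R) : 0 <= c -> c < x -> x < rho -> I x = I c.
  move=> c0 cx xr; apply/esym; apply: eq_of_approx.
    by apply: cI; rewrite ger0_norm// (lt_trans cx).
  move=> d d0; have cm : c < Num.min (c + d) x by rewrite lt_min cx ltrDl d0.
  have [m1 m2] := midf_lt cm.
  exists ((c + Num.min (c + d) x) / 2).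
    rewrite gtr0_norm ?subr_gt0// ltrBlDl (lt_le_trans m2)// ge_min lexx//.
  apply: Ieq => //; first exact: le_lt_trans m1.
    by rewrite (lt_le_trans m2)// ge_min lexx orbT.
  by rewrite negb_and -!ltNge m1.
move=> r /andP[r0 rr]; rewrite -I0E -/(I r).
have c0 : 0 <= c := nc_ge0 z0.
move: r0; rewrite le_eqVlt => /predU1P[<-//|r0].
have Ic : c < rho -> I c = I 0.
  by move: c0; rewrite le_eqVlt => /predU1P[<-//|]; exact: atc.
have [rc|cr|rc] := ltgtP r c; [exact: below| |by rewrite rc Ic// -rc].
by rewrite above// Ic// (lt_trans cr).
Qed.

End MeanValue.

(** * Complex circle means and reproducing kernels *)

Section CircleMeans.
Context {R : realType}.
Notation mu := (@lebesgue_measure R).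
Implicit Types (f g : Cplx R -> Cplx R) (r : R) (z w c : Cplx R).

Definition rmean (phi : R -> R) : R :=
  (pi *+ 2)^-1 * \int[mu]_(t in `[0, pi *+ 2]) phi t.

Definition cmean r f : Cplx R :=
  (rmean (fun t => complex.Re (f (pt r t))) +i* rmean (fun t => complex.Im (f (pt r t))))%C.

Definition on_circle r f := forall z, nc z = r -> {for z, continuous f}.

Lemma ctsD f g z : {for z, continuous f} -> {for z, continuous g} ->
  {for z, continuous (fun w : Cplx R => f w + g w : Cplx R)}.
Proof. by move=> cf cg; exact: (@continuousD _ (Cplx R) (Cplx R) f g z cf cg). Qed.

Lemma ctsM f g z : {for z, continuous f} -> {for z, continuous g} ->
  {for z, continuous (fun w : Cplx R => f w * g w : Cplx R)}.
Proof. by move=> cf cg; exact: (@continuousM _ (Cplx R) f g z cf cg). Qed.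

Lemma ctsZ c f z : {for z, continuous f} ->
  {for z, continuous (fun w : Cplx R => c * f w : Cplx R)}.
Proof. by move=> cf; exact: (@ctsM (fun=> c) f z (@cst_continuous _ _ c z) cf). Qed.

Lemma derM f g z : derivable f z 1 -> derivable g z 1 ->
  derivable (fun w : Cplx R => f w * g w : Cplx R) z 1.
Proof. by move=> df dg; exact: (@derivableM _ (Cplx R) f g z 1 df dg). Qed.

Lemma derZ c f z : derivable f z 1 -> derivable (fun w : Cplx R => c * f w : Cplx R) z 1.
Proof. by move=> df; exact: (@derM (fun=> c) f z (@derivable_cst _ (Cplx R) (Cplx R) c z 1) df). Qed.

Lemma derB f g z : derivable f z 1 -> derivable g z 1 ->
  derivable (fun w : Cplx R => f w - g w : Cplx R) z 1.
Proof. by move=> df dg; exact: (@derivableB _ (Cplx R) (Cplx R) f g z 1 df dg). Qed.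

Lemma derV f z : f z != 0 -> derivable f z 1 ->
  derivable (fun w : Cplx R => (f w)^-1 : Cplx R) z 1.
Proof. by move=> f0 df; exact: (@derivableV _ (Cplx R) f z 1 f0 df). Qed.

Lemma der_id z : derivable (fun w : Cplx R => w : Cplx R) z 1.
Proof. exact: derivable_id. Qed.

Lemma der_cst c z : derivable (fun w : Cplx R => c : Cplx R) z 1.
Proof. exact: derivable_cst. Qed.

Lemma circle_cont (G : Cplx R -> R) r f a b : 0 <= r -> contr1 G -> on_circle r f ->
  cont_on (fun t => G (f (pt r t))) a b.
Proof.
move=> r0 cG cf t _; apply: (continuous_angle cG); apply: cf.
by rewrite nc_pt ger0_norm.
Qed.

Lemma rmeanZ k (phi : R -> R) : cont_on phi 0 (pi *+ 2) ->
  rmean (fun t => k * phi t) = k * rmean phi.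
Proof. by move=> cphi; rewrite /rmean IntZ// mulrCA. Qed.

Lemma rmeanD (phi psi : R -> R) : cont_on phi 0 (pi *+ 2) -> cont_on psi 0 (pi *+ 2) ->
  rmean (fun t => phi t + psi t) = rmean phi + rmean psi.
Proof. by move=> cphi cpsi; rewrite /rmean IntD// mulrDr. Qed.

Lemma rmeanB (phi psi : R -> R) : cont_on phi 0 (pi *+ 2) -> cont_on psi 0 (pi *+ 2) ->
  rmean (fun t => phi t - psi t) = rmean phi - rmean psi.
Proof. by move=> cphi cpsi; rewrite /rmean IntB// mulrBr. Qed.

Lemma rmean_le (phi psi : R -> R) : cont_on phi 0 (pi *+ 2) -> cont_on psi 0 (pi *+ 2) ->
  (forall t, 0 <= t <= pi *+ 2 -> phi t <= psi t) -> rmean phi <= rmean psi.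
Proof.
move=> cphi cpsi pp; rewrite /rmean ler_pM2l ?invr_gt0 ?twopi_gt0//.
by apply: Int_le.
Qed.

Lemma rmean_cst k : rmean (fun=> k) = k.
Proof.
rewrite /rmean (Int_cst k (ltW twopi_gt0)) subr0 mulrC mulfK// gt_eqF//.
exact: twopi_gt0.
Qed.

Lemma eq_rmean (phi psi : R -> R) : phi =1 psi -> rmean phi = rmean psi.
Proof. by move=> pp; congr rmean; apply/funext. Qed.

Lemma eq_cmean r f g : 0 <= r -> (forall z, nc z = r -> f z = g z) -> cmean r f = cmean r g.
Proof.
move=> r0 fg; rewrite /cmean; congr (_ +i* _)%C; apply: eq_rmean => t.
  by rewrite fg// nc_pt ger0_norm.
by rewrite fg// nc_pt ger0_norm.
Qed.

Lemma cmeanB r f g : 0 <= r -> on_circle r f -> on_circle r g ->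
  cmean r (fun w => f w - g w) = cmean r f - cmean r g.
Proof.
move=> r0 cf cg; apply/eqP; rewrite eq_complex /=.
rewrite -!rmeanB; try by apply: circle_cont => //; [exact: contr1_Re|exact: contr1_Im].
  apply/andP; split; apply/eqP; apply: eq_rmean => t; [exact: ReB|exact: ImB].
all: try exact: (circle_cont _ contr1_Re).
all: exact: (circle_cont _ contr1_Im).
Qed.

Lemma cmeanD r f g : 0 <= r -> on_circle r f -> on_circle r g ->
  cmean r (fun w => f w + g w) = cmean r f + cmean r g.
Proof.
move=> r0 cf cg; apply/eqP; rewrite eq_complex /=.
rewrite -!rmeanD.
  apply/andP; split; apply/eqP; apply: eq_rmean => t; [exact: ReD|exact: ImD].
all: try exact: (circle_cont _ contr1_Re).
all: exact: (circle_cont _ contr1_Im).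
Qed.

Lemma cmeanZ r c f : 0 <= r -> on_circle r f ->
  cmean r (fun w => c * f w) = c * cmean r f.
Proof.
move=> r0 cf; case: c => a b; apply/eqP; rewrite eq_complex /=.
have cre := circle_cont (a := 0) (b := pi *+ 2) r0 contr1_Re cf.
have cim := circle_cont (a := 0) (b := pi *+ 2) r0 contr1_Im cf.
have cz k (phi : R -> R) : cont_on phi 0 (pi *+ 2) -> cont_on (fun t => k * phi t) 0 (pi *+ 2).
  by move=> cphi; apply: (@cont_onM R (cst k)) => // t _; exact: cst_continuous.
rewrite -!rmeanZ// -rmeanB; [|exact: cz|exact: cz].
rewrite -rmeanD; [|exact: cz|exact: cz].
apply/andP; split; apply/eqP; apply: eq_rmean => t.
  by case: (f _).
by case: (f _).
Qed.

Lemma cmean_sum r (c : nat -> Cplx R) (F : nat -> Cplx R -> Cplx R) n : 0 <= r ->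
  (forall k, on_circle r (F k)) ->
  cmean r (fun w => \sum_(k < n) c k * F k w) = \sum_(k < n) c k * cmean r (F k).
Proof.
move=> r0 cF; have cS m : on_circle r (fun w => \sum_(k < m) c k * F k w).
  move=> z zr; elim: m => [|m ih].
    rewrite (_ : (fun w => _) = cst 0); first exact: cst_continuous.
    by apply/funext => w; rewrite big_ord0.
  rewrite (_ : (fun w => _) = (fun w : Cplx R => \sum_(k < m) c k * F k w + c m * F m w : Cplx R)).
    exact: (ctsD ih (@ctsZ (c m) _ _ (cF m z zr))).
  by apply/funext => w; rewrite big_ord_recr.
elim: n => [|n ih].
  rewrite big_ord0; apply/eqP; rewrite eq_complex /=.
  by rewrite !(eq_rmean (psi := fun=> 0)) ?rmean_cst ?eqxx// => t; rewrite big_ord0.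
rewrite big_ord_recr/= -ih -cmeanZ// -cmeanD//.
  by apply: eq_cmean => // z _; rewrite big_ord_recr.
by move=> z zr; apply: ctsZ; exact: cF.
Qed.

Lemma cmean_conj r f : 0 <= r -> on_circle r f ->
  cmean r (fun w => conjc (f w)) = conjc (cmean r f).
Proof.
move=> r0 cf; apply/eqP; rewrite eq_complex /=.
have cim := circle_cont (a := 0) (b := pi *+ 2) r0 contr1_Im cf.
rewrite -[- rmean _]mulN1r -rmeanZ//.
apply/andP; split; apply/eqP; apply: eq_rmean => t; first by case: (f _).
by case: (f _) => u v; rewrite /= mulN1r.
Qed.

(** Multiplying f by the unit scalar conj I / |I| turns the mean I into the real number |I|. This is
    then a mean of real parts, each at most the modulus. *)
Lemma nc_cmean r f : 0 <= r -> on_circle r f ->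
  nc (cmean r f) <= rmean (fun t => nc (f (pt r t))).
Proof.
move=> r0 cf; set I := cmean r f.
have [->|I0] := eqVneq I 0.
  rewrite Normc.normc0 /rmean mulr_ge0 ?invr_ge0 ?(ltW twopi_gt0)//.
  by apply: Rintegral_ge0 => t _; exact: nc_ge0.
pose u : Cplx R := ((nc I)^-1)%:C%C * conjc I.
have ncI : 0 < nc I by rewrite nc_gt0.
have uI : u * I = (nc I)%:C%C.
  rewrite /u -mulrA.
  have -> : conjc I * I = (nc I ^+ 2)%:C%C.
    case: (I) => a b; apply/eqP; rewrite eq_complex /= sqr_sqrtr ?addr_ge0 ?sqr_ge0//.
    by rewrite !expr2 mulNr opprK eqxx /= mulNr (mulrC b) addrN.
  by rewrite -rmorphM /= expr2 mulKf// gt_eqF.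
have ncu : nc u = 1.
  have : nc (u * I) = nc I by rewrite uI nc_real gtr0_norm.
  by rewrite ncM => /(canRL (mulfK (lt0r_neq0 ncI))); rewrite divff// gt_eqF.
have -> : nc I = complex.Re (cmean r (fun w => u * f w)) by rewrite cmeanZ// uI.
have cuf : on_circle r (fun w => u * f w).
  by move=> z zr; apply: ctsZ; exact: cf.
apply: (rmean_le (circle_cont r0 contr1_Re cuf) (circle_cont r0 contr1_nc cf)) => t _.
rewrite (le_trans (ler_norm _))// (le_trans (le_Re_nc _))//.
by rewrite ncM ncu mul1r.
Qed.

(** The imaginary part follows from the version for real parts applied to -i f. *)
Lemma mean_value f z0 rho r : 0 <= r < rho ->
  (forall z, nc z < rho -> {for z, continuous f}) ->
  (forall z, nc z < rho -> z != z0 -> derivable f z 1) ->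
  cmean r f = f 0.
Proof.
move=> rr cf df.
have K : pi *+ 2 != 0 :> R by rewrite gt_eqF// twopi_gt0.
apply/eqP; rewrite eq_complex /= /rmean (mean_value_Re cf df rr) mulrC mulfK// eqxx/=.
pose g (w : Cplx R) : Cplx R := (0 -i* 1)%C * f w.
have gE w : complex.Re (g w) = complex.Im (f w).
  by rewrite /g; case: (f w) => a b /=; rewrite mul0r mulN1r opprK add0r.
under eq_Rintegral do rewrite -gE.
have cg z : nc z < rho -> {for z, continuous g}.
  by move=> zr; apply: ctsZ; exact: cf.
have dg z : nc z < rho -> z != z0 -> derivable g z 1.
  by move=> zr zz0; apply: derZ; exact: df.
by rewrite (mean_value_Re cg dg rr) mulrC mulfK// gE.
Qed.

Lemma mul_conjc z : z * conjc z = (nc z ^+ 2)%:C%C.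
Proof.
case: z => a b; apply/eqP; rewrite eq_complex /= sqr_sqrtr ?addr_ge0 ?sqr_ge0//.
by rewrite !expr2 mulrN opprK eqxx /= mulrN (mulrC b) addNr.
Qed.

Lemma nc_conjc z : nc (conjc z) = nc z.
Proof. by case: z => a b; rewrite /Normc.normc /= sqrrN. Qed.

(* The radius is chosen so that the pole r^2 / conj z of the reflected kernel stays outside. *)
Lemma reflected_kernel r z : 0 < r -> nc z < r -> exists2 rho, r < rho &
  forall w, nc w < rho -> (r ^+ 2)%:C%C - conjc z * w != 0.
Proof.
move=> r0 zr; pose m := (nc z + r) / 2.
have zm : nc z <= m by rewrite ler_pdivlMr// mulr_natr mulr2n lerD2l ltW.
have mr : m < r by rewrite ltr_pdivrMr// mulr_natr mulr2n ltrD2r.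
have m0 : 0 < m by rewrite divr_gt0// ltr_wpDl// nc_ge0.
exists (r ^+ 2 / m); first by rewrite ltr_pdivlMr// expr2 ltr_pM2l.
move=> w; rewrite ltr_pdivlMr// => wm; rewrite subr_eq0; apply/eqP => /(congr1 (@Normc.normc R)).
rewrite nc_real ncM nc_conjc ger0_norm ?sqr_ge0// => E.
by move: wm; rewrite E mulrC ltNge ler_wpM2r// nc_ge0.
Qed.

Lemma circle_neq r z w : nc z < r -> nc w = r -> w - z != 0.
Proof. by move=> zr wr; rewrite subr_eq0; apply: contraTneq zr => <-; rewrite wr ltxx. Qed.

Lemma derivable_kernel z w : w - z != 0 ->
  derivable (fun w : Cplx R => w * (w - z)^-1 : Cplx R) w 1.
Proof.
move=> wz; apply: derM; first exact: der_id.
by apply: (@derV (fun w => w - z)) => //; apply: derB.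
Qed.

Lemma derivable_reflected (k z w : Cplx R) : k - z * w != 0 ->
  derivable (fun w : Cplx R => (k - z * w)^-1 : Cplx R) w 1.
Proof.
by move=> kz; apply: (@derV (fun w => k - z * w)) => //; apply: derB.
Qed.

Lemma conj_kernel r z w : nc z < r -> nc w = r -> w != 0 ->
  conjc (w / (w - z)) = (r ^+ 2)%:C%C / ((r ^+ 2)%:C%C - conjc z * w).
Proof.
move=> zr wr w0; have wz := circle_neq zr wr.
rewrite -wr -mul_conjc rmorphM fmorphV rmorphB /=.
have cwz : conjc w - conjc z != 0 by rewrite -rmorphB fmorph_eq0.
have -> : w * conjc w - conjc z * w = w * (conjc w - conjc z) by ring.
by field; rewrite cwz w0.
Qed.

(* On |w| = r the conjugate of w / (w - z) is r^2 / (r^2 - conj z w), to which the mean value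
   property applies. *)
Lemma kernel_mean r z : 0 < r -> nc z < r -> cmean r (fun w => w * (w - z)^-1) = 1.
Proof.
move=> r0 zr; rewrite -[LHS]conjcK -cmean_conj ?(ltW r0)//; last first.
  by move=> w wr; apply/derivable_continuous/derivable_kernel/(circle_neq zr).
have [rho rrho krho] := reflected_kernel r0 zr.
pose g (w : Cplx R) : Cplx R := (r ^+ 2)%:C%C * ((r ^+ 2)%:C%C - conjc z * w)^-1.
have dg w : nc w < rho -> derivable g w 1.
  by move=> wr; apply: derZ; apply: derivable_reflected; exact: krho.
have -> : cmean r (fun w => conjc (w / (w - z))) = cmean r g.
  apply: eq_cmean => [|w wr]; first exact: ltW.
  by apply: conj_kernel => //; rewrite -nc_gt0 wr.
have cg w : nc w < rho -> {for w, continuous g} by move=> /dg/derivable_continuous.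
have rr : 0 <= r < rho by rewrite ltW.
rewrite (mean_value rr cg (z0 := 0)); last by move=> w /dg.
by rewrite /g mulr0 subr0 divff ?rmorph1// fmorph_eq0 gt_eqF// exprn_gt0.
Qed.

(* The mean value property for w (f w - f z) / (w - z), which is continuous at z. *)
Lemma cauchy_formula f rho r z : (forall z, nc z < rho -> derivable f z 1) ->
  0 < r < rho -> nc z < r -> f z = cmean r (fun w => f w * (w * (w - z)^-1)).
Proof.
move=> df /andP[r0 rr] zr.
have [l fl] := (derivable_ncP _ _).1 (df z (lt_trans zr rr)).
(* At w = z the first term is zero, and the second supplies the derivative [l]; off z only the
   difference quotient is left. *)
pose q (w : Cplx R) : Cplx R := (f w - f z) * (w - z)^-1 + l * (w == z)%:R.
pose H (w : Cplx R) : Cplx R := w * q w.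
have dq w : nc w < rho -> w != z -> derivable q w 1.
  move=> wr wz.
  pose F (w : Cplx R) : Cplx R := (f w - f z) * (w - z)^-1.
  have N : {near w, F =1 q}.
    apply/nbhs_ballP; exists `|w - z|; first by rewrite /= normr_gt0 subr_eq0.
    move=> v; rewrite -ball_normE /= => wv.
    have /negbTE vz : v != z by apply: contraTneq wv => ->; rewrite ltxx.
    by rewrite /q /F vz mulr0 addr0.
  have D : derivable F w 1.
    apply: derM; first by apply: derB; [exact: df|exact: der_cst].
    apply: (@derV (fun w => w - z)); first by rewrite subr_eq0.
    by apply: derB; [exact: der_id|exact: der_cst].
  exact: (@near_eq_derivable _ (Cplx R) (Cplx R) F q w 1 N D).
have cq : {for z, continuous q}.
  apply/continuous_ncP => e e0.
  have e2 : 0 < e / 2 by rewrite divr_gt0.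
  have [d d0 fd] := fl _ e2; exists d => // w wz.
  rewrite /q eqxx subrr mul0r add0r mulr1.
  have [->|wz0] := eqVneq w z; first by rewrite subrr mul0r add0r mulr1 subrr Normc.normc0.
  have w0 : w - z != 0 by rewrite subr_eq0.
  rewrite mulr0 addr0 -(@ltr_pM2r _ (nc (w - z))) ?nc_gt0// -ncM mulrBl divfK//.
  rewrite (le_lt_trans (fd _ wz))// ltr_pM2r ?nc_gt0//.
  by rewrite ltr_pdivrMr// ltr_pMr// ltr1n.
have cH w : nc w < rho -> {for w, continuous H}.
  move=> wr; apply: ctsM; first exact: cvg_id.
  have [->//|wz] := eqVneq w z.
  exact/derivable_continuous/dq.
have dH w : nc w < rho -> w != z -> derivable H w 1.
  by move=> wr wz; apply: derM; [exact: der_id|exact: dq].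
(* [H] vanishes at 0, so its circle mean is zero: f and the constant f z have the same mean against
   the Cauchy kernel. *)
have := @mean_value H z rho r; rewrite (ltW r0) rr => /(_ isT cH dH).
rewrite {2}/H mul0r.
pose k (w : Cplx R) : Cplx R := w * (w - z)^-1.
have ck : on_circle r k.
  by move=> w wr; apply/derivable_continuous/derivable_kernel/(circle_neq zr).
have cf : on_circle r f by move=> w wr; apply/derivable_continuous/df; rewrite wr.
pose f1 (w : Cplx R) : Cplx R := f w * k w; pose f2 (w : Cplx R) : Cplx R := f z * k w.
have cf1 : on_circle r f1 by move=> w wr; exact: (ctsM (cf w wr) (ck w wr)).
have cf2 : on_circle r f2 by move=> w wr; exact: (ctsZ (ck w wr)).
have -> : cmean r H = cmean r f1 - cmean r f2.
  rewrite -(cmeanB (ltW r0) cf1 cf2); apply: eq_cmean => [|w wr]; first exact: ltW.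
  have wz := circle_neq zr wr; rewrite /H /q /f1 /f2 /k.
  by rewrite -(subr_eq0 w z) (negbTE wz) mulr0 addr0; field.
by rewrite (cmeanZ (f z) (ltW r0) ck) (kernel_mean r0 zr) mulr1 => /eqP; rewrite subr_eq0 => /eqP.
Qed.

Definition poisson r z w : R := (r ^+ 2 - nc z ^+ 2) / nc (w - z) ^+ 2.

(* Cauchy's formula for f(w) (r^2 - |z|^2) / (r^2 - conj z w). *)
Lemma poisson_formula f rho r z : (forall z, nc z < rho -> derivable f z 1) ->
  0 < r < rho -> nc z < r -> f z = cmean r (fun w => f w * (poisson r z w)%:C%C).
Proof.
move=> df /andP[r0 rr] zr.
have [s rs ks] := reflected_kernel r0 zr.
pose k : Cplx R := (r ^+ 2)%:C%C - (nc z ^+ 2)%:C%C.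
pose F (w : Cplx R) : Cplx R := f w * (k * ((r ^+ 2)%:C%C - conjc z * w)^-1).
have dF w : nc w < Num.min rho s -> derivable F w 1.
  rewrite lt_min => /andP[wr ws]; apply: derM; first exact: df.
  by apply: derZ; apply: derivable_reflected; exact: ks.
have := @cauchy_formula F (Num.min rho s) r z dF; rewrite r0 lt_min rr rs => /(_ isT zr).
have k0 : k != 0.
  rewrite /k -rmorphB /= fmorph_eq0 subr_eq0 eqf_sqr negb_or; apply/andP; split.
    by rewrite gt_eqF.
  by rewrite gt_eqF// (le_lt_trans _ r0)// oppr_le0 nc_ge0.
(* At w = z the denominator r^2 - conj z w equals [k], so the added factor is 1 there; on the circle
   it turns the Cauchy kernel into the Poisson kernel. *)
rewrite {1}/F.
have -> : (r ^+ 2)%:C%C - conjc z * z = k :> Cplx R by rewrite /k -mul_conjc mulrC.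
rewrite divff// mulr1 => ->; apply: eq_cmean; first exact: ltW.
move=> w wr; rewrite /F /poisson.
have wz := circle_neq zr wr.
have w0 : w != 0 by rewrite -nc_gt0 wr.
have cwz : conjc w - conjc z != 0 by rewrite -rmorphB fmorph_eq0.
have -> : ((r ^+ 2 - nc z ^+ 2) / nc (w - z) ^+ 2)%:C%C =
    k / ((w - z) * (conjc w - conjc z)).
  by rewrite -rmorphB /= mul_conjc /k -rmorphB /= -fmorph_div.
have -> : (r ^+ 2)%:C%C - conjc z * w = w * (conjc w - conjc z).
  by rewrite -wr -mul_conjc; ring.
by field; rewrite w0 cwz wz.
Qed.

Lemma poisson_ge0 r z w : nc z < r -> 0 <= poisson r z w.
Proof.
move=> zr; rewrite divr_ge0 ?sqr_ge0// subr_ge0 ler_pXn2r ?nnegrE ?nc_ge0//.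
  exact: ltW.
by rewrite (le_trans (nc_ge0 z))// ltW.
Qed.

End CircleMeans.

(** * Power series *)

Section PowerSeries.
Context {R : realType}.
Implicit Types (f g : Cplx R -> Cplx R) (r s rho : R) (z w h : Cplx R) (c : nat -> Cplx R).

Lemma cvg_nc_le (u : nat -> Cplx R) (l : Cplx R) (v : R ^nat) :
  (forall n, nc (u n - l) <= v n) -> v @ \oo --> (0 : R) -> u n @[n --> \oo] --> l.
Proof.
move=> uv v0; apply/cvgn_ncP.
apply: (@squeeze_cvgr _ _ _ _ (cst 0) v) => //; last exact: cvg_cst.
by apply: nearW => n; rewrite nc_ge0 uv.
Qed.

Lemma nc_lim_le (u : nat -> Cplx R) (l : Cplx R) (B : R) :
  u n @[n --> \oo] --> l -> (forall n, nc (u n) <= B) -> nc l <= B.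
Proof.
move=> /cvgn_ncP ul uB; rewrite -[leRHS]addr0.
have H n : nc l <= B + nc (u n - l).
  by rewrite nc_distC -[in leLHS](subrK (u n) l) addrC (le_trans (ncD _ _))// lerD2r.
have C : (fun n => B + nc (u n - l)) @ \oo --> B + 0 by apply: cvgD => //; exact: cvg_cst.
rewrite -(cvg_lim (@Rhausdorff R) C); apply: limr_ge; first by apply/cvg_ex; exists (B + 0).
exact: nearW.
Qed.

Lemma cvgD_c (u v : nat -> Cplx R) (l m : Cplx R) :
  u n @[n --> \oo] --> l -> v n @[n --> \oo] --> m -> u n + v n @[n --> \oo] --> l + m.
Proof. exact: (@cvgD _ (Cplx R)). Qed.

Lemma cvgB_c (u v : nat -> Cplx R) (l m : Cplx R) :
  u n @[n --> \oo] --> l -> v n @[n --> \oo] --> m -> u n - v n @[n --> \oo] --> l - m.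
Proof. exact: (@cvgB _ (Cplx R)). Qed.

Lemma cvgZ_c (u : nat -> Cplx R) (k l : Cplx R) :
  u n @[n --> \oo] --> l -> k * u n @[n --> \oo] --> k * l.
Proof.
move=> /cvgn_ncP ul; apply: (@cvg_nc_le _ _ (fun n => nc k * nc (u n - l))).
  by move=> n; rewrite -mulrBr ncM.
by rewrite -(mulr0 (nc k)); exact: cvgMr.
Qed.

Lemma cvg_unique_c (u : nat -> Cplx R) (l m : Cplx R) :
  u n @[n --> \oo] --> l -> u n @[n --> \oo] --> m -> l = m.
Proof. by move=> ul um; rewrite -(cvg_lim (@norm_hausdorff _ (Cplx R)) ul) (cvg_lim (@norm_hausdorff _ (Cplx R)) um). Qed.

Lemma cseries_cvg (u : nat -> Cplx R) (v : R ^nat) :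
  (forall k, nc (u k) <= v k) -> cvgn (series v) ->
  exists l : Cplx R, series u n @[n --> \oo] --> l.
Proof.
move=> uv cv.
have cG (G : Cplx R -> R) : (forall z, `|G z| <= nc z) -> cvgn (series (fun k => G (u k))).
  move=> Gnc; apply: normed_cvg; apply: (@series_le_cvg _ _ v) => //.
  - by move=> n; exact: normr_ge0.
  - by move=> n; exact: le_trans (nc_ge0 (u n)) (uv n).
  - by move=> n; rewrite /= (le_trans (Gnc _)).
have /cvg_ex[a ua] := cG _ (@le_Re_nc R); have /cvg_ex[b ub] := cG _ (@le_Im_nc R).
exists (a +i* b)%C; apply: (@cvg_nc_le _ _ (fun n =>
  `|series (fun k => complex.Re (u k)) n - a| + `|series (fun k => complex.Im (u k)) n - b|)).
  move=> n; apply: le_trans (nc_le_ReIm _) _; rewrite ReB ImB /=.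
  by rewrite /series /= !raddf_sum.
rewrite -(addr0 (0 : R)); apply: cvgD.
  by apply/norm_cvg0P; rewrite -(subrr a); apply: cvgB => //; exact: cvg_cst.
by apply/norm_cvg0P; rewrite -(subrr b); apply: cvgB => //; exact: cvg_cst.
Qed.

(** The coefficients are the means of f(w) w^-k. Splitting off the first n powers of z / w from the
    Cauchy kernel w / (w - z) leaves z^n times the mean of f(w) w^-n w / (w - z), which decays
    geometrically. *)
Lemma expansion f rho r : (forall z, nc z < rho -> derivable f z 1) -> 0 < r < rho ->
  exists c, (forall k, nc (c k) * r ^+ k <= rmean (fun t => nc (f (pt r t)))) /\
    forall z, nc z < r -> series (fun k => c k * z ^+ k) n @[n --> \oo] --> f z.
Proof.
move=> df /andP[r0 rr]; have r0' := ltW r0.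
have cf : on_circle r f by move=> w wr; apply/derivable_continuous/df; rewrite wr.
pose P k (w : Cplx R) : Cplx R := f w * (w ^-1) ^+ k.
have cV : on_circle r (fun w => w^-1 : Cplx R).
  move=> w wr; apply/derivable_continuous; apply: (@derV _ (fun w => w)); last exact: der_id.
  by rewrite -nc_gt0 wr.
have cX k : on_circle r (fun w => w^-1 ^+ k : Cplx R).
  move=> w wr; elim: k => [|k ih].
    by rewrite (_ : (fun w => _) = cst 1); [exact: cst_continuous|apply/funext => ?; rewrite expr0].
  rewrite (_ : (fun w => _) = (fun w : Cplx R => w^-1 * w^-1 ^+ k : Cplx R)).
    exact: (ctsM (cV w wr) ih).
  by apply/funext => ?; rewrite exprS.
have cP k : on_circle r (P k) by move=> w wr; exact: (ctsM (cf w wr) (cX k w wr)).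
have ncP k w : nc w = r -> nc (P k w) * r ^+ k = nc (f w).
  by move=> wr; rewrite /P ncM ncX ncV wr -mulrA -exprMn mulVf ?expr1n ?mulr1// gt_eqF.
exists (fun k => cmean r (P k)); split=> [k|z zr].
  rewrite mulrC; have H := nc_cmean r0' (cP k).
  have rk : 0 < r ^+ k by rewrite exprn_gt0.
  rewrite -(ler_pM2l rk) in H; apply: (le_trans H).
  rewrite -rmeanZ; last exact: (circle_cont r0' contr1_nc (cP k)).
  by rewrite (eq_rmean (psi := fun t => nc (f (pt r t))))// => t; rewrite mulrC ncP// nc_pt ger0_norm.
have cfr (x t : R) : r <= x <= r -> {for pt x t, continuous f}.
  by move=> /le_anti <-; apply: cf; rewrite nc_pt ger0_norm.
have [M M0 fM] := bounded_polar (lexx r) cfr.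
pose K (w : Cplx R) : Cplx R := w * (w - z)^-1.
have cK : on_circle r K by move=> w wr; apply/derivable_continuous/derivable_kernel/(circle_neq zr).
(* [M] bounds |f| on the circle, and r / (r - |z|) bounds the Cauchy kernel there. *)
apply: (@cvg_nc_le _ _ (fun n => M * (r / (r - nc z)) * (nc z / r) ^+ n)); last first.
  rewrite -(mulr0 (M * (r / (r - nc z)))); apply: cvgMr.
  apply: cvg_expr; rewrite ger0_norm ?divr_ge0 ?nc_ge0//.
  by rewrite ltr_pdivrMr// mul1r.
move=> n.
pose Q (w : Cplx R) : Cplx R := P n w * K w.
have cQ : on_circle r Q by move=> w wr; exact: (ctsM (cP n w wr) (cK w wr)).
have -> : series (fun k => cmean r (P k) * z ^+ k) n - f z = - (z ^+ n * cmean r Q).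
  rewrite (cauchy_formula df _ zr) ?r0// seriesEord/=.
  under eq_bigr do rewrite mulrC.
  rewrite -cmean_sum// -cmeanZ//.
  have cS : on_circle r (fun w => \sum_(k < n) z ^+ k * P k w : Cplx R).
    move=> w wr; elim: (n) => [|m ih].
      by rewrite (_ : (fun w => _) = cst 0); [exact: cst_continuous|apply/funext => ?; rewrite big_ord0].
    rewrite (_ : (fun w => _) = (fun w : Cplx R => \sum_(k < m) z ^+ k * P k w + z ^+ m * P m w : Cplx R)).
      exact: (ctsD ih (@ctsZ _ (z ^+ m) _ _ (cP m w wr))).
    by apply/funext => ?; rewrite big_ord_recr.
  pose SP (w : Cplx R) : Cplx R := \sum_(k < n) z ^+ k * P k w.
  pose ZQ (w : Cplx R) : Cplx R := z ^+ n * Q w.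
  have cZ : on_circle r ZQ by move=> w wr; exact: (@ctsZ _ (z ^+ n) _ _ (cQ w wr)).
  suff -> : cmean r (fun w => f w * (w * (w - z)^-1)) = cmean r SP + cmean r ZQ.
    by rewrite opprD addrA subrr sub0r.
  rewrite -(cmeanD r0' cS cZ).
  apply: eq_cmean => // w wr; rewrite /SP /ZQ /Q /K /P; apply/esym.
  have wz := circle_neq zr wr; have w0 : w != 0 by rewrite -nc_gt0 wr.
  under eq_bigr => k _ do rewrite mulrCA -exprMn.
  rewrite -mulr_sumr; set x := z * w^-1; have KE : w * (w - z)^-1 * (1 - x) = 1 by rewrite /x; field; rewrite w0.
  have -> : \sum_(k < n) x ^+ k = w * (w - z)^-1 * (1 - x ^+ n).
    by rewrite -(opprB _ 1) subrX1 -mulNr opprB mulrA KE mul1r.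
  have -> : z ^+ n * (f w * w^-1 ^+ n * (w * (w - z)^-1)) = f w * (x ^+ n * (w * (w - z)^-1)).
    by rewrite /x exprMn; ring.
  by ring.
have rz : 0 < r - nc z by rewrite subr_gt0.
rewrite ncN ncM ncX exprMn [leRHS]mulrCA ler_wpM2l ?exprn_ge0 ?nc_ge0//.
apply: (le_trans (nc_cmean r0' cQ)).
rewrite -(rmean_cst (M * (r / (r - nc z)) * r^-1 ^+ n)).
apply: rmean_le => [|t _|t tpi]; [exact: (circle_cont r0' contr1_nc cQ)|exact: cst_continuous|].
have wr : nc (pt r t) = r by rewrite nc_pt ger0_norm.
rewrite /Q /P /K !ncM ncX !ncV wr mulrAC ler_wpM2r ?exprn_ge0 ?invr_ge0//.
rewrite ler_pM ?nc_ge0 ?mulr_ge0 ?invr_ge0 ?nc_ge0 ?fM ?lexx// ler_pM2l// lef_pV2 ?posrE//.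
  by rewrite (le_trans _ (le_trans (ler_norm _) (contr1_nc _ _)))// wr.
by rewrite nc_gt0 (circle_neq zr).
Qed.

(* Coefficients of a power series with radius of convergence at least rho. *)
Definition coef_class rho c :=
  forall s, 0 <= s < rho -> exists M, forall k, nc (c k) * s ^+ k <= M.

Definition has_pow rho f c := coef_class rho c /\
  forall z, nc z < rho -> series (fun k => c k * z ^+ k) n @[n --> \oo] --> f z.

(** A larger radius, taken halfway to [rho], leaves room for geometric decay, which absorbs factors
    k and gives summability below. *)
Lemma coef_class_near rho c s : coef_class rho c -> 0 <= s < rho ->
  exists s1 M, [/\ s < s1, s1 < rho, 0 <= M & forall k, nc (c k) * s1 ^+ k <= M].
Proof.
move=> cc /andP[s0 sr]; have [m1 m2] := midf_lt sr.
have [|M cM] := cc ((s + rho) / 2); first by rewrite m2 (le_trans s0)// ltW.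
exists ((s + rho) / 2), M; split=> //.
by rewrite (le_trans _ (cM 0%N))// expr0 mulr1 nc_ge0.
Qed.

(** Bernoulli's inequality for 1 / q: 1 + k (1 / q - 1) <= q^-k. *)
Lemma mulk_pow_le (q : R) k : 0 <= q < 1 -> k%:R * q ^+ k <= q / (1 - q).
Proof.
move=> /andP[q0 q1]; have [->|qn0] := eqVneq q 0.
  by case: k => [|k]; rewrite ?mul0r// exprS mul0r mulr0.
have {q0 qn0} q0 : 0 < q by rewrite lt_def qn0.
have q1' : 0 < 1 - q by rewrite subr_gt0.
have B : 1 + k%:R * (q^-1 - 1) <= q^-1 ^+ k.
  elim: k => [|k ih]; first by rewrite mul0r addr0 expr0.
  have V : 1 <= q^-1 by rewrite invf_ge1// ltW.
  rewrite exprS; apply: (le_trans _ (ler_wpM2l _ ih)); last by rewrite invr_ge0 ltW.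
  rewrite -natr1; have : 0 <= k%:R * (q^-1 - 1) ^+ 2 by rewrite mulr_ge0// sqr_ge0.
  move: (k%:R) => K; move: (q^-1) => v H; rewrite -subr_ge0.
  by rewrite (_ : _ - _ = K * (v - 1) ^+ 2)//; ring.
rewrite ler_pdivlMr//; have qk : 0 < q ^+ k by rewrite exprn_gt0.
have : k%:R * (q^-1 - 1) <= q^-1 ^+ k by rewrite (le_trans _ B)// lerDr.
rewrite -(ler_pM2r qk) -exprMn mulVf ?gt_eqF// expr1n -(ler_pM2r q0) mul1r.
by congr (_ <= _); field; rewrite gt_eqF.
Qed.

Lemma coef_class_mulk rho c : coef_class rho c -> coef_class rho (fun k => k%:R * c k).
Proof.
move=> cc s sr; have [s1 [M [ss1 s1r M0 cM]]] := coef_class_near cc sr.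
case/andP: sr => s0 _; have s10 : 0 < s1 by exact: le_lt_trans ss1.
pose q := s / s1.
have q01 : 0 <= q < 1 by rewrite divr_ge0 ?(ltW s10)//= ltr_pdivrMr// mul1r.
exists (M * (q / (1 - q))) => k.
have -> : nc (k%:R * c k) * s ^+ k = (nc (c k) * s1 ^+ k) * (k%:R * q ^+ k).
  rewrite ncM (_ : nc (k%:R : Cplx R) = k%:R); last first.
    by rewrite -(rmorph_nat (real_complex R)) nc_real normr_nat.
  by rewrite /q expr_div_n; field; rewrite expf_neq0// gt_eqF.
by rewrite ler_pM ?mulr_ge0 ?nc_ge0 ?exprn_ge0 ?(ltW s10)//; [case/andP: q01|exact: mulk_pow_le].
Qed.

Lemma coef_class_shift rho c : coef_class rho c -> coef_class rho (fun k => c k.+1).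
Proof.
move=> cc s sr; have [s1 [M [ss1 s1r M0 cM]]] := coef_class_near cc sr.
case/andP: sr => s0 _; have s10 : 0 < s1 by exact: le_lt_trans ss1.
exists (M / s1) => k; rewrite ler_pdivlMr// (le_trans _ (cM k.+1))//.
rewrite [in leRHS]exprSr mulrA ler_pM2r// ler_wpM2l ?nc_ge0//.
by rewrite lerXn2r ?nnegrE ?(ltW s10) ?(ltW ss1).
Qed.

Lemma coef_class_summable rho c s : coef_class rho c -> 0 <= s < rho ->
  cvgn (series (fun k => nc (c k) * s ^+ k)).
Proof.
move=> cc sr; have [s1 [M [ss1 s1r M0 cM]]] := coef_class_near cc sr.
case/andP: sr => s0 _; have s10 : 0 < s1 by exact: le_lt_trans ss1.
apply: (@series_le_cvg _ _ (geometric M (s / s1))).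
- by move=> k; rewrite mulr_ge0 ?nc_ge0 ?exprn_ge0.
- by move=> k; rewrite /= mulr_ge0 ?exprn_ge0 ?divr_ge0// ltW.
- move=> k; rewrite /= expr_div_n (le_trans _ (ler_wpM2r _ (cM k))) ?divr_ge0 ?exprn_ge0 ?(ltW s10)//.
  by rewrite mulrA mulrAC mulfK// expf_neq0// gt_eqF.
- apply: is_cvg_geometric_series.
  by rewrite ger0_norm ?divr_ge0 ?(ltW s10)// ltr_pdivrMr// mul1r.
Qed.

Lemma coef_class_cvg rho c z : coef_class rho c -> nc z < rho ->
  exists l : Cplx R, series (fun k => c k * z ^+ k) n @[n --> \oo] --> l.
Proof.
move=> cc zr; apply: (@cseries_cvg _ (fun k => nc (c k) * nc z ^+ k)).
  by move=> k; rewrite ncM ncX.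
by apply: coef_class_summable cc _; rewrite nc_ge0.
Qed.

(** Second-order remainder of a power, by induction on k. The factor s^2 on the left replaces
    s^(k-2) on the right and avoids negative exponents; k^2 is a crude constant. At k = 0 the
    truncated predecessor is harmless, being multiplied by k. *)
Lemma taylor_term_le (z h : Cplx R) s k : 0 < s -> nc z <= s -> nc (z + h) <= s ->
  nc ((z + h) ^+ k - z ^+ k - k%:R * z ^+ k.-1 * h) * s ^+ 2 <= k%:R ^+ 2 * s ^+ k * nc h ^+ 2.
Proof.
move=> s0 zs zhs; elim: k => [|k ih].
  by rewrite !expr0 subrr mul0r mul0r subr0 Normc.normc0 expr0n !mul0r.
have E : (z + h) ^+ k.+1 - z ^+ k.+1 - k.+1%:R * z ^+ k * h =
   (z + h) * ((z + h) ^+ k - z ^+ k - k%:R * z ^+ k.-1 * h) + k%:R * z ^+ k.-1 * h ^+ 2.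
  case: k {ih} => [|k]; first by rewrite !expr1 !expr0 mul0r; ring.
  by rewrite -!natr1 !exprS /=; ring.
have S2 : 0 <= s ^+ 2 by rewrite sqr_ge0.
rewrite /= E (le_trans (ler_wpM2r S2 (ncD _ _)))// mulrDl.
have A : nc ((z + h) * ((z + h) ^+ k - z ^+ k - k%:R * z ^+ k.-1 * h)) * s ^+ 2 <=
    s * (k%:R ^+ 2 * s ^+ k * nc h ^+ 2).
  rewrite ncM -mulrA; apply: ler_pM => //; first exact: nc_ge0.
  exact: mulr_ge0 (nc_ge0 _) S2.
have B : nc (k%:R * z ^+ k.-1 * h ^+ 2) * s ^+ 2 <= k%:R * s ^+ k.+1 * nc h ^+ 2.
  case: k {ih E A} => [|k]; first by rewrite !mul0r Normc.normc0 mul0r.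
  rewrite !ncM !ncX (_ : nc (k.+1%:R : Cplx R) = k.+1%:R); last first.
    by rewrite -(rmorph_nat (real_complex R)) nc_real normr_nat.
  rewrite /= (_ : k.+1%:R * s ^+ k.+2 * nc h ^+ 2 = k.+1%:R * s ^+ 2 * nc h ^+ 2 * s ^+ k).
    rewrite [leLHS](_ : _ = k.+1%:R * s ^+ 2 * nc h ^+ 2 * nc z ^+ k); last by ring.
    apply: ler_wpM2l; first by rewrite mulr_ge0 ?sqr_ge0// mulr_ge0.
    by rewrite lerXn2r ?nnegrE ?nc_ge0// ltW.
  by rewrite !exprS; ring.
apply: (le_trans (lerD A B)).
rewrite -natr1 (exprS s k); have K0 : 0 <= k%:R :> R by [].
rewrite -subr_ge0 (_ : _ - _ = (k%:R + 1) * (s * s ^+ k * nc h ^+ 2)); last by ring.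
by rewrite !mulr_ge0 ?addr_ge0 ?exprn_ge0 ?nc_ge0// ltW.
Qed.

Definition dcoef c : nat -> Cplx R := fun k => k.+1%:R * c k.+1.

(** Termwise differentiation: the second-order remainders add up to at most C |h|^2, where C s^2 is
    the sum of k^2 |c_k| s^k for a radius s strictly between |z| and rho. *)
Lemma has_pow_deriv rho f c : has_pow rho f c ->
  has_pow rho (cderiv f) (dcoef c) /\ forall z, nc z < rho -> derivable f z 1.
Proof.
move=> [cc cf].
have cd : coef_class rho (dcoef c) := coef_class_shift (coef_class_mulk cc).
suff D z : nc z < rho -> exists2 l : Cplx R,
    series (fun k => dcoef c k * z ^+ k) n @[n --> \oo] --> l &
    forall e, 0 < e -> exists2 d : R, 0 < d &
      forall h, h != 0 -> nc h < d -> nc ((f (z + h) - f z) / h - l) < e.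
  split=> [|z /D[l _ fl]]; last first.
    exact: (proj1 (holomorphic_derivable f z)
      (cvgP l (proj2 (cvg_dnbhs_ncP (fun h => (f (z + h) - f z) / h) l) fl))).
  split; first exact: cd.
  by move=> z /D[l sl fl]; rewrite (cderivE fl); exact: sl.
move=> zr; have [l sl] := coef_class_cvg cd zr; exists l => // e e0.
have nz := nc_ge0 z.
have [m1 m2] := midf_lt zr; set s := (nc z + rho) / 2 in m1 m2.
have s0 : 0 < s := le_lt_trans nz m1.
have s0r : 0 <= s < rho by rewrite (ltW s0).
have := coef_class_summable (coef_class_mulk (coef_class_mulk cc)) s0r.
set v : R ^nat := fun k => _ => cv.
have v0 k : 0 <= v k by rewrite mulr_ge0 ?nc_ge0 ?exprn_ge0// ltW.
set S := limn (series v).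
have vS n : series v n <= S.
  by apply: nondecreasing_cvgn_le => //; apply: nondecreasing_series => k _ _; exact: v0.
have S0 : 0 <= S by rewrite (le_trans _ (vS 0%N))// /series /= big_geq.
pose C := S / s ^+ 2.
have C0 : 0 <= C by rewrite divr_ge0// sqr_ge0.
have C1 : 0 < C + 1 by rewrite ltr_wpDl.
(* The first entry keeps z + h in the disk of radius [s]; the second makes C |h| smaller than [e],
   with C + 1 in place of C because C may vanish. *)
exists (Num.min (s - nc z) (e / (C + 1))).
  by rewrite lt_min subr_gt0 m1 divr_gt0.
move=> h h0; rewrite lt_min => /andP[hs he].
have zh : nc (z + h) <= s.
  by rewrite (le_trans (ncD _ _))// addrC -lerBrDr ltW.
have hn : 0 < nc h by rewrite nc_gt0.
have zhr : nc (z + h) < rho by exact: le_lt_trans m2.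
suff B : nc (f (z + h) - f z - l * h) <= C * nc h ^+ 2.
  rewrite -(ltr_pM2r hn) -ncM mulrBl divfK// (le_lt_trans B)//.
  rewrite expr2 mulrA ltr_pM2r// (le_lt_trans (y := (C + 1) * nc h))//.
    by rewrite ler_pM2r// lerDl.
  by rewrite -ltr_pdivlMl// mulrC.
(* The derived series in unshifted indexing, to match the terms of f; its term at k = 0 is zero. *)
have sl' : series (fun k => k%:R * c k * z ^+ k.-1) n @[n --> \oo] --> l.
  rewrite -cvg_shiftS /=; rewrite (_ : (fun n => _) = series (fun k => dcoef c k * z ^+ k))//.
  by apply/funext => n; rewrite /series /= big_nat_recl//= mul0r mul0r add0r.
have L := cvgB_c (cvgB_c (cf _ zhr) (cf _ zr)) (@cvgZ_c _ h l sl').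
rewrite (mulrC l); apply: (nc_lim_le L) => n /=.
rewrite /series /= mulr_sumr -!sumrB (le_trans (nc_sum _ _ _))//.
have S2 : 0 < s ^+ 2 by rewrite exprn_gt0.
rewrite -(ler_pM2r S2) /C mulrAC divfK ?gt_eqF// mulr_suml.
apply: (le_trans _ (ler_wpM2r (sqr_ge0 _) (vS n))).
rewrite /series /= mulr_suml; apply: ler_sum => k _.
have -> : c k * (z + h) ^+ k - c k * z ^+ k - h * (k%:R * c k * z ^+ k.-1) =
   c k * ((z + h) ^+ k - z ^+ k - k%:R * z ^+ k.-1 * h) by ring.
have := taylor_term_le k s0 (ltW m1) zh => T.
have := ler_wpM2l (nc_ge0 (c k)) T; rewrite mulrA -ncM => T'; apply: (le_trans T').
rewrite /v !ncM.
rewrite (_ : nc (k%:R : Cplx R) = k%:R); last first.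
  by rewrite -(rmorph_nat (real_complex R)) nc_real normr_nat.
by rewrite le_eqVlt; apply/orP; left; apply/eqP; ring.
Qed.

Lemma has_pow_at0 rho f c : 0 < rho -> has_pow rho f c -> f 0 = c 0%N.
Proof.
move=> rho0 [_ /(_ 0)]; rewrite Normc.normc0 => /(_ rho0) H.
apply: (cvg_unique_c H); rewrite -cvg_shiftS /=.
rewrite (_ : (fun n => _) = cst (c 0%N)); first exact: cvg_cst.
apply/funext => n; rewrite /series /= big_nat_recl//= expr0 mulr1 big1 ?addr0// => i _.
by rewrite exprS mul0r mulr0.
Qed.

(** Iterating [dcoef] j times multiplies the coefficient at i + j by (i + 1) ... (i + j); at i = 0
    this is the factorial dividing in [taylor_coef]. *)
Lemma has_pow_taylor rho f c k : 0 < rho -> has_pow rho f c -> taylor_coef f k = c k.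
Proof.
move=> rho0 fc.
have H : has_pow rho (iter k (@cderiv R) f) (iter k dcoef c).
  elim: k => [//|k ih]; rewrite !iterS; exact: (proj1 (has_pow_deriv ih)).
rewrite /taylor_coef (has_pow_at0 rho0 H).
have E j i : iter j dcoef c i = (\prod_(i.+1 <= m < (i + j).+1) m)%N%:R * c (i + j)%N.
  elim: j i => [|j ih] i; first by rewrite addn0 big_geq// mul1r.
  rewrite iterS /dcoef ih addSnnS mulrA -natrM; congr (_%:R * _).
  by rewrite [in RHS]big_ltn// addnS ltnS leq_addr.
rewrite E add0n -fact_prod mulrC mulKf// pnatr_eq0 -lt0n fact_gt0//.
Qed.

(** Expansions on different circles have the same coefficients, since all are the Taylor
    coefficients at 0. Hence one series serves the whole disk, with the coefficient estimate at
    every radius. *)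
Lemma holomorphic_has_pow f : holomorphic_disk f ->
  has_pow 1 f (taylor_coef f) /\
  forall r, 0 < r < 1 -> forall k, nc (taylor_coef f k) * r ^+ k <= rmean (fun t => nc (f (pt r t))).
Proof.
move=> hf; have df z : nc z < 1 -> derivable f z 1 by move=> /hf/holomorphic_derivable.
have E r : 0 < r < 1 -> has_pow r f (taylor_coef f) /\
   forall k, nc (taylor_coef f k) * r ^+ k <= rmean (fun t => nc (f (pt r t))).
  move=> r01; have [c [cb cf]] := expansion df r01; case/andP: r01 => r0 r1.
  have fc : has_pow r f c.
    split=> // s /andP[s0 sr]; eexists => k; apply: (le_trans _ (cb k)).
    by rewrite ler_wpM2l ?nc_ge0// lerXn2r ?nnegrE// ltW.
  have -> : taylor_coef f = c by apply/funext => k; exact: has_pow_taylor fc.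
  by [].
split=> [|r /E[]//].
have mid s : 0 <= s < 1 -> exists2 r, 0 < r < 1 & s < r.
  move=> /andP[s0 s1]; have [m1 m2] := midf_lt s1.
  by exists ((s + 1) / 2) => //; rewrite m2 (le_lt_trans s0).
split=> [s s01|z z1].
  have [r /E[[cc _] _] sr] := mid _ s01; apply: cc; case/andP: s01 => -> _; exact: sr.
have [r /E[[_ cf] _] zr] := mid (nc z) (introT andP (conj (nc_ge0 z) z1)).
exact: cf.
Qed.
End PowerSeries.

(** * Integral means *)

Section PowerMeans.
Context {R : realType}.
Variable p : R.
Hypothesis p1 : 1 <= p.
Implicit Types (f g : Cplx R -> Cplx R) (r s rho M x y : R) (z w : Cplx R).

Let p0 : 0 < p. Proof. exact: lt_le_trans p1. Qed.

(* Tangent-line inequality for x^p at y, in a division-free form. *)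
Lemma powR_tangent x y : 0 <= x -> 0 <= y -> p * x * y `^ (p - 1) <= x `^ p + (p - 1) * y `^ p.
Proof.
move=> x0 y0; have [->|p1'] := eqVneq p 1.
  by rewrite subrr powRr0 mulr1 mul1r mul0r addr0 powRr1.
have q0 : 0 < p - 1 by rewrite subr_gt0 lt_def p1' p1.
have := @conjugate_powR R x (y `^ (p - 1)) p (p / (p - 1)) x0 (powR_ge0 _ _) p0 (divr_gt0 p0 q0).
have pn0 : p != 0 by rewrite gt_eqF.
have qn0 : p - 1 != 0 by rewrite gt_eqF.
rewrite -powRrM (_ : (p - 1) * (p / (p - 1)) = p); last by field.
rewrite (_ : p^-1 + (p / (p - 1))^-1 = 1); last by field; rewrite pn0 qn0.
move=> /(_ erefl); rewrite -(ler_pM2l p0) => H; rewrite -mulrA (le_trans H)//.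
by rewrite le_eqVlt; apply/orP; left; apply/eqP; field; rewrite pn0 qn0.
Qed.

Lemma powR_pred x : 0 <= x -> x * x `^ (p - 1) = x `^ p.
Proof.
rewrite le_eqVlt => /predU1P[<-|x0].
  by rewrite mul0r powR0// gt_eqF.
rewrite -[X in X * _](powRr1 (ltW x0)) -powRD ?subrKC//.
by apply/implyP => _; rewrite gt_eqF.
Qed.

(** The tangent inequality, used for both orders of the pair; M^(p-1) dominates both slopes. *)
Lemma powR_lip M x y : 0 <= x <= M -> 0 <= y <= M ->
  `|x `^ p - y `^ p| <= p * M `^ (p - 1) * `|x - y|.
Proof.
have H a b : 0 <= a <= M -> 0 <= b <= M -> a `^ p - b `^ p <= p * M `^ (p - 1) * `|a - b|.
  move=> /andP[a0 aM] /andP[b0 bM].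
  have T := powR_tangent b0 a0.
  have : a `^ p - b `^ p <= p * a `^ (p - 1) * (a - b).
    rewrite mulrBr -[p * _ * a]mulrA (mulrC _ a) powR_pred// (mulrAC p) in T *.
    by rewrite mulrBl mul1r in T; lra.
  move=> /le_trans; apply; rewrite (le_trans (ler_wpM2l _ (ler_norm _)))//.
    by rewrite mulr_ge0 ?powR_ge0// ltW.
  rewrite ler_wpM2r// ler_wpM2l ?(ltW p0)//.
  by rewrite ge0_ler_powR ?nnegrE ?subr_ge0// (le_trans a0).
move=> xM yM; rewrite ler_norml H// andbT lerNl opprB distrC H//.
Qed.

Lemma continuous_powR_comp (u : R -> R) (t : R) : (forall s, 0 <= u s) ->
  {for t, continuous u} -> {for t, continuous (fun s => u s `^ p)}.
Proof.
move=> u0 cu; pose M := u t + 1; pose K := p * M `^ (p - 1) + 1.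
have M0 : 0 < M by rewrite ltr_wpDl.
have K0 : 0 < K by rewrite ltr_wpDl// mulr_ge0 ?powR_ge0// ltW.
apply/cvgrPdist_lt => e e0; have eK : 0 < e / K by rewrite divr_gt0.
move/cvgrPdist_lt: cu => cu; near=> s.
have us1 : `|u t - u s| < 1 by near: s; exact: cu.
have use : `|u t - u s| < e / K by near: s; exact: cu.
apply: le_lt_trans (_ : p * M `^ (p - 1) * `|u t - u s| < e).
  apply: powR_lip; first by rewrite u0 lerDl ler01.
  rewrite u0/=; move: us1; rewrite distrC ltr_norml => /andP[_]; rewrite ltrBlDl => /ltW//.
move: use; rewrite ltr_pdivlMr// mulrC => use; apply: le_lt_trans use.
by rewrite ler_wpM2r// lerDl.
Unshelve. all: by end_near. Qed.

(** No p-th root is taken: comparing with p-th powers of bounds keeps the estimates linear under the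
    integral. *)
Definition Mp f r : R := rmean (fun t => nc (f (pt r t)) `^ p).

Lemma circle_pow_cont r f a b : 0 <= r -> on_circle r f ->
  cont_on (fun t => nc (f (pt r t)) `^ p) a b.
Proof.
move=> r0 cf t tab; apply: continuous_powR_comp => [s|]; first exact: nc_ge0.
exact: (circle_cont r0 contr1_nc cf tab).
Qed.

Lemma Mp_ge0 f r : 0 <= Mp f r.
Proof.
rewrite /Mp /rmean mulr_ge0 ?invr_ge0 ?(ltW twopi_gt0)//.
by apply: Rintegral_ge0 => t _; exact: powR_ge0.
Qed.

Lemma Mp_bound f r B : 0 <= r -> on_circle r f -> 0 <= B ->
  (forall z, nc z = r -> nc (f z) <= B) -> Mp f r <= B `^ p.
Proof.
move=> r0 cf B0 fB; rewrite -[leRHS]rmean_cst; apply: rmean_le.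
- exact: circle_pow_cont.
- by move=> t _; exact: cst_continuous.
by move=> t _; rewrite ge0_ler_powR ?nnegrE ?nc_ge0 ?(ltW p0)// fB// nc_pt ger0_norm.
Qed.

(** The tangent inequality at the combination [m], applied to [u] and [v] and averaged with weights
    l and 1 - l. *)
Lemma convex_pow_le (l u v : R) : 0 <= l <= 1 -> 0 <= u -> 0 <= v ->
  (l * u + (1 - l) * v) `^ p <= l * u `^ p + (1 - l) * v `^ p.
Proof.
move=> /andP[l0 l1] u0 v0; have l1' : 0 <= 1 - l by rewrite subr_ge0.
set m := l * u + _; have m0 : 0 <= m by rewrite addr_ge0// mulr_ge0.
have Tu := ler_wpM2l l0 (powR_tangent u0 m0).
have Tv := ler_wpM2l l1' (powR_tangent v0 m0).
have E : l * (p * u * m `^ (p - 1)) + (1 - l) * (p * v * m `^ (p - 1)) = p * m `^ p.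
  by rewrite -powR_pred// /m; ring.
move: (lerD Tu Tv); rewrite E; move: (u `^ p) (v `^ p) (m `^ p) => a b c H.
by rewrite -subr_ge0; move: H; rewrite -subr_ge0; congr (0 <= _); ring.
Qed.

(* Minkowski's inequality without p-th roots: write f + g as (A + B) times a convex
   combination of f / A and g / B. *)
Lemma minkowski_gauge f g r A B : 0 <= r -> on_circle r f -> on_circle r g ->
  0 < A -> 0 < B -> Mp f r <= A `^ p -> Mp g r <= B `^ p ->
  Mp (fun z => f z + g z) r <= (A + B) `^ p.
Proof.
move=> r0 cf cg A0 B0 fA gB; have AB : 0 < A + B by rewrite addr_gt0.
pose l := A / (A + B).
have l01 : 0 <= l <= 1.
  apply/andP; split; first by rewrite divr_ge0// ltW.
  by rewrite ler_pdivrMr// mul1r lerDl ltW.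
have l1E : 1 - l = B / (A + B) by rewrite /l; field; rewrite gt_eqF.
pose a := (A + B) `^ p * l / A `^ p; pose b := (A + B) `^ p * (1 - l) / B `^ p.
have Ap : 0 < A `^ p by rewrite powR_gt0.
have Bp : 0 < B `^ p by rewrite powR_gt0.
have cfp := circle_pow_cont (a := 0) (b := pi *+ 2) r0 cf.
have cgp := circle_pow_cont (a := 0) (b := pi *+ 2) r0 cg.
have cz k (phi : R -> R) : cont_on phi 0 (pi *+ 2) -> cont_on (fun t => k * phi t) 0 (pi *+ 2).
  by move=> cphi; apply: (@cont_onM R (cst k)) => // t _; exact: cst_continuous.
apply: (@le_trans _ _ (a * Mp f r + b * Mp g r)).
  rewrite /Mp -!rmeanZ// -rmeanD; [|exact: cz|exact: cz].
  apply: rmean_le.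
  - have cfg : on_circle r (fun z => f z + g z : Cplx R).
      by move=> z zr; exact: (ctsD (cf z zr) (cg z zr)).
    exact: (circle_pow_cont r0 cfg).
  - by apply: cont_onD; exact: cz.
  move=> t _; set x := nc (f _); set y := nc (g _).
  have x0 : 0 <= x := nc_ge0 _; have y0 : 0 <= y := nc_ge0 _.
  apply: (@le_trans _ _ ((x + y) `^ p)).
    by rewrite ge0_ler_powR ?nnegrE ?nc_ge0 ?addr_ge0 ?(ltW p0)// ncD.
  have -> : x + y = (A + B) * (l * (x / A) + (1 - l) * (y / B)).
    by rewrite l1E /l; field; rewrite !gt_eqF.
  have xA : 0 <= x / A by rewrite divr_ge0// ltW.
  have yB : 0 <= y / B by rewrite divr_ge0// ltW.
  have l0 : 0 <= l by case/andP: l01.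
  have l1 : 0 <= 1 - l by rewrite subr_ge0; case/andP: l01.
  have m0 : 0 <= l * (x / A) + (1 - l) * (y / B) := addr_ge0 (mulr_ge0 l0 xA) (mulr_ge0 l1 yB).
  rewrite (powRM _ (ltW AB) m0).
  rewrite (le_trans (ler_wpM2l (powR_ge0 _ _) (convex_pow_le l01 xA yB)))//.
  rewrite mulrDr /a /b le_eqVlt; apply/orP; left; apply/eqP.
  have E u U : 0 <= u -> 0 < U -> (u / U) `^ p = u `^ p / U `^ p.
    move=> u0 U0; apply/(canRL (mulfK _)); first by rewrite gt_eqF// powR_gt0.
    by rewrite -powRM ?divr_ge0 ?(ltW U0)// divfK// gt_eqF.
  by rewrite !E//; ring.
have a0 : 0 <= a.
  apply: divr_ge0; last exact: powR_ge0.
  by apply: mulr_ge0; [exact: powR_ge0|case/andP: l01].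
have b0 : 0 <= b.
  apply: divr_ge0; last exact: powR_ge0.
  by apply: mulr_ge0; [exact: powR_ge0|rewrite subr_ge0; case/andP: l01].
apply: (le_trans (lerD (ler_wpM2l a0 fA) (ler_wpM2l b0 gB))).
by rewrite /a /b !divfK ?gt_eqF// -mulrDr subrKC mulr1.
Qed.

(** The tangent inequality at the weighted mean y, multiplied by the density P and averaged. *)
Lemma jensen_mean (phi P : R -> R) : cont_on phi 0 (pi *+ 2) -> cont_on P 0 (pi *+ 2) ->
  (forall t, 0 <= phi t) -> (forall t, 0 <= P t) -> rmean P = 1 ->
  (rmean (fun t => phi t * P t)) `^ p <= rmean (fun t => phi t `^ p * P t).
Proof.
move=> cphi cP phi0 P0 P1; set y := rmean (fun t => phi t * P t).
have y0 : 0 <= y.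
  rewrite /y /rmean mulr_ge0 ?invr_ge0 ?(ltW twopi_gt0)//.
  by apply: Rintegral_ge0 => t _; exact: mulr_ge0.
have cpP : cont_on (fun t => phi t * P t) 0 (pi *+ 2) by exact: cont_onM.
have cppP : cont_on (fun t => phi t `^ p * P t) 0 (pi *+ 2).
  by apply: cont_onM => // t tab; apply: continuous_powR_comp => //; exact: cphi.
have cz k (h : R -> R) : cont_on h 0 (pi *+ 2) -> cont_on (fun t => k * h t) 0 (pi *+ 2).
  by move=> ch; apply: (@cont_onM R (cst k)) => // t _; exact: cst_continuous.
have : rmean (fun t => (p * y `^ (p - 1)) * (phi t * P t) - ((p - 1) * y `^ p) * P t) <=
    rmean (fun t => phi t `^ p * P t).
  apply: rmean_le => // [|t _]; first by apply: cont_onB; exact: cz.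
  have := ler_wpM2r (P0 t) (powR_tangent (phi0 t) y0).
  by rewrite mulrDl -lerBlDr; congr (_ - _ <= _); ring.
rewrite rmeanB; [|exact: cz|exact: cz].
rewrite !rmeanZ// P1 -/y mulr1 -mulrA (mulrC _ y) powR_pred//.
by rewrite mulrBl mul1r opprB addrCA subrr addr0.
Qed.

Lemma rmean_le_gauge (phi : R -> R) A : cont_on phi 0 (pi *+ 2) -> (forall t, 0 <= phi t) ->
  0 <= A -> rmean (fun t => phi t `^ p) <= A `^ p -> rmean phi <= A.
Proof.
move=> cphi phi0 A0 H.
have c1 : cont_on (cst (1 : R)) 0 (pi *+ 2) by move=> t _; exact: cst_continuous.
have := jensen_mean cphi c1 phi0 (fun=> ler01) (rmean_cst 1).
under eq_rmean do rewrite /= mulr1.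
rewrite [in X in _ <= X](eq_rmean (psi := fun t => phi t `^ p)); last by move=> t; rewrite /= mulr1.
move=> /le_trans /(_ H).
have m0 : 0 <= rmean phi.
  by rewrite /rmean mulr_ge0 ?invr_ge0 ?(ltW twopi_gt0)//; apply: Rintegral_ge0.
apply: contraTT; rewrite -!ltNge => Am.
by rewrite gt0_ltr_powR ?nnegrE.
Qed.

Lemma poisson_cont r z a b : 0 < r -> nc z < r -> cont_on (fun t => poisson r z (pt r t)) a b.
Proof.
move=> r0 zr t _; apply: (@continuousM R R (cst _)); first exact: cst_continuous.
have cw : {for pt r t, continuous (fun w : Cplx R => w - z : Cplx R)}.
  by apply: derivable_continuous; apply: derB; [exact: der_id|exact: der_cst].
have cn := continuous_angle contr1_nc cw.
apply: (@continuousV R R (fun t => nc (pt r t - z) ^+ 2)).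
  rewrite expf_neq0// gt_eqF// nc_gt0 (circle_neq zr)// nc_pt gtr0_norm//.
by apply: (@continuousM R R).
Qed.

(** Poisson's formula for the constant function 1. *)
Lemma poisson_mean r z : 0 < r -> nc z < r -> rmean (fun t => poisson r z (pt r t)) = 1.
Proof.
move=> r0 zr.
have d1 w : nc w < r + 1 -> derivable (fun _ : Cplx R => 1 : Cplx R) w 1 by move=> _; exact: der_cst.
have := poisson_formula d1 (z := z) (r := r).
rewrite r0 ltrDl ltr01 => /(_ isT zr) /(congr1 (@complex.Re R)) /= ->.
by apply: eq_rmean => t; rewrite mul1r mulr0 subr0.
Qed.

(** Poisson's formula bounds |f z| by a weighted mean of |f|; Jensen's inequality for the Poisson
    density brings the p-th power inside. *)
Lemma subharmonic f rho r z : (forall z, nc z < rho -> derivable f z 1) ->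
  0 < r < rho -> nc z < r ->
  nc (f z) `^ p <= rmean (fun t => nc (f (pt r t)) `^ p * poisson r z (pt r t)).
Proof.
move=> df rr zr; have /andP[r0 rrho] := rr; have r0' := ltW r0.
have cf : on_circle r f by move=> w wr; apply/derivable_continuous/df; rewrite wr.
have cP := @poisson_cont r z 0 (pi *+ 2) r0 zr.
have cn := circle_cont (a := 0) (b := pi *+ 2) r0' contr1_nc cf.
apply: le_trans (jensen_mean cn cP (fun=> nc_ge0 _) (fun t => poisson_ge0 _ zr) (poisson_mean r0 zr)).
have m0 : 0 <= rmean (fun t => nc (f (pt r t)) * poisson r z (pt r t)).
  rewrite /rmean mulr_ge0 ?invr_ge0 ?(ltW twopi_gt0)//.
  by apply: Rintegral_ge0 => t _; rewrite mulr_ge0 ?nc_ge0 ?poisson_ge0.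
rewrite ge0_ler_powR ?nnegrE ?nc_ge0 ?(ltW p0)//.
rewrite (poisson_formula df rr zr).
have cPc : on_circle r (fun w => (poisson r z w)%:C%C : Cplx R).
  move=> w wr; have wz := circle_neq zr wr.
  have cn' : {for w, continuous (fun w : Cplx R => nc (w - z))}.
    apply/(@cvgrPdist_lt _ R^o _ (nbhs w)) => e e0.
    apply/nbhs_ballP; exists e%:C%C; first by rewrite /= ltcR.
    move=> v; rewrite -ball_normE /= normE ltcR; apply: le_lt_trans.
    by rewrite (le_trans (contr1_nc _ _))// opprB addrA subrK.
  have cr : {for w, continuous (poisson r z)}.
    apply: (@continuousM R (Cplx R) (cst _)); first exact: cst_continuous.
    apply: (@continuousV R (Cplx R) (fun w => nc (w - z) ^+ 2)).
      by rewrite expf_neq0// gt_eqF// nc_gt0.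
    exact: (@continuousM R (Cplx R)).
  apply/continuous_ncP => e e0.
  move/(@cvgrPdist_lt _ R^o _ (nbhs w)): cr => /(_ e e0) /nbhs_ballP[d /= d0 H].
  have [dE d0'] := gt0_complexE d0; exists (complex.Re d) => // v vw.
  rewrite /= subrr expr0n /= addr0 sqrtr_sqr distrC; apply: H.
  by rewrite -ball_normE /= normE dE ltcR nc_distC.
apply: (le_trans (nc_cmean r0' _)) => [w wr|]; first exact: (ctsM (cf w wr) (cPc w wr)).
rewrite le_eqVlt; apply/orP; left; apply/eqP; apply: eq_rmean => t.
by rewrite ncM nc_real ger0_norm// poisson_ge0.
Qed.

End PowerMeans.

(** * Tonelli's theorem on measurable rectangles *)

Section TonelliOn.
Local Open Scope ereal_scope.
Context (d1 d2 : measure_display) (T1 : measurableType d1) (T2 : measurableType d2) (R : realType).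
Variables (m1 : {sigma_finite_measure set T1 -> \bar R}) (m2 : {sigma_finite_measure set T2 -> \bar R}).
Variables (A : set T1) (B : set T2) (F : T1 * T2 -> \bar R).
Hypotheses (mA : measurable A) (mB : measurable B).
Hypotheses (mF : measurable_fun [set: T1 * T2] F) (F0 : forall x, 0 <= F x).

(** Extension by zero off the rectangle reduces both results below to Tonelli's theorem on the full
    product. *)
Let H := F \_ (A `*` B).

Let mH : measurable_fun [set: T1 * T2] H.
Proof.
apply/(measurable_restrictT _ _).1 => //; first exact: measurableX.
exact: measurable_funTS.
Qed.

Let H0 x : 0 <= H x.
Proof. by rewrite /H patchE; case: ifP. Qed.

Let HF x : \int[m2]_y H (x, y) = ((fun x => \int[m2]_(y in B) F (x, y)) \_ A) x.
Proof.
rewrite [RHS]patchE; case: ifPn => [xA|xA].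
  rewrite [RHS]integral_mkcond; apply: eq_integral => y _.
  by rewrite /H !patchE in_setX/= xA.
apply: integral0_eq => y _; rewrite /H patchE ifF//.
by apply: contraNF xA; rewrite !inE => -[].
Qed.

Let HG y : \int[m1]_x H (x, y) = ((fun y => \int[m1]_(x in A) F (x, y)) \_ B) y.
Proof.
rewrite [RHS]patchE; case: ifPn => [yB|yB].
  rewrite [RHS]integral_mkcond; apply: eq_integral => x _.
  by rewrite /H !patchE in_setX/= yB andbT.
apply: integral0_eq => x _; rewrite /H patchE ifF//.
by apply: contraNF yB; rewrite !inE => -[].
Qed.

Lemma tonelli_on : \int[m1]_(x in A) \int[m2]_(y in B) F (x, y) =
  \int[m2]_(y in B) \int[m1]_(x in A) F (x, y).
Proof.
rewrite integral_mkcond [RHS]integral_mkcond.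
under eq_integral do rewrite -HF.
under [RHS]eq_integral do rewrite -HG.
exact: fubini_tonelli.
Qed.

Lemma measurable_tonelli_on : measurable_fun A (fun x => \int[m2]_(y in B) F (x, y)).
Proof.
apply/(measurable_restrictT _ mA).
have := measurable_fun_fubini_tonelli_F (m2 := m2) H mH H0.
by congr measurable_fun; apply/funext => x; rewrite /fubini_F HF.
Qed.

End TonelliOn.


Lemma cont_onZ {R : realType} (k : R) (phi : R -> R) (a b : R) :
  cont_on phi a b -> cont_on (fun t => k * phi t) a b.
Proof.
move=> cphi; have ck : cont_on (fun=> k) a b by move=> t _; exact: cst_continuous.
exact: (cont_onM ck cphi).
Qed.

(** * Monotonicity and continuity of integral means in the radius *)

Section MonotoneMeans.
Context {R : realType}.
Notation mu := (@lebesgue_measure R).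
Variable p : R.
Hypothesis p1 : 1 <= p.
Let p0 : 0 < p. Proof. exact: lt_le_trans p1. Qed.

Lemma EFin_Int (phi : R -> R) : cont_on phi 0 (pi *+ 2) ->
  (\int[mu]_(t in `[0%R, (pi *+ 2)%R]%classic) (phi t)%:E)%E = ((pi *+ 2) * rmean phi)%:E.
Proof.
move=> cphi; have := cont_integrable cphi => /integrable_fin_num H.
rewrite /rmean mulrA divff ?mul1r; last by rewrite gt_eqF// twopi_gt0.
by rewrite /Rintegral fineK//; exact: H.
Qed.

Lemma nc_pt_swap (r s a b : R) : nc (pt r a - pt s b) ^+ 2 = r ^+ 2 + s ^+ 2 - r * s *+ 2 * (cos a * cos b + sin a * sin b).
Proof.
rewrite /pt /cpt /= sqr_sqrtr ?addr_ge0 ?sqr_ge0//.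
have := cos2Dsin2 a; have := cos2Dsin2 b.
move: (cos a) (sin a) (cos b) (sin b) => ca sa cb sb Hb Ha.
transitivity (r ^+ 2 * (ca ^+ 2 + sa ^+ 2) + s ^+ 2 * (cb ^+ 2 + sb ^+ 2) - r * s *+ 2 * (ca * cb + sa * sb)).
  by ring.
by rewrite Ha Hb !mulr1.
Qed.

(** After expansion the angles enter only through cos a cos b + sin a sin b. *)
Lemma poisson_swap (r s a b : R) : poisson r (pt s a) (pt r b) = poisson r (pt s b) (pt r a).
Proof.
rewrite /poisson !nc_pt !nc_pt_swap; congr (_ / (_ - _ * _)).
by rewrite mulrC (mulrC (sin b)).
Qed.

(* Average the sub-mean value inequality over |z| = s; the Poisson kernel is symmetric in the
   two angles, so Tonelli removes it. *)
Lemma Mp_mono (f : Cplx R -> Cplx R) rho s r : (forall z, nc z < rho -> derivable f z 1) ->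
  0 <= s -> s < r -> r < rho -> Mp p f s <= Mp p f r.
Proof.
move=> df s0 sr rr; have r0 : 0 < r by exact: le_lt_trans sr.
have r0' := ltW r0.
have rr' : 0 < r < rho by rewrite r0.
have cfr : on_circle r f by move=> w wr; apply/derivable_continuous/df; rewrite wr.
have cfs : on_circle s f by move=> w ws; apply/derivable_continuous/df; rewrite ws (lt_trans sr).
pose I := `[0%R, pi *+ 2]%classic : set R.
pose k := (pi *+ 2)^-1 : R.
have k0 : 0 < k by rewrite invr_gt0 twopi_gt0.
have kK : pi *+ 2 * k = 1 by rewrite mulfV// gt_eqF// twopi_gt0.
pose phi (t : R) := nc (f (pt r t)) `^ p.
(* With the factor [k] = 1 / (2 pi) in the kernel, integration over either angle produces a
   normalized circle mean. *)
pose G (x : R * R) := phi x.2 * (k * poisson r (pt s x.1) (pt r x.2)).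
have sP t : nc (pt s t) < r by rewrite nc_pt ger0_norm.
have G0 x : 0 <= G x by rewrite /G mulr_ge0 ?powR_ge0// mulr_ge0 ?(ltW k0)// poisson_ge0.
have mphi : measurable_fun [set: R] phi.
  apply: continuous_measurable_fun => t.
  by apply: (circle_pow_cont p1 r0' cfr (a := t) (b := t)); rewrite !lexx.
have mG : measurable_fun [set: R * R] G.
  apply: measurable_funM; first exact: measurableT_comp mphi measurable_snd.
  apply: measurable_funM => //.
  rewrite /poisson; apply: measurable_funM.
    rewrite (_ : (fun x => _) = cst (r ^+ 2 - `|s| ^+ 2)); first exact: measurable_cst.
    by apply/funext => x; rewrite nc_pt.
  rewrite (_ : (fun x => _) = (fun x : R * R => (r ^+ 2 + s ^+ 2 - r * s *+ 2 *
      (cos x.1 * cos x.2 + sin x.1 * sin x.2)) `^ (-1))); last first.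
    apply/funext => x; rewrite (mulrC (cos x.1)) (mulrC (sin x.1)) -nc_pt_swap.
    by rewrite powR_inv1// sqr_ge0.
  apply: (measurableT_comp (@measurable_powR R (-1))).
  have mc : measurable_fun [set: R] (@cos R) by apply: continuous_measurable_fun; exact: continuous_cos.
  have ms : measurable_fun [set: R] (@sin R) by apply: continuous_measurable_fun; exact: continuous_sin.
  apply: measurable_funB => //; apply: measurable_funM => //.
  apply: measurable_funD; apply: measurable_funM.
  - exact: measurableT_comp mc measurable_fst.
  - exact: measurableT_comp mc measurable_snd.
  - exact: measurableT_comp ms measurable_fst.
  - exact: measurableT_comp ms measurable_snd.
have mII : measurable I by exact: measurable_itv.
have mG' : measurable_fun [set: R * R] (fun x => (G x)%:E) by exact/measurable_EFinP.
have G0' x : (0 <= (G x)%:E)%E by rewrite lee_fin.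
have HG : (\int[mu]_(x in I) \int[mu]_(y in I) (G (x, y))%:E = \int[mu]_(y in I) \int[mu]_(x in I) (G (x, y))%:E)%E.
  exact: (@tonelli_on _ _ _ _ R mu mu I I (fun x => (G x)%:E) mII mII mG' G0').
have mI := @measurable_tonelli_on _ _ _ _ R mu I I (fun x => (G x)%:E) mII mII mG' G0'.
suff : (\int[mu]_(t in I) (nc (f (pt s t)) `^ p)%:E <= \int[mu]_(t in I) (nc (f (pt r t)) `^ p)%:E)%E.
  have Es := EFin_Int (circle_pow_cont p1 s0 cfs).
  have Er := EFin_Int (circle_pow_cont p1 r0' cfr).
  by rewrite /I Es Er lee_fin (ler_pM2l twopi_gt0).
(* Integrated over the angle of the inner point, the kernel contributes 1: by symmetry this is the
   mean of a Poisson kernel over the outer circle. *)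
have -> : (\int[mu]_(t in I) (nc (f (pt r t)) `^ p)%:E = \int[mu]_(y in I) \int[mu]_(x in I) (G (x, y))%:E)%E.
  apply: eq_integral => t _; rewrite /G /=.
  have cP : cont_on (fun x => poisson r (pt s x) (pt r t)) 0 (pi *+ 2).
    have := @poisson_cont R r (pt s t) 0 (pi *+ 2) r0 (sP t).
    by congr cont_on; apply/funext => x; rewrite poisson_swap.
  have ck : cont_on (fun x => phi t * (k * poisson r (pt s x) (pt r t))) 0 (pi *+ 2).
    by do 2 apply: cont_onZ.
  rewrite (EFin_Int ck) (@rmeanZ _ (phi t) _ (@cont_onZ _ k _ _ _ cP)) (@rmeanZ _ k _ cP); congr (_%:E).
  rewrite (eq_rmean (psi := fun x => poisson r (pt s t) (pt r x))); last by move=> x; rewrite poisson_swap.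
  by rewrite (poisson_mean r0 (sP t)) mulr1 mulrCA kK mulr1.
rewrite -HG.
have m1 : measurable_fun I (fun t => (nc (f (pt s t)) `^ p)%:E).
  apply/measurable_EFinP; apply: measurable_funTS; apply: continuous_measurable_fun => t.
  by apply: (circle_pow_cont p1 s0 cfs (a := t) (b := t)); rewrite !lexx.
apply: ge0_le_integral; first exact: mII.
- by move=> t _; rewrite lee_fin powR_ge0.
- exact: m1.
- exact: mI.
move=> t _.
have cPt : cont_on (fun u => poisson r (pt s t) (pt r u)) 0 (pi *+ 2) by exact: poisson_cont.
have cphi : cont_on phi 0 (pi *+ 2) by exact: circle_pow_cont.
have cG : cont_on (fun u => phi u * poisson r (pt s t) (pt r u)) 0 (pi *+ 2) by exact: cont_onM.
have -> : (\int[mu]_(u in I) (G (t, u))%:E)%E = (rmean (fun u => phi u * poisson r (pt s t) (pt r u)))%:E.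
  rewrite /G /= (_ : (fun u => _) = (fun u => (k * (phi u * poisson r (pt s t) (pt r u)))%:E)).
    rewrite (EFin_Int (@cont_onZ _ k _ _ _ cG)).
    by rewrite (@rmeanZ _ k _ cG) mulrA kK mul1r.
  by apply/funext => u; rewrite mulrCA.
by rewrite lee_fin; exact: (subharmonic p1 df rr' (sP t)).
Qed.

(** The p-th power of the modulus is not a contraction. Truncated at a bound M of |f| and divided by
    the Lipschitz constant K of x^p on [0, M] it becomes one, and near the given radius the
    truncation changes nothing. *)
Lemma Mp_continuous (f : Cplx R -> Cplx R) rho x : (forall z, nc z < rho -> {for z, continuous f}) ->
  `|x| < rho -> {for x, continuous (fun x => Mp p f x)}.
Proof.
move=> cf xr; have [m1 m2] := midf_lt xr; set b := (`|x| + rho) / 2 in m1 m2.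
have b0 : 0 < b by exact: le_lt_trans m1.
have cfb (y t : R) : - b <= y <= b -> {for pt y t, continuous f}.
  by rewrite -ler_norml => yb; apply: cf; rewrite nc_pt (le_lt_trans yb).
have bb : - b <= b by rewrite (@le_trans _ _ 0) ?oppr_le0 ?(ltW b0).
have [M0 M00 fM0] := bounded_polar bb cfb.
pose M := M0 + 1; have Mgt : 0 < M by rewrite ltr_wpDl.
pose K := p * M `^ (p - 1).
have K0 : 0 < K by rewrite mulr_gt0// powR_gt0.
pose G (z : Cplx R) := (Num.min (nc z) M) `^ p / K.
have cG : contr1 G.
  move=> z w; rewrite /G -mulrBl normrM normfV (gtr0_norm K0) ler_pdivrMr// mulrC.
  apply: (le_trans (powR_lip p1 (M := M) _ _)).
  - by rewrite le_min nc_ge0 (ltW Mgt) ge_min lexx orbT.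
  - by rewrite le_min nc_ge0 (ltW Mgt) ge_min lexx orbT.
  rewrite ler_wpM2l ?(ltW K0)// (le_trans _ (contr1_nc z w))//.
  rewrite /Order.min; case: ifPn; case: ifPn => //; rewrite -?leNgt => A B.
  - rewrite ler0_norm ?subr_le0 ?(ltW B)// ler0_norm; lra.
  - rewrite ger0_norm ?subr_ge0 ?(ltW A)// ger0_norm; lra.
  - by rewrite subrr normr0.
have C := continuous_mean cG cf xr.
have E : {near x, (fun y => K * ((pi *+ 2)^-1 * \int[mu]_(t in `[0, pi *+ 2]) G (f (pt y t)))) =1 Mp p f}.
  apply/nbhs_ballP; exists (b - `|x|); first by rewrite /= subr_gt0.
  move=> y; rewrite /ball /= => xy.
  have yb : - b <= y <= b.
    by rewrite -ler_norml -[y](subrK x) (le_trans (ler_normD _ _))// distrC -lerBrDr ltW.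
  rewrite /Mp /rmean mulrCA; congr (_ * _).
  rewrite -RintegralZl//; last first.
    apply: cont_integrable => t _; apply: (continuous_angle cG); exact: cfb.
  apply: eq_Rintegral => t; rewrite inE /= in_itv /= => tpi.
  have -> : G (f (pt y t)) = nc (f (pt y t)) `^ p / K.
    rewrite /G; congr (_ `^ p / K); apply/min_idPl.
    by rewrite (le_trans (fM0 _ _ yb tpi))// lerDl.
  by rewrite mulrCA divff ?mulr1// gt_eqF.
apply: (cvg_trans (near_eq_cvg E)); rewrite -(nbhs_singleton E).
apply: cvgM; first exact: cvg_cst.
by apply: cvgM; [exact: cvg_cst|exact: C].
Qed.
End MonotoneMeans.

(** * Uniform boundedness on H^p *)

Section GlidingHump.
Context {R : realType} (V : zmodType).
(** [bnd x A] plays the role of a norm bound of A on x, and [sc] of multiplication by real scalars.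
    The hypotheses on [bnd] are the norm axioms for positive bounds, together with completeness
    along series dominated by a halving sequence. *)
Variables (sc : R -> V -> V) (bnd : V -> R -> Prop) (T : nat -> V -> V).
Implicit Types (x y : V) (A B C e K : R).
Hypothesis bndD : forall x y A B, 0 < A -> 0 < B -> bnd x A -> bnd y B -> bnd (x + y) (A + B).
Hypothesis bndN : forall x A, bnd x A -> bnd (- x) A.
Hypothesis bndS : forall a x A, 0 < a -> 0 < A -> bnd x A -> bnd (sc a x) (a * A).
Hypothesis bndW : forall x A B, 0 < A -> A <= B -> bnd x A -> bnd x B.
Hypothesis bnd_complete : forall (xi : nat -> V) (eps : nat -> R),
  (forall j, 0 < eps j) -> (forall j, eps j.+1 <= eps j / 2) -> (forall j, bnd (xi j) (eps j)) ->
  exists y, forall j, bnd (y - \sum_(i < j) xi i) (2 * eps j).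
Hypothesis scK : forall a x, 0 < a -> sc a^-1 (sc a x) = x.
Hypothesis sc2 : forall x, x + x = sc 2 x.
Hypothesis TD : forall n x y, T n (x + y) = T n x + T n y.
Hypothesis TN : forall n x, T n (- x) = - T n x.
Hypothesis TS : forall n a x, T n (sc a x) = sc a (T n x).
Hypothesis Tbnd : forall n, exists2 B, 0 < B & forall x A, 0 < A -> bnd x A -> bnd (T n x) (B * A).
Hypothesis Tpt : forall x A, 0 < A -> bnd x A -> exists2 K, 0 < K & forall n, bnd (T n x) K.

(* A uniform boundedness principle for the gauge bnd, by Sokal's gliding hump:
   replacing s by s + xi or s - xi makes T_n s at least as large as T_n xi. *)
Lemma gliding_hump : exists2 C, 0 < C & forall n x A, 0 < A -> bnd x A -> bnd (T n x) (C * A).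
Proof.
apply: contrapT => NH.
have H C : 0 < C -> exists n x A, [/\ 0 < A, bnd x A & ~ bnd (T n x) (C * A)].
  move=> C0; apply: contrapT => N; apply: NH; exists C => // n x A A0 xA.
  by apply: contrapT => nb; apply: N; exists n, x, A.
have step1 e K : 0 < e -> 0 < K -> exists n xi, bnd xi e /\ ~ bnd (T n xi) K.
  move=> e0 K0; have [n [x [A [A0 xA nb]]]] := H (K / e) (divr_gt0 K0 e0).
  have eA : 0 < e / A by rewrite divr_gt0.
  exists n, (sc (e / A) x); split.
    by rewrite -[X in bnd _ X](divfK (lt0r_neq0 A0)); exact: bndS.
  rewrite TS => b; apply: nb; rewrite -[T n x](scK _ eA).
  rewrite [X in bnd _ X](_ : _ = (e / A)^-1 * K).
    by apply: bndS => //; rewrite invr_gt0.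
  by rewrite invf_div; field; rewrite !gt_eqF.
(* T (s + xi) and T (s - xi) differ by twice T xi, so they cannot both be bounded by K when T xi is
   not. *)
have step2 s e K : 0 < e -> 0 < K -> exists nx : nat * V, bnd nx.2 e /\ ~ bnd (T nx.1 (s + nx.2)) K.
  move=> e0 K0; have [n [xi [xe nb]]] := step1 e K e0 K0.
  have [bp|nbp] := pselect (bnd (T n (s + xi)) K); last by exists (n, xi).
  exists (n, - xi); split; first exact: bndN.
  move=> /= bm; apply: nb.
  have : bnd (T n (s + xi) - T n (s - xi)) (K + K) by apply: bndD => //; exact: bndN.
  rewrite -TN -TD opprB addrC addrA subrK TD sc2 => /(bndS (a := 2^-1) _ (addr_gt0 K0 K0)).
  rewrite scK// (_ : 2^-1 * (K + K) = K); last by field.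
  by apply; rewrite invr_gt0.
have /choice[sel selP] : forall q : V * R * nat, exists nx : nat * V, 0 < q.1.2 ->
    bnd nx.2 q.1.2 /\ ~ bnd (T nx.1 (q.1.1 + nx.2)) q.2.+1%:R.
  move=> [[s e] j] /=.
  have [e0|ne] := pselect (0 < e); last by exists (0%N, 0) => e0.
  by have [nx P] := step2 s e j.+1%:R e0 (ltr0Sn _ _); exists nx.
have /choice[Bn BnP] : forall n : nat, exists B : R, 0 < B /\
    forall x A, 0 < A -> bnd x A -> bnd (T n x) (B * A).
  by move=> n; have [B B0 P] := Tbnd n; exists B.
(* A state holds the partial sum, the size allowed for the next hump, and the index. The new size is
   at most 1 / (2 B), with B a bound for the operator just selected, so that this operator moves the
   whole remaining tail by at most 1. *)
pose nxt (q : V * R * nat) : V * R * nat :=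
  (q.1.1 + (sel q).2, Num.min (q.1.2 / 2) (2 * Bn (sel q).1)^-1, q.2.+1).
pose st j := iter j nxt (0, 1, 0%N).
have stj j : (st j).2 = j by elim: j => //= j ->.
pose eps j := (st j).1.2; pose xi j := (sel (st j)).2; pose nn j := (sel (st j)).1.
have B20 j : 0 < 2 * Bn (nn j) by rewrite mulr_gt0//; case: (BnP (nn j)).
have epsS j : eps j.+1 = Num.min (eps j / 2) (2 * Bn (nn j))^-1 by [].
have e0 j : 0 < eps j.
  elim: j => [|j ih]; first exact: ltr01.
  by rewrite epsS lt_min divr_gt0//= invr_gt0.
have stS j : (st j).1.1 = \sum_(i < j) xi i.
  by elim: j => [|j ih]; rewrite ?big_ord0// big_ord_recr /= -ih.
have sP j := selP (st j) (e0 j).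
have [||j|y yP] := @bnd_complete xi eps.
- exact: e0.
- by move=> j; rewrite epsS ge_min lexx.
- by case: (sP j).
have := yP 0%N; rewrite big_ord0 subr0 => y2.
have [K K0 yK] := Tpt (mulr_gt0 (ltr0Sn _ 1) (e0 0%N)) y2.
(* At stage j the selected operator is not bounded by j + 1 on the partial sum including hump j.
   That sum is the limit y minus the tail, whose images have bounds K <= j and 1. *)
pose j := Num.bound K.
have [_] := sP j; apply; rewrite stj stS -/(xi j) -/(nn j).
have -> : \sum_(i < j) xi i + xi j = y - (y - \sum_(i < j.+1) xi i).
  by rewrite opprB [RHS]addrC subrK [RHS]big_ord_recr.
rewrite TD TN.
have b1 : bnd (T (nn j) (y - \sum_(i < j.+1) xi i)) 1.
  have [B0 BP] := BnP (nn j).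
  apply: (bndW _ _ (BP _ _ _ (yP j.+1))).
  - by rewrite !mulr_gt0.
  - have e' : eps j.+1 <= (2 * Bn (nn j))^-1 by rewrite epsS ge_min lexx orbT.
    rewrite -(ler_pM2l (B20 j)) mulfV ?gt_eqF// in e'.
    by rewrite mulrA (mulrC (Bn (nn j))).
  - by rewrite mulr_gt0.
apply: (bndW _ _ (bndD K0 ltr01 (yK (nn j)) (bndN b1))); first exact: addr_gt0.
rewrite -natr1 lerD2r ltW//; apply: archi_boundP; exact: ltW.
Qed.
End GlidingHump.

(** * The H^p gauge on coefficient sequences *)

Section CoefficientSpace.
Context {R : realType}.
Variable p : R.
Hypothesis p1 : 1 <= p.
Let p0 : 0 < p. Proof. exact: lt_le_trans p1. Qed.
Implicit Types (c d : nat -> Cplx R) (A B r : R) (z w : Cplx R).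

(** Sequences rather than functions are the basic objects: multipliers act on them entrywise, and
    values outside the disk do not enter. *)
Definition PS c z : Cplx R := limn (series (fun k => c k * z ^+ k)).

Lemma PS_has_pow c : coef_class 1 c -> has_pow 1 (PS c) c.
Proof.
move=> cc; split=> // z z1; have [l cl] := coef_class_cvg cc z1.
suff -> : PS c z = l by [].
exact: (cvg_lim (@norm_hausdorff _ (Cplx R)) cl).
Qed.

Lemma PS_eq c z (l : Cplx R) : series (fun k => c k * z ^+ k) n @[n --> \oo] --> l -> PS c z = l.
Proof. by move=> cl; exact: (cvg_lim (@norm_hausdorff _ (Cplx R)) cl). Qed.

Lemma PS_cvg c z : coef_class 1 c -> nc z < 1 ->
  series (fun k => c k * z ^+ k) n @[n --> \oo] --> PS c z.
Proof. by move=> /PS_has_pow[_]; apply. Qed.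

Lemma PS_derivable c z : coef_class 1 c -> nc z < 1 -> derivable (PS c) z 1.
Proof. by move=> /PS_has_pow/has_pow_deriv[_]; apply. Qed.

Lemma PS_holomorphic c : coef_class 1 c -> holomorphic_disk (PS c).
Proof. by move=> cc z z1; apply/holomorphic_derivable; exact: PS_derivable. Qed.

Lemma PS_taylor c k : coef_class 1 c -> taylor_coef (PS c) k = c k.
Proof. by move=> /PS_has_pow; exact: has_pow_taylor ltr01. Qed.

Lemma PS_circle c r : coef_class 1 c -> r < 1 -> on_circle r (PS c).
Proof. by move=> cc r1 z zr; apply/derivable_continuous/PS_derivable => //; rewrite zr. Qed.

Lemma eq_cvg_c (u v : nat -> Cplx R) (l : Cplx R) : u =1 v ->
  u n @[n --> \oo] --> l -> v n @[n --> \oo] --> l.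
Proof. by move=> /funext ->. Qed.

Lemma coef_classD c d : coef_class 1 c -> coef_class 1 d -> coef_class 1 (c + d).
Proof.
move=> cc cd s s1; have [M HM] := cc s s1; have [N HN] := cd s s1.
exists (M + N) => k; have /andP[s0 _] := s1.
rewrite (le_trans (ler_wpM2r (exprn_ge0 k s0) (ncD (c k) (d k))))// mulrDl.
exact: lerD.
Qed.

Lemma coef_classN c : coef_class 1 c -> coef_class 1 (- c).
Proof. by move=> cc s /cc[M HM]; exists M => k; rewrite ncN. Qed.

Lemma PSD c d z : coef_class 1 c -> coef_class 1 d -> nc z < 1 -> PS (c + d) z = PS c z + PS d z.
Proof.
move=> cc cd z1; apply: PS_eq.
have := cvgD_c (PS_cvg cc z1) (PS_cvg cd z1).
apply: eq_cvg_c => n; rewrite /series /= -big_split /=.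
by apply: eq_bigr => k _; rewrite -mulrDl.
Qed.

Lemma PSN c z : coef_class 1 c -> nc z < 1 -> PS (- c) z = - PS c z.
Proof.
move=> cc z1; apply: PS_eq.
have := @cvgZ_c _ _ (-1) _ (PS_cvg cc z1); rewrite mulN1r.
apply: eq_cvg_c => n; rewrite /series /= mulN1r -sumrN.
by apply: eq_bigr => k _; rewrite -mulNr.
Qed.

Lemma PSZ (a : Cplx R) c z : coef_class 1 c -> nc z < 1 -> PS (fun k => a * c k) z = a * PS c z.
Proof.
move=> cc z1; apply: PS_eq; have := @cvgZ_c _ _ a _ (PS_cvg cc z1).
apply: eq_cvg_c => n; rewrite /series /= mulr_sumr.
by apply: eq_bigr => k _; rewrite mulrA.
Qed.

Lemma eq_Mp (f g : Cplx R -> Cplx R) r : 0 <= r -> (forall z, nc z = r -> f z = g z) ->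
  Mp p f r = Mp p g r.
Proof.
by move=> r0 fg; apply: eq_rmean => t; rewrite fg// nc_pt ger0_norm.
Qed.

(* The H^p norm of PS c is at most A. *)
Definition bnd c A := coef_class 1 c /\ forall r, 0 <= r < 1 -> Mp p (PS c) r <= A `^ p.

Lemma bndD c d A B : 0 < A -> 0 < B -> bnd c A -> bnd d B -> bnd (c + d) (A + B).
Proof.
move=> A0 B0 [cc cA] [cd dB]; split=> [|r r01]; first exact: coef_classD.
have /andP[r0 r1] := r01.
rewrite (@eq_Mp _ (fun z => PS c z + PS d z))//; last by move=> z zr; rewrite PSD// zr.
apply: (minkowski_gauge p1 r0 (PS_circle cc r1) (PS_circle cd r1) A0 B0) => //; [exact: cA|exact: dB].
Qed.

Lemma bndW c A B : 0 < A -> A <= B -> bnd c A -> bnd c B.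
Proof.
move=> A0 AB [cc cA]; split=> // r /cA/le_trans; apply.
by rewrite ge0_ler_powR ?nnegrE ?(ltW p0) ?(ltW A0)// (le_trans (ltW A0)).
Qed.

Lemma bndN c A : bnd c A -> bnd (- c) A.
Proof.
move=> [cc cA]; split=> [|r r01]; first exact: coef_classN.
have /andP[r0 r1] := r01; apply: le_trans (cA r r01).
rewrite (@eq_Mp _ (fun z => - PS c z) r r0); last by move=> z zr; rewrite PSN// zr.
by rewrite /Mp; under eq_rmean do rewrite ncN.
Qed.

Definition scaleC (a : R) c : nat -> Cplx R := fun k => a%:C%C * c k.

Lemma bndS a c A : 0 < a -> 0 < A -> bnd c A -> bnd (scaleC a c) (a * A).
Proof.
move=> a0 A0 [cc cA].
have ca : coef_class 1 (scaleC a c).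
  move=> s /cc[M HM]; exists (a * M) => k.
  by rewrite /scaleC ncM nc_real gtr0_norm// -mulrA ler_pM2l.
split=> // r r01; have /andP[r0 r1] := r01.
rewrite (@eq_Mp _ (fun z => a%:C%C * PS c z))//; last by move=> z zr; rewrite PSZ// zr.
rewrite /Mp (eq_rmean (psi := fun t => a `^ p * nc (PS c (pt r t)) `^ p)); last first.
  by move=> t; rewrite ncM nc_real gtr0_norm// powRM ?nc_ge0// ltW.
rewrite rmeanZ; last exact: circle_pow_cont (PS_circle cc r1).
by rewrite powRM ?(ltW a0) ?(ltW A0)// ler_wpM2l ?powR_ge0// cA.
Qed.

Lemma one_sub_mul_le (h : R) k : 0 <= h <= 1 -> 1 - k%:R * h <= (1 - h) ^+ k.
Proof.
move=> /andP[h0 h1]; elim: k => [|k ih]; first by rewrite mul0r subr0 expr0.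
have h1' : 0 <= 1 - h by rewrite subr_ge0.
rewrite exprS; apply: le_trans (ler_wpM2l h1' ih).
rewrite -subr_ge0 -natr1 (_ : _ - _ = k%:R * h ^+ 2); last by ring.
by rewrite mulr_ge0 ?sqr_ge0.
Qed.

(** Letting r tend to 1: for r = 1 - h with h = e / D, Bernoulli's inequality loses at most x k h <=
    e. The summands e + 1 in D ensure h < 1. *)
Lemma le_of_mul_pow (x A : R) k : 0 <= x -> (forall r, 0 < r < 1 -> x * r ^+ k <= A) -> x <= A.
Proof.
move=> x0 H; apply/ler_addgt0Pr => e e0.
pose D := x * k%:R + e + 1; have xk : 0 <= x * k%:R by rewrite mulr_ge0.
have D0 : 0 < D by rewrite /D; lra.
pose h := e / D.
have h0 : 0 < h by rewrite divr_gt0.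
have h1 : h < 1 by rewrite ltr_pdivrMr// mul1r /D; lra.
have := H (1 - h); rewrite subr_gt0 h1 ltrBlDr ltrDl h0 => /(_ isT).
have B : 1 - k%:R * h <= (1 - h) ^+ k.
  by apply: one_sub_mul_le; rewrite !ltW.
move=> H'; have : x * (1 - k%:R * h) <= A by apply: le_trans H'; exact: ler_wpM2l.
rewrite mulrBr mulr1 mulrA => H2.
have : x * k%:R * h <= e.
  rewrite /h mulrA ler_pdivrMr// mulrC ler_pM2l// /D; lra.
by move=> H3; lra.
Qed.

(** The coefficient estimate on each circle, combined with Jensen's inequality, gives |c_k| r^k <=
    A; then r tends to 1. *)
Lemma bnd_coef c A k : 0 < A -> bnd c A -> nc (c k) <= A.
Proof.
move=> A0 [cc cA]; have [_ H] := holomorphic_has_pow (PS_holomorphic cc).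
apply: (@le_of_mul_pow _ _ k (nc_ge0 _)) => r r01; have /andP[r0 r1] := r01.
have := H r r01 k; rewrite (PS_taylor _ cc) => /le_trans; apply.
apply: (rmean_le_gauge p1 _ _ (ltW A0)).
- exact: (circle_cont (ltW r0) contr1_nc (PS_circle cc r1)).
- by move=> t; exact: nc_ge0.
- by apply: cA; rewrite (ltW r0).
Qed.

Lemma bounded_coef_class c (D : R) : (forall k, nc (c k) <= D) -> coef_class 1 c.
Proof.
move=> cD s /andP[s0 s1]; exists D => k; rewrite -[leRHS]mulr1.
by apply: ler_pM; rewrite ?nc_ge0 ?exprn_ge0// exprn_ile1// ltW.
Qed.

Lemma geom_sum_le (r : R) n : 0 <= r < 1 -> \sum_(0 <= k < n) r ^+ k <= (1 - r)^-1.
Proof.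
move=> /andP[r0 r1]; have r1' : 0 < 1 - r by rewrite subr_gt0.
rewrite big_mkord -(ler_pM2l r1') mulfV ?gt_eqF//.
have -> : (1 - r) * \sum_(i < n) r ^+ i = 1 - r ^+ n.
  by rewrite -[RHS]opprB subrX1 -mulNr opprB.
by rewrite gerBl exprn_ge0.
Qed.

Lemma PS_le c (D : R) z : (forall k, nc (c k) <= D) -> nc z < 1 -> nc (PS c z) <= D / (1 - nc z).
Proof.
move=> cD z1; have D0 : 0 <= D := le_trans (nc_ge0 _) (cD 0%N).
apply: (nc_lim_le (PS_cvg (bounded_coef_class cD) z1)) => n.
rewrite /series /= (le_trans (nc_sum _ _ _))//.
apply: (@le_trans _ _ (D * \sum_(0 <= k < n) nc z ^+ k)).
  rewrite mulr_sumr; apply: ler_sum => k _.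
  by rewrite ncM ncX ler_wpM2r ?exprn_ge0 ?nc_ge0.
by rewrite ler_wpM2l// geom_sum_le// nc_ge0.
Qed.

(** The bound telescopes: halving gives eps_j <= 2 eps_j - 2 eps_(j+1). The difference form keeps a
    reserve for further terms. *)
Lemma sub_sum_le (xi : nat -> nat -> Cplx R) (eps : nat -> R) :
  (forall j, 0 < eps j) -> (forall j, eps j.+1 <= eps j / 2) ->
  (forall j, bnd (xi j) (eps j)) -> forall J i,
  bnd (\sum_(l < J + i.+1) xi l - \sum_(l < J) xi l) (2 * eps J - 2 * eps (J + i.+1)%N).
Proof.
move=> e0 eS xe J; elim=> [|i ih].
  rewrite addn1 big_ord_recr /= addrAC subrr add0r.
  apply: bndW (xe J) => //; have := eS J; lra.
rewrite addnS big_ord_recr /= addrAC.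
have e1 : eps (J + i.+1)%N < eps J.
  elim: i {ih} => [|i ih]; first by rewrite addn1; have := eS J; have := e0 J; lra.
  by apply: lt_trans ih; rewrite addnS; have := eS (J + i.+1)%N; have := e0 (J + i.+1)%N; lra.
have e2 := eS (J + i.+1)%N; have e3 := e0 (J + i.+1)%N.
apply: bndW (bndD _ (e0 _) ih (xe (J + i.+1)%N)); lra.
Qed.

(** Uniform closeness of coefficients gives uniform closeness on each circle of radius r < 1, with
    the geometric factor 1 / (1 - r); Minkowski's inequality then passes the bound to the limit
    circle by circle. *)
Lemma bnd_limit c A (d : nat -> nat -> Cplx R) (D : R ^nat) : 0 < A ->
  (forall m, bnd (d m) A) -> (forall m k, nc ((c - d m) k) <= D m) -> D @ \oo --> (0 : R) ->
  bnd c A.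
Proof.
move=> A0 dA cD D0.
have cE m : c = d m + (c - d m) by rewrite addrC subrK.
have cc : coef_class 1 c.
  rewrite (cE 0%N); apply: coef_classD; first by case: (dA 0%N).
  exact: bounded_coef_class (cD 0%N).
split=> // r r01; have /andP[r0 r1] := r01; have r1' : 0 < 1 - r by rewrite subr_gt0.
(* The term 1 / (m + 1) keeps the second bound in Minkowski's inequality positive when [D m]
   vanishes. *)
have H m : Mp p (PS c) r <= (A + (D m / (1 - r) + m.+1%:R^-1)) `^ p.
  have cm := bounded_coef_class (cD m).
  have Dm : 0 <= D m := le_trans (nc_ge0 _) (cD m 0%N).
  rewrite (@eq_Mp _ (fun z => PS (d m) z + PS (c - d m) z))//; last first.
    by move=> z zr; rewrite {1}(cE m) PSD ?zr//; case: (dA m).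
  have [dm dmA] := dA m.
  have M0 : 0 <= D m / (1 - r) by rewrite divr_ge0// ltW.
  have V0 : 0 < m.+1%:R^-1 :> R by rewrite invr_gt0.
  apply: (minkowski_gauge p1 r0 (PS_circle dm r1) (PS_circle cm r1) A0 _ (dmA r r01)).
    by rewrite ltr_wpDl.
  apply: (Mp_bound p1 r0 (PS_circle cm r1)); first by rewrite addr_ge0// ltW.
  by move=> z zr; rewrite (le_trans (PS_le (cD m) _)) ?zr// lerDl ltW.
have L : (fun m => (A + (D m / (1 - r) + m.+1%:R^-1)) `^ p) @ \oo --> A `^ p.
  have L1 : (fun m => A + (D m / (1 - r) + m.+1%:R^-1)) @ \oo --> A.
    rewrite -[X in _ --> X]addr0; apply: cvgD; first exact: cvg_cst.
    rewrite -[X in _ --> X]addr0; apply: cvgD; last exact: cvg_harmonic.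
    by rewrite -(mul0r (1 - r)^-1); exact: cvgMl.
  have C : {for A, continuous (fun x : R => `|x| `^ p)}.
    by apply: (continuous_powR_comp p1 (fun s => normr_ge0 s)); exact: norm_continuous.
  have L2 : (fun x : R => `|x| `^ p) (A + (D m / (1 - r) + m.+1%:R^-1)) @[m --> \oo] -->
      (fun x : R => `|x| `^ p) A by exact: (cvg_comp _ _ L1 C).
  rewrite /= (gtr0_norm A0) in L2; apply: cvg_trans L2; apply: near_eq_cvg; apply: nearW => m /=.
  rewrite ger0_norm// addr_ge0 ?(ltW A0)// addr_ge0 ?invr_ge0// divr_ge0 ?(ltW r1')//.
  exact: le_trans (nc_ge0 _) (cD m 0%N).
rewrite -(cvg_lim (@Rhausdorff R) L); apply: limr_ge; first by apply/cvg_ex; eexists; exact: L.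
exact: nearW.
Qed.

(** Since the gauge controls every coefficient, the series converges entrywise, with tails at most 2
    eps_J uniformly in the index; [bnd_limit] lifts this from coefficients to the gauge. *)
Lemma bnd_complete (xi : nat -> nat -> Cplx R) (eps : nat -> R) :
  (forall j, 0 < eps j) -> (forall j, eps j.+1 <= eps j / 2) -> (forall j, bnd (xi j) (eps j)) ->
  exists y, forall j, bnd (y - \sum_(i < j) xi i) (2 * eps j).
Proof.
move=> e0 eS xe.
have eg j : eps j <= geometric (eps 0%N) 2^-1 j.
  elim: j => [|j ih]; first by rewrite /= expr0 mulr1.
  by rewrite (le_trans (eS j))// /= exprSr mulrA ler_pM2r// invr_gt0.
have g0 : geometric (eps 0%N) (2^-1 : R) @ \oo --> (0 : R).
  by apply: cvg_geometric; rewrite ger0_norm ?invr_ge0// invf_lt1// ltr1n.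
have e_0 : eps @ \oo --> (0 : R).
  apply: (@squeeze_cvgr _ _ _ _ (cst 0) (geometric (eps 0%N) (2^-1 : R))) => //; last exact: cvg_cst.
  by apply: nearW => j; rewrite (ltW (e0 j)) eg.
have ys k : exists l : Cplx R, series (fun i => xi i k) n @[n --> \oo] --> l.
  apply: (@cseries_cvg _ _ (geometric (eps 0%N) 2^-1)).
    by move=> i; rewrite (le_trans _ (eg i))// bnd_coef.
  by apply: is_cvg_geometric_series; rewrite ger0_norm ?invr_ge0// invf_lt1// ltr1n.
have [y yP] := choice ys.
have sE m k : (\sum_(i < m) xi i) k = series (fun i => xi i k) m.
  by rewrite seriesEord /= fct_sumE.
have tail J k : nc ((y - \sum_(i < J) xi i) k) <= 2 * eps J.
  have L : (fun n => series (fun i => xi i k) (J + n.+1)%N - series (fun i => xi i k) J) n @[n --> \oo] -->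
      y k - series (fun i => xi i k) J.
    apply: (@cvgB_c _ _ (fun=> series (fun i => xi i k) J)); last exact: cvg_cst.
    have := yP k; rewrite -(cvg_shiftn J.+1) => Y; apply: (eq_cvg_c _ Y) => n /=.
    by congr (series _ _); rewrite !addnS addnC.
  rewrite (_ : (y - _) k = y k - series (fun i => xi i k) J); last by rewrite -sE.
  apply: (nc_lim_le L) => n; rewrite -!sE.
  have H := sub_sum_le e0 eS xe J n.
  have e1 : eps (J + n.+1)%N < eps J.
    elim: n {H} => [|n ih]; first by rewrite addn1; have := eS J; have := e0 J; lra.
    by apply: lt_trans ih; rewrite addnS; have := eS (J + n.+1)%N; have := e0 (J + n.+1)%N; lra.
  apply: le_trans (bnd_coef k _ H) _; last by have := e0 (J + n.+1)%N; lra.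
  lra.
exists y => J.
apply: (@bnd_limit _ _ (fun m => \sum_(i < J + m.+1) xi i - \sum_(i < J) xi i) (fun m => 2 * eps (J + m.+1)%N)).
- by rewrite mulr_gt0.
- move=> m; have H := sub_sum_le e0 eS xe J m; have em := e0 (J + m.+1)%N.
  have e1 : eps (J + m.+1)%N < eps J.
    elim: m {H em} => [|m ih]; first by rewrite addn1; have := eS J; have := e0 J; lra.
    by apply: lt_trans ih; rewrite addnS; have := eS (J + m.+1)%N; have := e0 (J + m.+1)%N; lra.
  by apply: bndW H; lra.
- by move=> m k; rewrite opprB addrA subrK; exact: tail.
- rewrite -(mulr0 2); apply: cvgMr.
  have := e_0; rewrite -(cvg_shiftn J.+1); apply: cvg_trans.
  by apply: near_eq_cvg; apply: nearW => n /=; rewrite !addnS addnC.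
Qed.
End CoefficientSpace.

(** * Multipliers on H^p and their localization to circles *)

Section HardyOperators.
Context {R : realType}.
Variable p : R.
Hypothesis p1 : 1 <= p.
Let p0 : 0 < p. Proof. exact: lt_le_trans p1. Qed.
Implicit Types (f g : Cplx R -> Cplx R) (c d : nat -> Cplx R) (A B r s : R) (z w : Cplx R).

Lemma integral_meanE f r : 0 <= r -> on_circle r f -> integral_mean p f r = (Mp p f r)%:E.
Proof.
move=> r0 cf; rewrite /integral_mean.
have := EFin_Int (circle_pow_cont p1 r0 cf (a := 0) (b := pi *+ 2)).
rewrite /pt => ->; rewrite -EFinM mulrA mulVf ?mul1r//.
by rewrite gt_eqF// twopi_gt0.
Qed.

Lemma powR_root A : 0 <= A -> (A `^ p) `^ p^-1 = A.
Proof. by move=> A0; rewrite -powRrM mulfV ?powRr1// gt_eqF. Qed.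

Lemma root_powR A : 0 <= A -> (A `^ p^-1) `^ p = A.
Proof. by move=> A0; rewrite -powRrM mulVf ?powRr1// gt_eqF. Qed.

Lemma hardy_leP f A : 0 <= A -> (forall r, 0 <= r < 1 -> on_circle r f) ->
  (hardy_norm p f <= A%:E)%E <-> (forall r, 0 <= r < 1 -> Mp p f r <= A `^ p).
Proof.
move=> A0 cf; split=> [H r r01|H].
  have /andP[r0 r1] := r01.
  have : (integral_mean p f r `^ p^-1 <= A%:E)%E.
    by apply: le_trans H; apply: ereal_sup_ubound; exists r.
  rewrite (integral_meanE r0 (cf r r01)) poweR_EFin lee_fin => H'.
  rewrite -(root_powR (Mp_ge0 p f r)) ge0_ler_powR ?nnegrE ?powR_ge0 ?(ltW p0)//.
apply: ge_ereal_sup => _ [r /= r01 <-]; rewrite in_itv/= in r01.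
have /andP[r0 r1] := r01.
rewrite (integral_meanE r0 (cf r r01)) poweR_EFin lee_fin -(powR_root A0).
by rewrite ge0_ler_powR ?nnegrE ?powR_ge0 ?Mp_ge0 ?invr_ge0 ?(ltW p0)// H.
Qed.

Lemma eq_hardy f g : (forall z, nc z < 1 -> f z = g z) -> hardy_norm p f = hardy_norm p g.
Proof.
move=> fg; have E r : `[0, 1[%classic r -> integral_mean p f r = integral_mean p g r.
  rewrite /= in_itv/= => /andP[r0 r1]; rewrite /integral_mean; congr (_ * _)%E.
  apply: eq_integral => t _; congr (_ `^ p)%:E; congr Normc.normc; apply: fg.
  by rewrite -/(pt r t) nc_pt ger0_norm.
rewrite /hardy_norm; apply: f_equal; apply: eq_imagel => r /E Er.
exact: (f_equal (fun x => (x `^ p^-1)%E) Er).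
Qed.

Lemma bnd_hardy c A : 0 < A -> coef_class 1 c ->
  (hardy_norm p (PS c) <= A%:E)%E <-> bnd p c A.
Proof.
move=> A0 cc; have cf r : 0 <= r < 1 -> on_circle r (PS c).
  by move=> /andP[_ r1]; exact: PS_circle.
by rewrite (hardy_leP (ltW A0) cf); split=> [|[]].
Qed.

Variable a : nat -> nat -> Cplx R.
Hypothesis sa : forall n, cvgn (series (fun k => nc (a n k))).

Definition mul_coef n c : nat -> Cplx R := fun k => a n k * c k.
(* The Taylor coefficients of S_n f - f when those of f are c. *)
Definition Tm n c : nat -> Cplx R := mul_coef n c - c.

Let S n : R := limn (series (fun k => nc (a n k))).

Let S_ge n m : series (fun k => nc (a n k)) m <= S n.
Proof.
apply: nondecreasing_cvgn_le => //; apply: nondecreasing_series => k _ _; exact: nc_ge0.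
Qed.

Let a_le n k : nc (a n k) <= S n.
Proof.
apply: le_trans (S_ge n k.+1); rewrite /series /= big_nat_recr//= lerDr.
by rewrite sumr_ge0// => i _; exact: nc_ge0.
Qed.

Let S_ge0 n : 0 <= S n. Proof. exact: le_trans (nc_ge0 _) (a_le n 0%N). Qed.

Lemma mul_coef_class n c : coef_class 1 c -> coef_class 1 (mul_coef n c).
Proof.
move=> cc s s1; have [M HM] := cc s s1; have /andP[s0 _] := s1; exists (S n * M) => k.
rewrite /mul_coef ncM -mulrA; apply: ler_pM; rewrite ?nc_ge0 ?a_le//.
by rewrite mulr_ge0 ?nc_ge0 ?exprn_ge0.
Qed.

Lemma Tm_class n c : coef_class 1 c -> coef_class 1 (Tm n c).
Proof. by move=> cc; apply: coef_classD; [exact: mul_coef_class|exact: coef_classN]. Qed.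

Lemma PS_Tm n c z : coef_class 1 c -> nc z < 1 ->
  PS (Tm n c) z = PS (mul_coef n c) z - PS c z.
Proof.
move=> cc z1; rewrite /Tm PSD ?PSN//; [exact: mul_coef_class|exact: coef_classN].
Qed.

(** Coefficients are at most A, so S_n f is at most A times the sum of the |a_nk| on the disk. One
    summand 1 ensures positivity, the other accounts for subtracting f. The constant depends on
    n. *)
Lemma Tm_bnd n : exists2 B, 0 < B & forall c A, 0 < A -> bnd p c A -> bnd p (Tm n c) (B * A).
Proof.
have S1 : 0 < S n + 1 by rewrite ltr_wpDl.
exists (S n + 1 + 1); first by rewrite addr_gt0.
move=> c A A0 cA; have [cc _] := cA; rewrite mulrDl mul1r.
apply: (bndD p1 (mulr_gt0 S1 A0) A0 _ (bndN cA)).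
have mc := mul_coef_class n cc; split=> [|r /andP[r0 r1]]; first exact: mc.
apply: (Mp_bound p1 r0 (PS_circle mc r1)); first by rewrite mulr_ge0// ltW.
move=> z zr; have z1 : nc z < 1 by rewrite zr.
apply: (nc_lim_le (PS_cvg mc z1)) => m; rewrite /series /= (le_trans (nc_sum _ _ _))//.
apply: (@le_trans _ _ (series (fun k => nc (a n k)) m * A)).
  rewrite /series /= mulr_suml; apply: ler_sum => k _.
  rewrite /mul_coef !ncM ncX -mulrA ler_wpM2l ?nc_ge0// -[leRHS]mulr1.
  apply: ler_pM; rewrite ?nc_ge0 ?exprn_ge0 ?nc_ge0//; first exact: (bnd_coef p1).
  by rewrite exprn_ile1 ?nc_ge0// ltW.
by rewrite ler_wpM2r ?(ltW A0)// (le_trans (S_ge n m))// lerDl.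
Qed.

Lemma SA_PS n f z : SA a n f z = PS (mul_coef n (taylor_coef f)) z.
Proof. by []. Qed.

Hypothesis Hconv : forall f, holomorphic_disk f -> (hardy_norm p f < +oo)%E ->
  hardy_norm p (fun z => SA a n f z - f z) @[n --> \oo] --> 0%E.

Lemma Tm_hardy_cvg c A : 0 < A -> bnd p c A -> hardy_norm p (PS (Tm n c)) @[n --> \oo] --> 0%E.
Proof.
move=> A0 cA; have [cc _] := cA.
have fin : (hardy_norm p (PS c) < +oo)%E.
  by apply: (@le_lt_trans _ _ A%:E); [apply/bnd_hardy|exact: ltry].
have := Hconv (PS_holomorphic cc) fin.
apply: cvg_trans; apply: near_eq_cvg; apply: nearW => n.
apply: eq_hardy => z z1; rewrite SA_PS (PS_Tm n cc z1).
have -> : mul_coef n (taylor_coef (PS c)) = mul_coef n c; last by [].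
by apply/funext => k; rewrite /mul_coef PS_taylor.
Qed.

Lemma Tm_eventually c A (e : R) : 0 < A -> bnd p c A -> 0 < e ->
  exists N, forall n, (N <= n)%N -> bnd p (Tm n c) e.
Proof.
move=> A0 cA e0; have [cc _] := cA.
have := Tm_hardy_cvg A0 cA => H.
have : \forall n \near \oo, (hardy_norm p (PS (Tm n c)) < e%:E)%E.
  have := H [set x | (x < e%:E)%E]; apply.
  by apply: (@open_ereal_lt R e%:E); rewrite /= lte_fin.
move=> [N _ HN]; exists N => n Nn.
by apply/bnd_hardy => //; [exact: Tm_class|apply/ltW/HN].
Qed.

(** Convergence bounds all but finitely many terms by 1; the remaining ones have individual bounds,
    which are added up. *)
Lemma Tm_pt c A : 0 < A -> bnd p c A -> exists2 K, 0 < K & forall n, bnd p (Tm n c) K.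
Proof.
move=> A0 cA; have [N HN] := Tm_eventually A0 cA ltr01.
have /choice[B BP] : forall n : nat, exists B : R, 0 < B /\ bnd p (Tm n c) B.
  by move=> n; have [B B0 H] := Tm_bnd n; exists (B * A); split; [exact: mulr_gt0|exact: H].
have B0 n : 0 <= B n by case: (BP n) => /ltW.
exists (1 + \sum_(i < N) B i); first by rewrite ltr_pwDl// sumr_ge0.
move=> n; have [Nn|nN] := leqP N n.
  by apply: (bndW p1 ltr01 _ (HN n Nn)); rewrite lerDl sumr_ge0.
have [Bn H] := BP n; apply: (bndW p1 Bn _ H).
rewrite (bigD1 (Ordinal nN))//= addrCA lerDl addr_ge0// sumr_ge0//.
Qed.

Lemma Tm_uniform : exists2 C, 0 < C & forall n c A, 0 < A -> bnd p c A -> bnd p (Tm n c) (C * A).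
Proof.
apply: (@gliding_hump R (nat -> Cplx R) (@scaleC R) (bnd p) Tm).
- by move=> x y A B; exact: bndD.
- by move=> x A; exact: bndN.
- by move=> k x A; exact: bndS.
- by move=> x A B; exact: bndW.
- exact: bnd_complete.
- move=> k x k0; apply/funext => i; rewrite /scaleC mulrA -rmorphM /= mulVf ?mul1r//.
  by rewrite gt_eqF.
- by move=> x; apply/funext => i; rewrite /scaleC rmorph_nat mulr_natl mulr2n.
- by move=> n x y; apply/funext => i; rewrite /Tm /mul_coef !fctE; ring.
- by move=> n x; apply/funext => i; rewrite /Tm /mul_coef !fctE; ring.
- by move=> n k x; apply/funext => i; rewrite /Tm /mul_coef /scaleC !fctE; ring.
- exact: Tm_bnd.
- exact: Tm_pt.
Qed.

(** Coefficients of the dilate w -> f(u w); complex u covers dilations and rotations together. *)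
Definition dil (u : Cplx R) c : nat -> Cplx R := fun k => u ^+ k * c k.

Lemma PS_dil u c z : PS (dil u c) z = PS c (u * z).
Proof.
rewrite /PS; congr (limn (series _)); apply/funext => k.
by rewrite /dil exprMn mulrA (mulrC (c k)).
Qed.

Lemma Mp_dil r c s : Mp p (PS (dil r%:C%C c)) s = Mp p (PS c) (r * s).
Proof. by apply: eq_rmean => t; rewrite PS_dil (ptE s) (ptE (r * s)) mulrA -rmorphM. Qed.

Lemma dil_class u c : nc u <= 1 -> coef_class 1 c -> coef_class 1 (dil u c).
Proof.
move=> u1 cc s s1; have [M HM] := cc s s1; have /andP[s0 _] := s1.
exists M => k; apply: le_trans (HM k); rewrite ler_wpM2r ?exprn_ge0//.
by rewrite /dil ncM ncX ler_piMl ?nc_ge0// exprn_ile1 ?nc_ge0.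
Qed.

Lemma Tm_dil n u c : Tm n (dil u c) = dil u (Tm n c).
Proof. by apply/funext => k; rewrite /Tm /mul_coef /dil !fctE; ring. Qed.

(* A dilate of PS c lies in H^p with norm governed by a single circle, so the uniform bound on
   H^p localizes to circles. *)
Lemma Tm_dominated : exists2 C, 0 <= C & forall n c r, coef_class 1 c -> 0 < r < 1 ->
  Mp p (PS (Tm n c)) r <= C * Mp p (PS c) r.
Proof.
have [C C0 CP] := Tm_uniform; exists (C `^ p); first exact: powR_ge0.
move=> n c r cc r01; have /andP[r0 r1] := r01.
set m := Mp p (PS c) r; have m0 : 0 <= m := Mp_ge0 _ _ _.
(* Adding [e] keeps the gauge of the dilate positive even if the mean [m] vanishes. The gauge
   controls only radii s < 1 of the dilate; the circle of radius r itself is reached below by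
   continuity as s tends to 1. *)
have H e s : 0 < e -> 0 <= s < 1 -> Mp p (PS (Tm n c)) (r * s) <= C `^ p * (m + e).
  move=> e0 s01; have /andP[s0 s1] := s01.
  have me : 0 < m + e by rewrite ltr_wpDl.
  have A0 : 0 < (m + e) `^ p^-1 by rewrite powR_gt0.
  have b : bnd p (dil r%:C%C c) ((m + e) `^ p^-1).
    split=> [|s' /andP[s'0 s'1]].
      by apply: dil_class => //; rewrite nc_real gtr0_norm// ltW.
    rewrite Mp_dil root_powR ?(ltW me)//.
    have rs : r * s' < r by rewrite gtr_pMr.
    apply: le_trans (Mp_mono p1 (fun z => PS_derivable cc (z := z)) _ rs r1) _.
      by rewrite mulr_ge0// ltW.
    by rewrite lerDl ltW.
  have [_ /(_ s s01)] := CP n _ _ A0 b.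
  by rewrite Tm_dil Mp_dil powRM ?root_powR ?(ltW me) ?(ltW C0) ?(ltW A0).
apply/ler_addgt0Pr => e e0; pose e' := e / (C `^ p + 1).
have Cp : 0 < C `^ p + 1 by rewrite ltr_wpDl ?powR_ge0.
have e'0 : 0 < e' by rewrite divr_gt0.
apply: (@le_trans _ _ (C `^ p * (m + e'))); last first.
  rewrite mulrDr lerD2l /e' mulrA ler_pdivrMr// mulrC ler_wpM2l ?(ltW e0)//.
  by rewrite lerDl.
have ct := Tm_class n cc.
have cont : {for r, continuous (fun x => Mp p (PS (Tm n c)) x)}.
  apply: (Mp_continuous p1 (rho := 1)); last by rewrite gtr0_norm.
  by move=> z z1; apply/derivable_continuous/PS_derivable.
apply/ler_addgt0Pr => u u0.
move/cvgrPdist_lt: cont => /(_ u u0)/nbhs_ballP[dl /= dl0 HB].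
pose h := Num.min dl r / 2.
have mn : 0 < Num.min dl r by rewrite lt_min dl0.
have [h0 h1] := midf_lt mn; rewrite add0r in h0 h1.
have hd : h < dl by rewrite (lt_le_trans h1)// ge_min lexx.
have hr : h < r by rewrite (lt_le_trans h1)// ge_min lexx orbT.
have := HB (r - h); rewrite /ball /= subKr gtr0_norm// => /(_ hd).
have s01 : 0 <= (r - h) / r < 1.
  by rewrite divr_ge0 ?subr_ge0 ?ltW//= ltr_pdivrMr// mul1r gtrBl.
have := H e' _ e'0 s01; rewrite mulrC divfK ?gt_eqF//.
move=> H1 /ltW; rewrite ler_norml => /andP[_]; rewrite lerBlDr => H2.
by rewrite (le_trans H2)// addrC lerD2r.
Qed.

(** With |u| < s < 1 and u = s v, the dilate by s has bounded coefficients, and |v| < 1 gives a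
    geometric bound on the whole disk. *)
Lemma dil_bnd u c : nc u < 1 -> coef_class 1 c -> exists2 A, 0 < A & bnd p (dil u c) A.
Proof.
move=> u1 cc; have [us s1] := midf_lt u1; set s := (nc u + 1) / 2 in us s1.
have s0 : 0 < s := le_lt_trans (nc_ge0 u) us.
have s01 : 0 <= s < 1 by rewrite (ltW s0).
have [M HM] := cc s s01.
have M0 : 0 <= M.
  by apply: le_trans (HM 0%N); rewrite mulr_ge0 ?nc_ge0 ?exprn_ge0 ?(ltW s0).
have sc0 : s%:C%C != 0 :> Cplx R by rewrite -nc_eq0 nc_real normr_eq0 gt_eqF.
have cM k : nc (dil s%:C%C c k) <= M.
  by rewrite /dil ncM ncX nc_real (gtr0_norm s0) mulrC.
pose v : Cplx R := u / s%:C%C.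
have vE : nc v = nc u / s by rewrite /v ncM ncV nc_real gtr0_norm.
have v1 : nc v < 1 by rewrite vE ltr_pdivrMr// mul1r.
have cd := dil_class (ltW u1) cc.
have v1' : 0 < 1 - nc v by rewrite subr_gt0.
have B0 : 0 <= M / (1 - nc v) by rewrite divr_ge0// ltW.
exists (M / (1 - nc v) + 1); first by rewrite ltr_wpDl.
split=> // r /andP[r0 r1]; apply: (Mp_bound p1 r0 (PS_circle cd r1)); first by rewrite addr_ge0.
move=> z zr; have vz : nc (v * z) <= nc v.
  by rewrite ncM ler_piMr ?nc_ge0// zr ltW.
have vu : s%:C%C * v = u by rewrite mulrC divfK.
rewrite PS_dil -vu -mulrA -PS_dil.
apply: (le_trans (PS_le cM (le_lt_trans vz v1))).
apply: (@le_trans _ _ (M / (1 - nc v))); last by rewrite lerDl.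
rewrite ler_wpM2l// lef_pV2 ?posrE ?subr_gt0 ?(le_lt_trans vz)//.
by rewrite lerD2l lerN2.
Qed.


(* The mean of |PS c|^p over the circle through z; avg_dil views it as an H^p quantity. *)
Definition avg c z : R := rmean (fun t => nc (PS c (z * pt 1 t)) `^ p).

(** For a radius r strictly between |z| and 1, the circle through z is the image of the circle of
    radius r under multiplication by u = z / r. Strictness makes |u| < 1 and covers z = 0. *)
Lemma avg_dil z : nc z < 1 -> exists r u, [/\ 0 < r < 1, nc u < 1 &
  forall d t, PS d (z * pt 1 t) = PS (dil u d) (pt r t)].
Proof.
move=> z1; have [zr r1] := midf_lt z1; set r := (nc z + 1) / 2 in zr r1.
have r0 : 0 < r := le_lt_trans (nc_ge0 z) zr.
have rc0 : r%:C%C != 0 :> Cplx R by rewrite -nc_eq0 nc_real normr_eq0 gt_eqF.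
exists r, (z / r%:C%C); split; first by rewrite r0 r1.
  by rewrite ncM ncV nc_real (gtr0_norm r0) ltr_pdivrMr// mul1r.
by move=> d t; rewrite PS_dil (ptE r) mulrA divfK.
Qed.

Lemma avg_cont c z a0 b0 : coef_class 1 c -> nc z < 1 ->
  cont_on (fun t => nc (PS c (z * pt 1 t)) `^ p) a0 b0.
Proof.
move=> cc /avg_dil[r [u [/andP[r0 r1] u1 E]]].
have -> : (fun t => nc (PS c (z * pt 1 t)) `^ p) = (fun t => nc (PS (dil u c) (pt r t)) `^ p).
  apply/funext => t; exact: (f_equal (fun w => nc w `^ p) (E c t)).
exact: (circle_pow_cont p1 (ltW r0) (PS_circle (dil_class (ltW u1) cc) r1)).
Qed.

Lemma avg_Tm_dominated : exists2 C, 0 <= C & forall n c z, coef_class 1 c -> nc z < 1 ->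
  avg (Tm n c) z <= C * avg c z.
Proof.
have [C C0 CP] := Tm_dominated; exists C => // n c z cc /avg_dil[r [u [r01 u1 E]]].
have E' d : avg d z = Mp p (PS (dil u d)) r by apply: eq_rmean => t; rewrite E.
by rewrite !E' -Tm_dil; apply: CP => //; apply: dil_class cc; exact: ltW.
Qed.

Lemma avg_Tm_cvg c z : coef_class 1 c -> nc z < 1 -> avg (Tm n c) z @[n --> \oo] --> (0 : R).
Proof.
move=> cc /avg_dil[r [u [r01 u1 E]]]; have [A A0 cA] := dil_bnd u1 cc.
have /andP[r0 r1] := r01.
have E' d : avg d z = Mp p (PS (dil u d)) r by apply: eq_rmean => t; rewrite E.
apply/cvgrPdist_le => e e0.
(* A gauge bound enters the mean through its p-th power, so the root of [e] is the right
   tolerance. *)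
have e'0 : 0 < e `^ p^-1 by rewrite powR_gt0.
have [N HN] := Tm_eventually A0 cA e'0; exists N => // n /= /HN[_ /(_ r)].
rewrite (ltW r0) r1 Tm_dil -E' root_powR ?(ltW e0)// => /(_ isT) H.
by rewrite sub0r normrN ger0_norm// E' Mp_ge0.
Qed.

End HardyOperators.

(** * Rotation invariance and averaging over the disk *)

Section PlaneRotation.
Context {R : realType}.
Notation mu := (@lebesgue_measure R).
Notation mu2 := (mu \x mu)%E.
Implicit Types (F : R * R -> \bar R) (a c d : R).

(** By uniqueness of Lebesgue measure it suffices to compare lengths of half-open intervals. *)
Lemma lebesgue_measure_addr c (A : set R) : measurable A ->
  pushforward mu ((fun x : R => x + c) : _ -> measurableTypeR R) A = mu A.
Proof.
move=> mA; apply/esym/lebesgue_measure_unique => //=.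
  by apply: measurable_funD => //; exact: measurable_cst.
move=> mc _ [[u v]] _ <-.
rewrite /pushforward (_ : _ @^-1` _ = `]u - c, v - c]%classic); last first.
  by apply/seteqP; split => x /=; rewrite !in_itv/= ltrBlDr lerBrDr.
rewrite !lebesgue_measure_itv/= !lte_fin ltrD2r.
by case: ifP => // _; rewrite -!EFinB; congr EFin; rewrite opprB addrA subrK.
Qed.

Lemma integral_addr c (f : R -> \bar R) : measurable_fun [set: R] f -> (forall x, 0 <= f x)%E ->
  (\int[mu]_x f (x + c)%R = \int[mu]_x f x)%E.
Proof.
move=> mf f0; have mc : measurable_fun [set: R] ((fun x : R => x + c) : _ -> measurableTypeR R).
  by apply: measurable_funD => //; exact: measurable_cst.
have := @ge0_integral_pushforward _ _ (measurableTypeR R) (measurableTypeR R) R (fun x => x + c) mc mu setT f measurableT mf (fun x _ => f0 x).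
rewrite preimage_setT => <-; apply: eq_measure_integral => A mA _.
exact: lebesgue_measure_addr.
Qed.

Definition measurable_nonneg F := measurable_fun [set: R * R] F /\ forall x, (0 <= F x)%E.

(** On each horizontal slice the shear is a translation, so Tonelli's theorem reduces the claim to
    one dimension. *)
Lemma integral_shearl F a : measurable_nonneg F ->
  (\int[mu2]_x F ((x.1 + a * x.2)%R, x.2) = \int[mu2]_x F x)%E.
Proof.
move=> [mF F0].
have mS : measurable_fun [set: R * R] (fun x : R * R => (x.1 + a * x.2, x.2)).
  apply: measurable_fun_pair => //; apply: measurable_funD => //; exact: measurable_funM.
have mFS := measurableT_comp mF mS.
have E := @fubini_tonelli2 _ _ _ _ R mu mu _ mFS (fun x => F0 _).
rewrite -[LHS]/(\int[mu2]_x (F \o (fun x : R * R => ((x.1 + a * x.2)%R, x.2))) x)%E.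
rewrite E (@fubini_tonelli2 _ _ _ _ R mu mu _ mF F0).
apply: eq_integral => y _; rewrite /fubini_G /=.
apply: (@integral_addr (a * y) (fun x => F (x, y))) => //.
by apply: measurableT_comp.
Qed.

Lemma integral_shearr F a : measurable_nonneg F ->
  (\int[mu2]_x F (x.1, (x.2 + a * x.1)%R) = \int[mu2]_x F x)%E.
Proof.
move=> [mF F0].
have mS : measurable_fun [set: R * R] (fun x : R * R => (x.1, x.2 + a * x.1)).
  apply: measurable_fun_pair => //; apply: measurable_funD => //; exact: measurable_funM.
have mFS := measurableT_comp mF mS.
have E := @fubini_tonelli1 _ _ _ _ R mu mu _ mFS (fun x => F0 _).
rewrite -[LHS]/(\int[mu2]_x (F \o (fun x : R * R => (x.1, (x.2 + a * x.1)%R))) x)%E.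
rewrite E (@fubini_tonelli1 _ _ _ _ R mu mu _ mF F0).
apply: eq_integral => x _; rewrite /fubini_F /=.
apply: (@integral_addr (a * x) (fun y => F (x, y))) => //.
by apply: measurableT_comp.
Qed.

Definition rotation c d (x : R * R) := (x.1 * c - x.2 * d, x.1 * d + x.2 * c).

Lemma measurable_rot c d : measurable_fun [set: R * R] (rotation c d).
Proof.
apply: measurable_fun_pair.
  by apply: measurable_funB; apply: measurable_funM.
by apply: measurable_funD; apply: measurable_funM.
Qed.

(* A rotation by an angle s <> pi is a product of three shears, with slopes -tan(s/2), sin s, -tan(s/2). *)
Lemma integral_rot_neq F c d : measurable_nonneg F -> c ^+ 2 + d ^+ 2 = 1 -> c != -1 ->
  (\int[mu2]_x F (rotation c d x) = \int[mu2]_x F x)%E.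
Proof.
move=> nF cd c1; have c10 : 1 + c != 0 by rewrite addrC addr_eq0.
pose t := - d / (1 + c).
pose F1 x := F (x.1 + t * x.2, x.2).
pose F2 x := F1 (x.1, x.2 + d * x.1).
have nS (G : R * R -> \bar R) u : measurable_nonneg G ->
    measurable_nonneg (fun x => G (x.1 + u * x.2, x.2)).
  move=> [mG G0]; split=> // ; apply: (measurableT_comp mG).
  apply: measurable_fun_pair => //; apply: measurable_funD => //; exact: measurable_funM.
have nT (G : R * R -> \bar R) u : measurable_nonneg G ->
    measurable_nonneg (fun x => G (x.1, x.2 + u * x.1)).
  move=> [mG G0]; split=> // ; apply: (measurableT_comp mG).
  apply: measurable_fun_pair => //; apply: measurable_funD => //; exact: measurable_funM.
have n1 : measurable_nonneg F1 := nS _ _ nF.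
have n2 : measurable_nonneg F2 := nT _ _ n1.
rewrite -(integral_shearl t nF) -/F1 -(integral_shearr d n1) -(integral_shearl t n2).
apply: eq_integral => -[x y] _; rewrite /F2 /F1 /rotation /=.
have E1 : 1 + t * d = c.
  have d2 : d ^+ 2 = 1 - c ^+ 2 by rewrite -cd addrC addKr.
  apply: (mulIf c10); transitivity (1 + c - d ^+ 2); last by rewrite d2; ring.
  by rewrite /t; field.
have E2 : t + t + t * t * d = - d.
  rewrite -[RHS]mulr1 -mulrA -[t * d](addrK 1) (addrC _ 1) E1.
  by rewrite /t; field.
have H1 (u v : R) : u * c - v * d = u + t * v + t * (v + d * (u + t * v)).
  transitivity (u * (1 + t * d) + v * (t + t + t * t * d)); last by ring.
  by rewrite E1 E2 mulrN.
have H2 (u v : R) : u * d + v * c = v + d * (u + t * v).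
  by transitivity (u * d + v * (1 + t * d)); [rewrite E1|ring].
by congr (F (_, _)); [exact: H1|exact: H2].
Qed.

(** The half turn, for which the slope tan(s/2) is undefined, is a product of two quarter turns. *)
Lemma integral_rot F c d : measurable_nonneg F -> c ^+ 2 + d ^+ 2 = 1 ->
  (\int[mu2]_x F (rotation c d x) = \int[mu2]_x F x)%E.
Proof.
move=> nF cd; have [c1|] := eqVneq c (-1); last exact: integral_rot_neq.
have d0 : d = 0.
  by apply/eqP; rewrite -sqrf_eq0; move: cd; rewrite c1 sqrrN expr1n => /eqP; rewrite addrC eq_sym -subr_eq subrr eq_sym.
have nQ : measurable_nonneg (F \o rotation 0 1).
  by case: nF => mF F0; split=> [|x]; [exact: measurableT_comp mF (measurable_rot _ _)|exact: F0].
have q1 : (0 : R) ^+ 2 + 1 ^+ 2 = 1 by rewrite expr0n expr1n add0r.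
have q0 : (0 : R) != -1 by rewrite eq_sym oppr_eq0 oner_eq0.
rewrite -[RHS](integral_rot_neq nF q1 q0) -(integral_rot_neq nQ q1 q0).
apply: eq_integral => -[x y] _; rewrite /= /rotation /= c1 d0; congr (F (_, _)); ring.
Qed.

End PlaneRotation.

(** * Averaging the Bergman integrand over rotations *)

Section BergmanAverage.
Context {R : realType}.
Notation mu := (@lebesgue_measure R).
Notation mu2 := (mu \x mu)%E.
Variable p : R.
Hypothesis p1 : 1 <= p.
Let p0 : 0 < p. Proof. exact: lt_le_trans p1. Qed.
Implicit Types (c : nat -> Cplx R) (x : R * R).

Definition plane x : Cplx R := cpt x.1 x.2.

Lemma nc_plane_lt1 x : unit_disk x <-> nc (plane x) < 1.
Proof.
rewrite /unit_disk /plane /cpt /=.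
by rewrite -[X in _ <-> is_true (_ < X)](@sqrtr1 R) ltr_sqrt.
Qed.

Lemma measurable_unit_disk : measurable (@unit_disk R : set (R * R)).
Proof.
have mf : measurable_fun [set: R * R] (fun x : R * R => x.1 ^+ 2 + x.2 ^+ 2).
  by apply: measurable_funD; apply: measurable_funX.
have := mf measurableT `]-oo, 1[%classic (measurable_itv _).
by rewrite setTI; congr measurable; apply/seteqP; split => x /=; rewrite in_itv.
Qed.

(** Measurability is carried through sums and products by real and imaginary parts; the modulus is
    the power 1/2 of the sum of their squares. *)
Lemma measurable_psum c m : measurable_fun [set: R * R] (fun x => nc (series (fun k => c k * plane x ^+ k) m)).
Proof.
pose M (u : R * R -> Cplx R) := measurable_fun [set: R * R] (fun x => complex.Re (u x)) /\
  measurable_fun [set: R * R] (fun x => complex.Im (u x)).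
have MM (u v : R * R -> Cplx R) : M u -> M v -> M (fun x => u x * v x).
  move=> [u1 u2] [v1 v2]; split.
    rewrite (_ : (fun x => _) = (fun x => complex.Re (u x) * complex.Re (v x) - complex.Im (u x) * complex.Im (v x))).
      by apply: measurable_funB; exact: measurable_funM.
    by apply/funext => x; case: (u x) (v x) => a b [a' b'].
  rewrite (_ : (fun x => _) = (fun x => complex.Re (u x) * complex.Im (v x) + complex.Im (u x) * complex.Re (v x))).
    by apply: measurable_funD; exact: measurable_funM.
  by apply/funext => x; case: (u x) (v x) => a b [a' b'].
have MD (u v : R * R -> Cplx R) : M u -> M v -> M (fun x => u x + v x).
  move=> [u1 u2] [v1 v2]; split.
    rewrite (_ : (fun x => _) = (fun x => complex.Re (u x) + complex.Re (v x))).
      exact: measurable_funD.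
    by apply/funext => x; case: (u x) (v x) => a b [a' b'].
  rewrite (_ : (fun x => _) = (fun x => complex.Im (u x) + complex.Im (v x))).
    exact: measurable_funD.
  by apply/funext => x; case: (u x) (v x) => a b [a' b'].
have Mc (z : Cplx R) : M (fun=> z) by split; exact: measurable_cst.
have Mp : M plane by split; [exact: measurable_fst|exact: measurable_snd].
have MX k : M (fun x => plane x ^+ k).
  elim: k => [|k ih]; first exact: Mc.
  rewrite (_ : (fun x => _) = (fun x => plane x * plane x ^+ k)); first exact: MM.
  by apply/funext => x; rewrite exprS.
have MS : M (fun x => series (fun k => c k * plane x ^+ k) m).
  rewrite /series /=; elim: m => [|m ih].
    rewrite (_ : (fun x => _) = fun=> 0); first exact: Mc.
    by apply/funext => x; rewrite big_geq.
  rewrite (_ : (fun x => _) = (fun x => \sum_(0 <= k < m) c k * plane x ^+ k + c m * plane x ^+ m)).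
    by apply: MD => //; apply: MM.
  by apply/funext => x; rewrite big_nat_recr.
have [r1 i1] := MS; pose S x : Cplx R := series (fun k => c k * plane x ^+ k) m.
rewrite (_ : (fun x => _) = (fun x => (complex.Re (S x) ^+ 2 + complex.Im (S x) ^+ 2) `^ 2^-1)).
  apply: (measurableT_comp (@measurable_powR R _)).
  by apply: measurable_funD; apply: measurable_funX.
apply/funext => x; rewrite -/(S x); case: (S x) => a b /=.
by rewrite powR12_sqrt// addr_ge0// sqr_ge0.
Qed.

Definition weight c x : \bar R := (nc (PS c (plane x)) `^ p)%:E.

Lemma measurable_weight c : coef_class 1 c -> measurable_fun (@unit_disk R) (weight c).
Proof.
move=> cc; apply/measurable_EFinP.
apply: (measurableT_comp (@measurable_powR R p)).
apply: (@measurable_fun_cvg _ _ _ _ (fun m x => nc (series (fun k => c k * plane x ^+ k) m))).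
  by move=> m; apply: measurable_funTS; exact: measurable_psum.
move=> x /nc_plane_lt1 x1; have /cvgn_ncP H := PS_cvg cc x1.
apply/cvgrPdist_le => e e0; move/cvgrPdist_le: H => /(_ e e0).
apply: filterS => n; rewrite sub0r normrN ger0_norm ?nc_ge0// => H.
by rewrite distrC; apply: le_trans H; exact: contr1_nc.
Qed.

(** The extension by zero lives on the whole plane, where rotation invariance of the integral is
    available. *)
Definition weight0 c : R * R -> \bar R := weight c \_ (@unit_disk R).

Lemma weight0_nonneg c : coef_class 1 c -> measurable_nonneg (weight0 c).
Proof.
move=> cc; split=> [|x].
  by apply/(measurable_restrictT _ measurable_unit_disk); exact: measurable_weight.
by rewrite /weight0 patchE; case: ifP => // _; rewrite lee_fin powR_ge0.
Qed.

Lemma plane_rot t x : plane (rotation (cos t) (sin t) x) = plane x * pt 1 t.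
Proof. by rewrite /plane /rotation /pt !mul1r. Qed.

Lemma weight0_rot c t x : weight0 c (rotation (cos t) (sin t) x) =
  ((fun x => (nc (PS c (plane x * pt 1 t)) `^ p)%:E) \_ (@unit_disk R)) x.
Proof.
have E : nc (plane (rotation (cos t) (sin t) x)) = nc (plane x).
  by rewrite plane_rot ncM nc_pt normr1 mulr1.
have D : (rotation (cos t) (sin t) x \in @unit_disk R) = (x \in @unit_disk R).
  by apply/idP/idP; rewrite !inE => /nc_plane_lt1 H; apply/nc_plane_lt1; move: H; rewrite E.
have P (F : R * R -> \bar R) y : (F \_ (@unit_disk R)) y = if y \in @unit_disk R then F y else 0%E.
  exact: patchE.
have W : weight c (rotation (cos t) (sin t) x) = (nc (PS c (plane x * pt 1 t)) `^ p)%:E.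
  exact: (f_equal (fun z => (nc (PS c z) `^ p)%:E) (plane_rot t x)).
transitivity (if x \in @unit_disk R then (nc (PS c (plane x * pt 1 t)) `^ p)%:E else 0%E).
  rewrite -D -W; exact: P.
exact: (esym (P (fun x => (nc (PS c (plane x * pt 1 t)) `^ p)%:E) x)).
Qed.

Lemma avg_ge0 c z : 0 <= avg p c z.
Proof.
rewrite /avg /rmean mulr_ge0 ?invr_ge0 ?(ltW twopi_gt0)//.
by apply: Rintegral_ge0 => t _; exact: powR_ge0.
Qed.

Let I := `[0%R, pi *+ 2]%classic : set R.
Let G c (y : (R * R) * R) := weight0 c (rotation (cos y.2) (sin y.2) y.1).

Let mG c : coef_class 1 c -> measurable_fun [set: (R * R) * R] (G c).
Proof.
move=> cc; have [mW _] := weight0_nonneg cc; apply: (measurableT_comp mW).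
have mc : measurable_fun [set: (R * R) * R] (fun y => cos y.2).
  by apply: measurableT_comp => //; apply: continuous_measurable_fun; exact: continuous_cos.
have ms : measurable_fun [set: (R * R) * R] (fun y => sin y.2).
  by apply: measurableT_comp => //; apply: continuous_measurable_fun; exact: continuous_sin.
have m1 : measurable_fun [set: (R * R) * R] (fun y => y.1.1).
  by apply: (measurableT_comp measurable_fst measurable_fst).
have m2 : measurable_fun [set: (R * R) * R] (fun y => y.1.2).
  by apply: (measurableT_comp measurable_snd measurable_fst).
apply: measurable_fun_pair.
  by apply: measurable_funB; exact: measurable_funM.
by apply: measurable_funD; exact: measurable_funM.
Qed.

Let G0 c y : coef_class 1 c -> (0 <= G c y)%E.
Proof. by move=> cc; case: (weight0_nonneg cc) => _; apply. Qed.

Let GI c x : coef_class 1 c -> unit_disk x ->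
  (\int[mu]_(t in I) G c (x, t) = ((pi *+ 2) * avg p c (plane x))%:E)%E.
Proof.
move=> cc xD; have x1 := (nc_plane_lt1 x).1 xD.
rewrite -(EFin_Int (avg_cont p1 (a0 := 0) (b0 := pi *+ 2) cc x1)).
apply: eq_integral => t _; rewrite /G weight0_rot patchE mem_set//.
Qed.

(** Tonelli's theorem provides measurability of the integral over the angle, which on the disk is 2
    pi times the average. *)
Lemma measurable_avg c : coef_class 1 c ->
  measurable_fun (@unit_disk R) (fun x => (avg p c (plane x))%:E).
Proof.
move=> cc; have mI : measurable I by exact: measurable_itv.
have := @measurable_tonelli_on _ _ _ _ R mu _ I _ measurable_unit_disk mI (mG cc) (fun y => G0 y cc).
move=> H; have H' : measurable_fun (@unit_disk R) (fun x => ((pi *+ 2) * avg p c (plane x))%:E).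
  by apply: eq_measurable_fun H => x; rewrite inE => xD; rewrite GI.
move/measurable_EFinP: H' => H'; apply/measurable_EFinP.
have := @measurable_funM _ _ R _ (cst (pi *+ 2)^-1) _ (measurable_cst _) H'.
by apply: eq_measurable_fun => x _ /=; rewrite mulKf// gt_eqF// twopi_gt0.
Qed.

Lemma sigma_finite_plane : sigma_finite setT mu2.
Proof.
exists (fun n => `[- n%:R, n%:R]%classic `*` `[- n%:R, n%:R]%classic).
  apply/seteqP; split => // -[u v] _.
  have B : `|u| + `|v| < (Num.bound (`|u| + `|v|))%:R by rewrite archi_boundP// addr_ge0.
  exists (Num.bound (`|u| + `|v|)) => //.
  by split; rewrite /= in_itv /= -ler_norml ltW// (le_lt_trans _ B)// ?lerDl ?lerDr.
move=> n; split; first by apply: measurableX; exact: measurable_itv.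
have L : (mu `[(- n%:R)%R, n%:R%R]%classic < +oo)%E.
  by rewrite lebesgue_measure_itv /=; case: ifP => _; rewrite ?ltry// -EFinD ltry.
rewrite product_measure1E; [|exact: measurable_itv|exact: measurable_itv].
by apply: lte_mul_pinfty; rewrite ?ge0_fin_numE.
Qed.

(** The rotated weight is integrated over disk and angle in both orders. For a fixed angle, rotation
    invariance removes the rotation; for a fixed point, the angular integral is 2 pi times the
    average. *)
Lemma integral_avg c : coef_class 1 c ->
  (\int[mu2]_(x in @unit_disk R) weight c x = \int[mu2]_(x in @unit_disk R) (avg p c (plane x))%:E)%E.
Proof.
move=> cc; have mI : measurable I by exact: measurable_itv.
have tp := @twopi_gt0 R.
have T : (\int[mu2]_(x in @unit_disk R) \int[mu]_(t in I) G c (x, t) =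
    \int[mu]_(t in I) \int[mu2]_(x in @unit_disk R) G c (x, t))%E.
  (* The canonical sigma-finite structure on a product only covers subprobabilities. *)
  pose M : {sigma_finite_measure set (measurableTypeR R * measurableTypeR R)%type -> \bar R} :=
    HB.pack mu2 (Measure_isSigmaFinite.Build _ _ _ mu2 sigma_finite_plane).
  exact: (tonelli_on M mu measurable_unit_disk mI (mG cc) (fun y => G0 y cc)).
have R1 : (\int[mu]_(t in I) \int[mu2]_(x in @unit_disk R) G c (x, t) =
    (pi *+ 2)%:E * \int[mu2]_(x in @unit_disk R) weight c x)%E.
  transitivity (\int[mu]_(t in I) cst (\int[mu2]_(x in @unit_disk R) weight c x) t)%E.
    apply: eq_integral => t _; rewrite /=.
    transitivity (\int[mu2]_x weight0 c (rotation (cos t) (sin t) x))%E.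
      rewrite integral_mkcond; apply: eq_integral => x _.
      rewrite patchE; case: ifPn => [_|xD]; first by [].
      by rewrite weight0_rot patchE (negbTE xD).
    rewrite (integral_rot (weight0_nonneg cc) (cos2Dsin2 t)).
    by rewrite [RHS]integral_mkcond.
  have mIE : mu I = (pi *+ 2)%:E by rewrite /I lebesgue_measure_itv/= lte_fin tp sube0.
  by rewrite -mIE muleC; exact: integral_cst.
have R2 : (\int[mu2]_(x in @unit_disk R) \int[mu]_(t in I) G c (x, t) =
    (pi *+ 2)%:E * \int[mu2]_(x in @unit_disk R) (avg p c (plane x))%:E)%E.
  rewrite -ge0_integralZl_EFin ?(ltW tp)//.
  - by apply: eq_integral => x; rewrite inE => xD; rewrite GI// EFinM.
  - exact: measurable_unit_disk.
  - by move=> x _; rewrite lee_fin avg_ge0.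
  - exact: measurable_avg.
have : ((pi *+ 2)%:E * \int[mu2]_(x in @unit_disk R) weight c x =
  (pi *+ 2)%:E * \int[mu2]_(x in @unit_disk R) (avg p c (plane x))%:E)%E by rewrite -R1 -R2 T.
move/(f_equal (fun y : \bar R => ((pi *+ 2)^-1)%:E * y)%E).
by rewrite !muleA -EFinM mulVf ?gt_eqF// !mul1e.
Qed.

End BergmanAverage.

(** * Dominated convergence on the disk *)

Theorem theorem5p5 (R : realType) (p : R) (a : nat -> nat -> Cplx R) :
  1 <= p ->
  (forall n : nat, cvgn (series (fun k => Normc.normc (a n k)))) ->
  (forall f : Cplx R -> Cplx R, holomorphic_disk f -> (hardy_norm p f < +oo)%E ->
     hardy_norm p (fun z => SA a n f z - f z) @[n --> \oo] --> 0%E) ->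
  (forall g : Cplx R -> Cplx R, holomorphic_disk g -> (bergman_norm p g < +oo)%E ->
     bergman_norm p (fun z => SA a n g z - g z) @[n --> \oo] --> 0%E).
Proof.
move=> p1 sa Hconv g hg bg; have p0 : 0 < p := lt_le_trans ltr01 p1.
have pV0 : 0 < p^-1 by rewrite invr_gt0.
have pi0 : 0 < (pi : R)^-1 by rewrite invr_gt0 pi_gt0.
set mu2 := (@lebesgue_measure R \x @lebesgue_measure R)%E.
set D := @unit_disk R; have mD : measurable D := measurable_unit_disk.
pose c := taylor_coef g; have [gc _] := holomorphic_has_pow hg.
have [cc _] := gc.
have gE z : nc z < 1 -> g z = PS c z by move=> z1; apply/esym/PS_eq; case: gc => _; apply.
have bE (f : Cplx R -> Cplx R) d : coef_class 1 d -> (forall z, nc z < 1 -> f z = PS d z) ->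
    bergman_norm p f = (((pi^-1)%:E * \int[mu2]_(x in D) (avg p d (plane x))%:E) `^ p^-1)%E.
  move=> cd fE; rewrite /bergman_norm; congr ((_ * _) `^ _)%E.
  rewrite -(integral_avg p1 cd); apply: eq_integral => x; rewrite inE => /nc_plane_lt1 x1.
  by rewrite /weight fE.
have cT n := Tm_class sa n cc.
have dE n := bE _ _ (cT n) (fun z z1 => etrans (congr2 (fun u v => u - v) (SA_PS a n g z) (gE z z1)) (esym (PS_Tm sa n cc z1))).
have mT n := measurable_avg p1 (cT n).
(* An infinite integral would make the Bergman norm of g infinite, as its p-th root would be
   infinite too. *)
have fin : (\int[mu2]_(x in D) (avg p c (plane x))%:E < +oo)%E.
  rewrite ltey; apply/eqP => E; move: bg; rewrite (bE g c cc gE) E.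
  by rewrite gt0_muley ?lte_fin// poweRyr ?gt_eqF// ltxx.
have [C C0 CP] := avg_Tm_dominated p1 sa Hconv.
have ig : mu2.-integrable D (fun x => (C * avg p c (plane x))%:E).
  apply/integrableP; split.
    by apply/measurable_EFinP; apply: measurable_funM => //; apply/measurable_EFinP; exact: measurable_avg.
  have -> : (\int[mu2]_(x in D) `|(C * avg p c (plane x))%:E| = C%:E * \int[mu2]_(x in D) (avg p c (plane x))%:E)%E.
    rewrite -ge0_integralZl_EFin//; last 2 first.
    - by move=> x _; rewrite lee_fin avg_ge0.
    - exact: measurable_avg.
    by apply: eq_integral => x _; rewrite gee0_abs ?EFinM// lee_fin mulr_ge0// avg_ge0.
  exact: lte_mul_pinfty.
have lim : (\int[mu2]_(x in D) (avg p (Tm a n c) (plane x))%:E)%E @[n --> \oo] --> 0%E.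
  have [] := @dominated_convergence _ _ R mu2 D mD (fun n x => (avg p (Tm a n c) (plane x))%:E)
    (cst 0%E) _ mT (measurable_cst _) _ ig.
  - apply: aeW => x /nc_plane_lt1 x1; apply: cvg_EFin; first exact: nearW.
    exact: (avg_Tm_cvg p1 sa Hconv cc x1).
  - apply: aeW => x n /nc_plane_lt1 x1; rewrite gee0_abs ?lee_fin ?avg_ge0//.
    exact: CP.
  - by move=> _ _; rewrite integral0.
(* Convergence to 0 makes the integrals finite eventually, which is enough to take p-th roots in the
   reals and return to extended reals at the end. *)
have /fine_cvgP[finn lim'] := lim.
have L : (fun n => (pi^-1 * fine (\int[mu2]_(x in D) (avg p (Tm a n c) (plane x))%:E)%E) `^ p^-1) @ \oo --> (0 : R).
  apply/cvgrPdist_le => e e0.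
  (* This tolerance becomes [e] after division by pi and extraction of the p-th root. *)
  have e'0 : 0 < pi * e `^ p by rewrite mulr_gt0 ?pi_gt0 ?powR_gt0.
  move/cvgrPdist_le: lim' => /(_ _ e'0); apply: filterS => n.
  rewrite !sub0r !normrN => H; rewrite ger0_norm ?powR_ge0//.
  rewrite -(powR_root p1 (ltW e0)) ge0_ler_powR ?nnegrE ?powR_ge0 ?(ltW pV0)//.
    by rewrite mulr_ge0 ?(ltW pi0)// fine_ge0// integral_ge0// => x _; rewrite lee_fin avg_ge0.
  by rewrite ler_pdivrMl ?pi_gt0// (le_trans (ler_norm _) H).
have bn n : (\int[mu2]_(x in D) (avg p (Tm a n c) (plane x))%:E)%E \is a fin_num ->
    bergman_norm p (fun z => SA a n g z - g z) =
    ((pi^-1 * fine (\int[mu2]_(x in D) (avg p (Tm a n c) (plane x))%:E)%E) `^ p^-1)%:E.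
  by move=> fn; rewrite dE -poweR_EFin EFinM fineK.
apply/fine_cvgP; split; first by apply: filterS finn => n /bn ->.
by apply: cvg_trans L; apply: near_eq_cvg; apply: filterS finn => n /bn /= ->.
Qed.
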